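(* Let $\mathcal D$ be an algebraic triangulated category, $(\mathcal D^{\le0},\mathcal D^{\ge0})$ a $t$-structure on $\mathcal D$ with truncation functors $\tau_{\le m},\tau_{\ge m}$ and cohomology functors $H^i_{\mathcal D}$ to the heart, and $n$ a positive integer; put $\mathcal D^{[-n+1,0]}=\mathcal D^{\le0}\cap\mathcal D^{\ge-n+1}$. Then the following hold. (i) $\mathcal D^{[-n+1,0]}$ admits a pretriangulated structure $(\Omega,\Sigma,\Delta,\nabla)$ where: - $\Omega:=\tau_{\le0}\circ[-1]$ and $\Sigma:=\tau_{\ge-n+1}\circ[1]$; - $\Delta$ is the class of triangles isomorphic to $\tau_{\le0}(Y[-1])\to\tau_{\le0}(\mathrm{Cone} f[-1])\to X\xrightarrow{f}Y$, for $f:X\to Y$ a morphism of $\mathcal D^{[-n+1,0]}$; - $\nabla$ is the class of triangles isomorphic to $X\xrightarrow{f}Y\to\tau_{\ge-n+1}\mathrm{Cone} f\to\tau_{\ge-n+1}(X[1])$, for $f:X\to Y$ a morphism of $\mathcal D^{[-n+1,0]}$. (ii) $\mathcal D^{[-n+1,0]}$ admits an extriangulated structure such that: - its conflations are the distinguished triangles $A\to B\to C\overset{\delta}{\dashrightarrow}$ of $\mathcal D$ all of whose terms $A,B,C$ lie in $\mathcal D^{[-n+1,0]}$; - for a morphism $f:X\to Y$ in $\mathcal D^{[-n+1,0]}$ the following are equivalent: (1) $f$ is an inflation; (2) $H^{-n+1}_{\mathcal D}(f)$ is a monomorphism in the heart; (3) $\Omega^{n-1}(f)$ is a monomorphism in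 $\mathcal D^{[-n+1,0]}$; - for a morphism $f:X\to Y$ in $\mathcal D^{[-n+1,0]}$ the following are equivalent: (1) $f$ is a deflation; (2) $H^{0}_{\mathcal D}(f)$ is an epimorphism in the heart; (3) $\Sigma^{n-1}(f)$ is an epimorphism in $\mathcal D^{[-n+1,0]}$. (iii) For every morphism $f:X\to Y$ in $\mathcal D^{[-n+1,0]}$ there exists a factorization $f=m_n\circ e_1$ in $\mathcal D^{[-n+1,0]}$ such that: - $H^{-n+1}_{\mathcal D}(m_n)$ is a monomorphism in the heart, or equivalently $\Omega^{n-1}(m_n)$ is a monomorphism in $\mathcal D^{[-n+1,0]}$; - $H^{-n+1}_{\mathcal D}(e_1)$ is an epimorphism and $H^{i}_{\mathcal D}(e_1)$ is an isomorphism for all $i\ge-n+2$ in the heart, or equivalently $e_1$ is an epimorphism and $\Sigma^{i}(e_1)$ is an isomorphism for all $i\ge1$ in $\mathcal D^{[-n+1,0]}$; and this factorization is unique up to isomorphism. (iii)' Dually, for every morphism $f:X\to Y$ in $\mathcal D^{[-n+1,0]}$ there exists a factorization $f=m_1\circ e_n$ in $\mathcal D^{[-n+1,0]}$ such that: - $H^{0}_{\mathcal D}(e_n)$ is an epimorphism in the heart, or equivalently $\Sigma^{n-1}(e_n)$ is an epimorphism in $\mathcal D^{[-n+1,0]}$; - $H^{0}_{\mathcal D}(m_1)$ is a monomorphism and $H^{i}_{\mathcal D}(m_1)$ is an isomorphism for all $i\le-1$ in the heart, or equivalently $m_1$ is a monomorphism and $\Omega^{i}(m_1)$ is an isomorphism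 for all $i\ge1$ in $\mathcal D^{[-n+1,0]}$; and this factorization is unique up to isomorphism.
   Context: An algebraic triangulated category is one that is triangle equivalent to $H^0$ of a pretriangulated DG-category (over a commutative ring $k$). The heart is $\mathcal D^{\le0}\cap\mathcal D^{\ge0}$, and $H^i_{\mathcal D}(X)=\tau_{\le0}\tau_{\ge0}(X[i])$. The unnamed maps in $\Delta$ and $\nabla$ are the canonical ones induced from the distinguished triangle $X\xrightarrow fY\to\mathrm{Cone}f\to X[1]$ and its rotations by truncation. Uniqueness of a factorization $f=m\circ e$ up to isomorphism means that for another such factorization $f=m'\circ e'$ there is an isomorphism $t$ between the middle objects with $te=e'$, $m't=m$. **Left triangulated categories.** Let $\mathcal C$ be additive, $\Omega:\mathcal C\to\mathcal C$ an additive functor, and $\Delta$ a class of diagrams (''triangles'') $\Omega A\to C\to B\to A$ closed under isomorphism (a morphism of triangles is a triple $(\gamma,\beta,\alpha)$ which together with $\Omega\alpha$ makes all squares commute). $(\mathcal C,\Omega,\Delta)$ is left triangulated if: (LT1) $0\to A= A\to0$ is in $\Delta$ for every $A$, and every $f:B\to A$ fits into some $\Omega A\to C\to B\xrightarrow{f}A$ in $\Delta$. (LT2) If $\Omega A\xrightarrow{h}C\xrightarrow{g}B\xrightarrow{f}A$ is in $\Delta$, so is $\Omega B\xrightarrow{-\Omega f}\Omega A\xrightarrow{h}C\xrightarrow{g}B$. (LT3) Given two triangles in $\Delta$ and $(\beta,\alpha)$ making the rightmost square commute, there is $\gamma$ such that $(\gamma,\beta,\alpha)$ is a morphism of triangles.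 (LT4) Given $\Omega A\xrightarrow{f''}F\xrightarrow{f'}B\xrightarrow{f}A$ and $\Omega B\xrightarrow{g''}E\xrightarrow{g'}C\xrightarrow{g}B$ in $\Delta$, there are triangles $\Omega A\xrightarrow{v''}D\xrightarrow{v'}C\xrightarrow{f\circ g}A$ and $\Omega F\xrightarrow{u''}E\xrightarrow{u'}D\xrightarrow{u}F$ in $\Delta$ with $v'u'=g'$, $f'u=gv'$, $uv''=f''$, $u''=g''\circ\Omega f'$, $u'g''=v''\circ\Omega f$. Right triangulated categories $(\mathcal C,\Sigma,\nabla)$ are defined dually, with triangles $A\to B\to C\to\Sigma A$. **Pretriangulated categories (Beligiannis–Reiten).** $(\mathcal C,\Sigma,\Omega,\Delta,\nabla)$ is pretriangulated if: (i) $\Sigma\dashv\Omega$ (via some adjunction, which is part of the structure); (ii) $(\mathcal C,\Omega,\Delta)$ is left triangulated and $(\mathcal C,\Sigma,\nabla)$ is right triangulated; (iii) for every $A\to B\to C\to\Sigma A$ in $\nabla$, every $\Omega C'\to A'\to B'\to C'$ in $\Delta$, and every $a:A\to\Omega C'$, $b:B\to A'$ making the left square commute, there is $C\to B'$ making the whole ladder with vertical maps $a,b,C\to B',\overline a$ commute, where $\overline a:\Sigma A\to C'$ is adjoint to $a$; (iv) the dual: given $C\to B'$ and $\gamma:\Sigma A\to C'$ making the right square commute, there is $B\to A'$ making the ladder commute with first vertical map the adjoint $A\to\Omega C'$ of $\gamma$. **Extriangulated categories (Nakaoka–Palu).** Let $\mathcal C$ be additive $k$-linear and $\mathbb E:\mathcal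 C^{\mathrm{op}}\times\mathcal C\to\mathrm{Mod}\,k$ a bilinear functor; write $a\cdot\delta=\mathbb E(C,a)(\delta)$, $\delta\cdot c=\mathbb E(c,A)(\delta)$. An additive realization $\mathfrak s$ assigns to each $\delta\in\mathbb E(C,A)$ an equivalence class $[A\to B\to C]$ (equivalence: isomorphism of middle terms compatible with the maps) such that: (a) if $a\cdot\delta_0=\delta_1\cdot c$ for $\delta_i\in\mathbb E(C_i,A_i)$, $a:A_0\to A_1$, $c:C_0\to C_1$, there is $b$ between middle terms making the ladder commute; (b) $\mathfrak s(0)=[A\to A\oplus C\to C]$; (c) $\mathfrak s(\delta_0\oplus\delta_1)=\mathfrak s(\delta_0)\oplus\mathfrak s(\delta_1)$. If $\mathfrak s(\delta)=[A\xrightarrow fB\xrightarrow gC]$, then $A\xrightarrow fB\xrightarrow gC\overset\delta\dashrightarrow$ is called a conflation, $f$ an inflation, $g$ a deflation. $(\mathcal C,\mathbb E,\mathfrak s)$ is extriangulated if: (ET3) given two conflations (with classes $\delta,\delta'$) and $a,b$ with commuting left square, there is $c$ with commuting right square and $a\cdot\delta=\delta'\cdot c$; (ET3)' the dual; (ET4) given conflations $A\xrightarrow fB\xrightarrow{f'}D\overset{\delta}{\dashrightarrow}$ and $B\xrightarrow gC\xrightarrow{g'}F\overset{\delta'}{\dashrightarrow}$, there are conflations $A\xrightarrow{gf}C\xrightarrow{h}E\overset{\delta''}{\dashrightarrow}$ and $D\xrightarrow dE\xrightarrow eF\overset{f'\cdot\delta'}{\dashrightarrow}$ with $df'=hg$,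 $eh=g'$, $\delta=\delta''\cdot d$, $f\cdot\delta''=\delta'\cdot e$; (ET4)' the dual. Here a distinguished triangle $A\to B\to C\xrightarrow{\delta}A[1]$ is viewed as having extension class $\delta\in\mathbb E(C,A)=\mathcal D(C,A[1])$. *)

(* Defs.v *)
From HB Require Import structures.
From mathcomp Require Import all_boot all_order all_algebra.
From mathcomp Require Import boolp.

Set Implicit Arguments.
Unset Strict Implicit.
Unset Printing Implicit Defensive.

Import Order.TTheory GRing.Theory Num.Theory.
Local Open Scope ring_scope.
Local Obligation Tactic := idtac.

Declare Scope cat_scope.
Delimit Scope cat_scope with cat.

(* The [choiceType] carried by every [lmodType] is no restriction, the ambient
   logic being classical with choice. *)
Record kcat (k : comPzRingType) := KCat {
  ob :> Type;
  mor : ob -> ob -> lmodType k;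
  idmor : forall X, mor X X;
  ccomp : forall X Y Z, mor Y Z -> mor X Y -> mor X Z;
  compA : forall X Y Z W (h : mor Z W) (g : mor Y Z) (f : mor X Y),
    ccomp h (ccomp g f) = ccomp (ccomp h g) f;
  comp1m : forall X Y (f : mor X Y), ccomp (idmor Y) f = f;
  compm1 : forall X Y (f : mor X Y), ccomp f (idmor X) = f;
  comp_linl : forall X Y Z a (g g' : mor Y Z) (f : mor X Y),
    ccomp (a *: g + g') f = a *: ccomp g f + ccomp g' f;
  comp_linr : forall X Y Z a (g : mor Y Z) (f f' : mor X Y),
    ccomp g (a *: f + f') = a *: ccomp g f + ccomp g f'
}.
Arguments mor {k C} : rename.
Arguments idmor {k C} X : rename.
Arguments ccomp {k C X Y Z} : rename.

Notation "g ∘ f" := (ccomp g f) (at level 40, left associativity) : cat_scope.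
Local Open Scope cat_scope.

Section CategoryNotions.
Variables (k : comPzRingType) (C : kcat k).

Definition is_iso (X Y : C) (f : mor X Y) : Prop :=
  exists g : mor Y X, g ∘ f = idmor X /\ f ∘ g = idmor Y.

Definition is_mono (X Y : C) (f : mor X Y) : Prop :=
  forall (W : C) (u v : mor W X), f ∘ u = f ∘ v -> u = v.

Definition is_epi (X Y : C) (f : mor X Y) : Prop :=
  forall (W : C) (u v : mor Y W), u ∘ f = v ∘ f -> u = v.

Definition is_zero_ob (Z : C) : Prop :=
  forall X : C, (forall f : mor X Z, f = 0) /\ (forall f : mor Z X, f = 0).

Record biproduct (A B : C) := Biproduct {
  bp_ob : C;
  bp_in1 : mor A bp_ob;
  bp_in2 : mor B bp_ob;
  bp_pr1 : mor bp_ob A;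
  bp_pr2 : mor bp_ob B;
  bp_11 : bp_pr1 ∘ bp_in1 = idmor A;
  bp_22 : bp_pr2 ∘ bp_in2 = idmor B;
  bp_12 : bp_pr1 ∘ bp_in2 = 0;
  bp_21 : bp_pr2 ∘ bp_in1 = 0;
  bp_sum : bp_in1 ∘ bp_pr1 + bp_in2 ∘ bp_pr2 = idmor bp_ob
}.

Definition additive_cat : Prop :=
  (exists Z : C, is_zero_ob Z) /\ forall A B : C, inhabited (biproduct A B).

End CategoryNotions.

Definition bp_map (k : comPzRingType) (C : kcat k) (A A' B B' : C)
    (P : biproduct A A') (Q : biproduct B B') (f : mor A B) (f' : mor A' B') :
    mor (bp_ob P) (bp_ob Q) :=
  bp_in1 Q ∘ f ∘ bp_pr1 P + bp_in2 Q ∘ f' ∘ bp_pr2 P.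

Record functor (k : comPzRingType) (C D : kcat k) := Functor {
  fobj :> C -> D;
  fmap : forall X Y, mor X Y -> mor (fobj X) (fobj Y);
  fmap1 : forall X, fmap (idmor X) = idmor (fobj X);
  fmapM : forall X Y Z (g : mor Y Z) (f : mor X Y),
    fmap (g ∘ f) = fmap g ∘ fmap f
}.
Arguments fmap {k C D} F {X Y} : rename.

Section Functors.
Variable k : comPzRingType.

Definition additive_functor (C D : kcat k) (F : functor C D) : Prop :=
  forall (X Y : C) (f g : mor X Y), fmap F (f + g) = fmap F f + fmap F g.

Definition linear_functor (C D : kcat k) (F : functor C D) : Prop :=
  forall (X Y : C) a (f g : mor X Y),
    fmap F (a *: f + g) = a *: fmap F f + fmap F g.

Definition is_equivalence (C D : kcat k) (F : functor C D) : Prop :=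
  (forall X Y : C, bijective (@fmap k C D F X Y)) /\
  (forall Z : D, exists (X : C) (u : mor (F X) Z), is_iso u).

Definition fid (C : kcat k) : functor C C :=
  @Functor k C C (fun X => X) (fun _ _ f => f)
    (fun _ => erefl) (fun _ _ _ _ _ => erefl).

Program Definition fcomp (C D E : kcat k) (G : functor D E) (F : functor C D) :
    functor C E :=
  @Functor k C E (fun X => G (F X)) (fun _ _ f => fmap G (fmap F f)) _ _.
Next Obligation. by move=> * /=; rewrite !fmap1. Qed.
Next Obligation. by move=> * /=; rewrite !fmapM. Qed.

Fixpoint fiter (C : kcat k) (n : nat) (F : functor C C) : functor C C :=
  if n is m.+1 then fcomp F (fiter m F) else fid C.

Record adjunction (C D : kcat k) (L : functor C D) (R : functor D C) :=
  Adjunction {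
    adj : forall (A : C) (B : D), mor (L A) B -> mor A (R B);
    adj_bij : forall A B, bijective (@adj A B);
    adj_nat : forall A A' B B' (a : mor A' A) (f : mor (L A) B) (b : mor B B'),
      adj (b ∘ f ∘ fmap L a) = fmap R b ∘ adj f ∘ a
  }.

(* The opposite category, through which "dual" notions are defined. *)
Program Definition opcat (C : kcat k) : kcat k :=
  @KCat k C (fun X Y => @mor k C Y X) (fun X => idmor X)
    (fun X Y Z g f => f ∘ g) _ _ _ _ _.
Next Obligation. by move=> * /=; rewrite compA. Qed.
Next Obligation. by move=> * /=; rewrite compm1. Qed.
Next Obligation. by move=> * /=; rewrite comp1m. Qed.
Next Obligation. by move=> * /=; rewrite comp_linr. Qed.
Next Obligation. by move=> * /=; rewrite comp_linl. Qed.

Program Definition opfunctor (C D : kcat k) (F : functor C D) : functor (opcat C) (opcat D) :=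
  @Functor k (opcat C) (opcat D) (fun X => F X) (fun X Y f => @fmap k C D F Y X f) _ _.
Next Obligation. by move=> * /=; rewrite fmap1. Qed.
Next Obligation. by move=> * /=; rewrite fmapM. Qed.

Record fullsub_ob (C : kcat k) (P : C -> Prop) := FullsubOb {
  fs_val :> ob C;
  fs_valP : P fs_val
}.

Definition fullsub (C : kcat k) (P : C -> Prop) : kcat k :=
  @KCat k (fullsub_ob P) (fun X Y => @mor k C X Y) (fun X => @idmor k C X)
    (fun X Y Z => @ccomp k C X Y Z)
    (fun X Y Z W => @compA k C X Y Z W) (fun X Y => @comp1m k C X Y)
    (fun X Y => @compm1 k C X Y) (fun X Y Z => @comp_linl k C X Y Z)
    (fun X Y Z => @comp_linr k C X Y Z).

Definition fincl (C : kcat k) (P : C -> Prop) : functor (fullsub P) C :=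
  @Functor k (fullsub P) C (fun X => X) (fun _ _ f => f)
    (fun _ => erefl) (fun _ _ _ _ _ => erefl).

Definition fcorestr (C D : kcat k) (Q : D -> Prop) (F : functor C D)
    (FQ : forall X, Q (F X)) : functor C (fullsub Q) :=
  @Functor k C (fullsub Q) (fun X => FullsubOb (FQ X)) (fun X Y f => fmap F f)
    (@fmap1 k C D F) (@fmapM k C D F).

(* Isomorphism of triangles X -> Y -> Z -> T X. *)
Definition tri_iso (C : kcat k) (T : functor C C) (X Y Z X' Y' Z' : C)
    (f : mor X Y) (g : mor Y Z) (h : mor Z (T X))
    (f' : mor X' Y') (g' : mor Y' Z') (h' : mor Z' (T X')) : Prop :=
  exists (a : mor X X') (b : mor Y Y') (c : mor Z Z'),
    [/\ is_iso a, is_iso b & is_iso c] /\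
    [/\ b ∘ f = f' ∘ a, c ∘ g = g' ∘ b & fmap T a ∘ h = h' ∘ c].

End Functors.

Record tridata (k : comPzRingType) := TriData {
  tri_cat :> kcat k;
  sh : functor tri_cat tri_cat;
  dist : forall X Y Z : tri_cat, mor X Y -> mor Y Z -> mor Z (sh X) -> Prop
}.
Arguments sh {k} D : rename.
Arguments dist {k D X Y Z} : rename.

(* The shift is an autoequivalence, with the quasi-inverse [shV] = [-1] given
   as an adjoint equivalence. *)
Record triangulated (k : comPzRingType) := Triangulated {
  tri_data :> tridata k;
  tri_additive : additive_cat tri_data;
  sh_linear : linear_functor (sh tri_data);
  shV : functor tri_data tri_data;
  sh_unit : forall X : tri_data, mor X (shV (sh tri_data X));
  sh_counit : forall X : tri_data, mor (sh tri_data (shV X)) X;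
  sh_unit_iso : forall X, is_iso (sh_unit X);
  sh_counit_iso : forall X, is_iso (sh_counit X);
  sh_unit_nat : forall (X Y : tri_data) (f : mor X Y),
    sh_unit Y ∘ f = fmap shV (fmap (sh tri_data) f) ∘ sh_unit X;
  sh_counit_nat : forall (X Y : tri_data) (f : mor X Y),
    f ∘ sh_counit X = sh_counit Y ∘ fmap (sh tri_data) (fmap shV f);
  sh_triangle1 : forall X,
    sh_counit (sh tri_data X) ∘ fmap (sh tri_data) (sh_unit X) = idmor _;
  sh_triangle2 : forall X,
    fmap shV (sh_counit X) ∘ sh_unit (shV X) = idmor _;
  tr_iso : forall (X Y Z X' Y' Z' : tri_data)
      (f : mor X Y) (g : mor Y Z) (h : mor Z (sh tri_data X))
      (f' : mor X' Y') (g' : mor Y' Z') (h' : mor Z' (sh tri_data X')),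
    tri_iso f g h f' g' h' -> dist f g h -> dist f' g' h';
  tr_id : forall X Z : tri_data, is_zero_ob Z ->
    dist (idmor X) (0 : mor X Z) (0 : mor Z (sh tri_data X));
  tr_cone : forall (X Y : tri_data) (f : mor X Y),
    exists (Z : tri_data) (g : mor Y Z) (h : mor Z (sh tri_data X)), dist f g h;
  tr_rot : forall (X Y Z : tri_data)
      (f : mor X Y) (g : mor Y Z) (h : mor Z (sh tri_data X)),
    dist f g h <-> dist g h (- fmap (sh tri_data) f);
  tr_mor : forall (X Y Z X' Y' Z' : tri_data)
      (f : mor X Y) (g : mor Y Z) (h : mor Z (sh tri_data X))
      (f' : mor X' Y') (g' : mor Y' Z') (h' : mor Z' (sh tri_data X'))
      (a : mor X X') (b : mor Y Y'),
    dist f g h -> dist f' g' h' -> b ∘ f = f' ∘ a ->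
    exists c : mor Z Z',
      c ∘ g = g' ∘ b /\ fmap (sh tri_data) a ∘ h = h' ∘ c;
  tr_oct : forall (X Y Z Z' X' Y' : tri_data) (f : mor X Y) (g : mor Y Z)
      (f' : mor Y Z') (f'' : mor Z' (sh tri_data X))
      (g' : mor Z X') (g'' : mor X' (sh tri_data Y))
      (h' : mor Z Y') (h'' : mor Y' (sh tri_data X)),
    dist f f' f'' -> dist g g' g'' -> dist (g ∘ f) h' h'' ->
    exists (u : mor Z' Y') (v : mor Y' X'),
      dist u v (fmap (sh tri_data) f' ∘ g'') /\
      [/\ u ∘ f' = h' ∘ g, h'' ∘ u = f'', v ∘ h' = g' &
          g'' ∘ v = fmap (sh tri_data) f ∘ h'']
}.
Arguments shV {k} D : rename.
Arguments sh_unit {k D} X : rename.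
Arguments sh_counit {k D} X : rename.

Definition triangle_equivalence (k : comPzRingType) (S T : tridata k)
    (F : functor S T) (phi : forall X : S, mor (F (sh S X)) (sh T (F X))) : Prop :=
  [/\ linear_functor F, is_equivalence F,
      forall X, is_iso (phi X),
      forall (X Y : S) (f : mor X Y),
        phi Y ∘ fmap F (fmap (sh S) f) = fmap (sh T) (fmap F f) ∘ phi X &
      forall (X Y Z : S) (f : mor X Y) (g : mor Y Z) (h : mor Z (sh S X)),
        dist f g h -> dist (fmap F f) (fmap F g) (phi X ∘ fmap F h)].

Record submodule (k : comPzRingType) (V : lmodType k) := Submodule {
  sm_mem :> V -> Prop;
  sm_0 : sm_mem 0;
  sm_lin : forall a u v, sm_mem u -> sm_mem v -> sm_mem (a *: u + v)
}.

Section SubmoduleTheory.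
Variables (k : comPzRingType) (V : lmodType k) (S : submodule V).

Lemma smD u v : S u -> S v -> S (u + v).
Proof. by move=> hu hv; rewrite -[u]scale1r; exact: sm_lin. Qed.

Lemma smZ a u : S u -> S (a *: u).
Proof. by move=> hu; rewrite -[_ *: _]addr0; apply: sm_lin => //; exact: sm_0. Qed.

Lemma smN u : S u -> S (- u).
Proof. by move=> hu; rewrite -scaleN1r; exact: smZ. Qed.

Lemma smB u v : S u -> S v -> S (u - v).
Proof. by move=> hu hv; apply: smD => //; exact: smN. Qed.

End SubmoduleTheory.

Section Subquotient.
Variables (k : comPzRingType) (V : lmodType k) (Z B : submodule V).

(* The cosets z + B with z in Z, that is Z / (Z ∩ B). *)
Record subquot := SubQuot {
  sq_coset : V -> Prop;
  sq_cosetP : exists2 z, Z z & sq_coset = (fun v => B (v - z))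
}.

Lemma sq_eq (S T : subquot) : sq_coset S = sq_coset T -> S = T.
Proof.
case: S T => [S hS] [T hT] /= e; rewrite e in hS *.
by rewrite (Prop_irrelevance hS hT).
Qed.

Definition cls (z : V) (hz : Z z) : subquot :=
  @SubQuot (fun v => B (v - z)) (ex_intro2 _ _ z hz erefl).

Definition sq_repr (S : subquot) : V := projT1 (cid2 (sq_cosetP S)).

Lemma sq_reprP S : Z (sq_repr S).
Proof. by rewrite /sq_repr; case: cid2. Qed.

Lemma sq_reprK S : cls (sq_reprP S) = S.
Proof.
apply: sq_eq => /=; rewrite /sq_repr; case: cid2 => z hz /= ->.
by [].
Qed.

Lemma cls_eqP z z' (hz : Z z) (hz' : Z z') : cls hz = cls hz' <-> B (z - z').
Proof.
split=> [/(congr1 sq_coset)/= e|h].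
  by rewrite -[B _]/((fun v => B (v - z')) z) -e /= subrr; exact: sm_0.
apply: sq_eq; apply/funext => v /=; apply/propext; split=> hv.
  by rewrite -(subrKA z v (- z')); exact: smD.
rewrite -(subrKA z' v (- z)); apply: smD => //.
by rewrite -opprB; exact: smN.
Qed.

Lemma sq_repr_cls z (hz : Z z) : B (sq_repr (cls hz) - z).
Proof. by apply/(cls_eqP (sq_reprP _) hz); exact: sq_reprK. Qed.

Definition sq_zero := cls (sm_0 Z).
Definition sq_add S T := cls (smD (sq_reprP S) (sq_reprP T)).
Definition sq_opp S := cls (smN (sq_reprP S)).
Definition sq_scale a S := cls (smZ a (sq_reprP S)).

Lemma sq_addE u v (hu : Z u) (hv : Z v) :
  sq_add (cls hu) (cls hv) = cls (smD hu hv).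
Proof.
apply/cls_eqP; rewrite opprD addrACA.
by apply: smD; exact: sq_repr_cls.
Qed.

Lemma sq_oppE u (hu : Z u) : sq_opp (cls hu) = cls (smN hu).
Proof. by apply/cls_eqP; rewrite -opprD; apply: smN; exact: sq_repr_cls. Qed.

Lemma sq_scaleE a u (hu : Z u) : sq_scale a (cls hu) = cls (smZ a hu).
Proof. by apply/cls_eqP; rewrite -scalerBr; apply: smZ; exact: sq_repr_cls. Qed.

Lemma cls_ext u v (hu : Z u) (hv : Z v) : u = v -> cls hu = cls hv.
Proof. by move=> e; apply/cls_eqP; rewrite e subrr; exact: sm_0. Qed.

Lemma sq_addA : associative sq_add.
Proof.
move=> S T U; rewrite -(sq_reprK S) -(sq_reprK T) -(sq_reprK U) !sq_addE.
by apply: cls_ext; rewrite addrA.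
Qed.

Lemma sq_addC : commutative sq_add.
Proof.
move=> S T; rewrite -(sq_reprK S) -(sq_reprK T) !sq_addE.
by apply: cls_ext; rewrite addrC.
Qed.

Lemma sq_add0 : left_id sq_zero sq_add.
Proof. by move=> S; rewrite -(sq_reprK S) sq_addE; apply: cls_ext; rewrite add0r. Qed.

Lemma sq_addN : left_inverse sq_zero sq_opp sq_add.
Proof.
move=> S; rewrite -(sq_reprK S) sq_oppE sq_addE.
by apply: cls_ext; rewrite addNr.
Qed.

HB.instance Definition _ := gen_eqMixin subquot.
HB.instance Definition _ := gen_choiceMixin subquot.
HB.instance Definition _ :=
  GRing.isZmodule.Build subquot sq_addA sq_addC sq_add0 sq_addN.

Lemma sq_scaleA a b S : sq_scale a (sq_scale b S) = sq_scale (a * b) S.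
Proof.
rewrite -(sq_reprK S) !sq_scaleE; apply: cls_ext.
by rewrite scalerA.
Qed.

Lemma sq_scale1 : left_id 1 sq_scale.
Proof.
by move=> S; rewrite -(sq_reprK S) sq_scaleE; apply: cls_ext; rewrite scale1r.
Qed.

Lemma sq_scaleDr : right_distributive sq_scale +%R.
Proof.
move=> a S T; rewrite -(sq_reprK S) -(sq_reprK T).
have addE (U U' : subquot) : U + U' = sq_add U U' by [].
rewrite !addE sq_addE !sq_scaleE sq_addE.
by apply: cls_ext; rewrite scalerDr.
Qed.

Lemma sq_scaleDl S : {morph sq_scale^~ S : a b / a + b}.
Proof.
move=> a b /=; have addE (U U' : subquot) : U + U' = sq_add U U' by [].
rewrite -(sq_reprK S) !sq_scaleE addE sq_addE.
by apply: cls_ext; rewrite scalerDl.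
Qed.

HB.instance Definition _ := GRing.Zmodule_isLmodule.Build k subquot
  sq_scaleA sq_scale1 sq_scaleDr sq_scaleDl.

Lemma cls_linE a u v (hu : Z u) (hv : Z v) :
  a *: cls hu + cls hv = cls (sm_lin a hu hv) :> subquot.
Proof.
have addE (U U' : subquot) : U + U' = sq_add U U' by [].
have scaleE (U : subquot) : a *: U = sq_scale a U by [].
by rewrite addE scaleE sq_scaleE sq_addE; apply: cls_ext.
Qed.

End Subquotient.

(* Morphism complexes are internally graded: [mor X Y] is the direct sum of the
   submodules [dg_deg i] of homogeneous elements of degree i. *)
Record dgcat (k : comPzRingType) := DGCat {
  dg_cat :> kcat k;
  dg_deg : int -> forall X Y : dg_cat, submodule (mor X Y);
  dg_span : forall (X Y : dg_cat) (f : mor X Y),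
    exists (s : seq int) (c : int -> mor X Y),
      (forall i, dg_deg i X Y (c i)) /\ f = \sum_(i <- s) c i;
  dg_indep : forall (X Y : dg_cat) (s : seq int) (c : int -> mor X Y),
    uniq s -> (forall i, dg_deg i X Y (c i)) -> \sum_(i <- s) c i = 0 ->
    forall i, i \in s -> c i = 0;
  dg_deg1 : forall X : dg_cat, dg_deg 0 X X (idmor X);
  dg_degM : forall (X Y Z : dg_cat) i j (g : mor Y Z) (f : mor X Y),
    dg_deg i Y Z g -> dg_deg j X Y f -> dg_deg (i + j) X Z (g ∘ f);
  dg_d : forall X Y : dg_cat, mor X Y -> mor X Y;
  dg_d_lin : forall (X Y : dg_cat) a (f g : mor X Y),
    dg_d (a *: f + g) = a *: dg_d f + dg_d g;
  dg_d_deg : forall (X Y : dg_cat) i (f : mor X Y),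
    dg_deg i X Y f -> dg_deg (i + 1) X Y (dg_d f);
  dg_dd : forall (X Y : dg_cat) (f : mor X Y), dg_d (dg_d f) = 0;
  dg_leibniz : forall (X Y Z : dg_cat) i (g : mor Y Z) (f : mor X Y),
    dg_deg i Y Z g ->
    dg_d (g ∘ f) = dg_d g ∘ f + (-1) ^+ `|i|%N *: (g ∘ dg_d f)
}.
Arguments dg_deg {k A} i {X Y} : rename.
Arguments dg_d {k A X Y} f : rename.

Section DGCategories.
Variables (k : comPzRingType) (A : dgcat k).

Lemma dg_d0 (X Y : A) : dg_d (0 : mor X Y) = 0.
Proof.
have := dg_d_lin 1 (0 : mor X Y) 0; rewrite !scale1r addr0 => h.
by apply: (addrI (dg_d (0 : mor X Y))); rewrite addr0 -h.
Qed.

Lemma comp0m (C : kcat k) (X Y Z : C) (f : mor X Y) : (0 : mor Y Z) ∘ f = 0.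
Proof.
have := comp_linl 1 (0 : mor Y Z) 0 f; rewrite !scale1r addr0 => h.
by apply: (addrI ((0 : mor Y Z) ∘ f)); rewrite addr0 -h.
Qed.

Lemma compm0 (C : kcat k) (X Y Z : C) (g : mor Y Z) : g ∘ (0 : mor X Y) = 0.
Proof.
have := comp_linr 1 g (0 : mor X Y) 0; rewrite !scale1r addr0 => h.
by apply: (addrI (g ∘ (0 : mor X Y))); rewrite addr0 -h.
Qed.

Lemma compBm (C : kcat k) (X Y Z : C) (g g' : mor Y Z) (f : mor X Y) :
  (g - g') ∘ f = g ∘ f - g' ∘ f.
Proof. by rewrite addrC -scaleN1r comp_linl scaleN1r addrC. Qed.

Lemma compmB (C : kcat k) (X Y Z : C) (g : mor Y Z) (f f' : mor X Y) :
  g ∘ (f - f') = g ∘ f - g ∘ f'.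
Proof. by rewrite addrC -scaleN1r comp_linr scaleN1r addrC. Qed.

Lemma compZm (C : kcat k) (X Y Z : C) a (g : mor Y Z) (f : mor X Y) :
  (a *: g) ∘ f = a *: (g ∘ f).
Proof. by rewrite -[a *: g]addr0 comp_linl comp0m addr0. Qed.

Lemma compmZ (C : kcat k) (X Y Z : C) a (g : mor Y Z) (f : mor X Y) :
  g ∘ (a *: f) = a *: (g ∘ f).
Proof. by rewrite -[a *: f]addr0 comp_linr compm0 addr0. Qed.

Program Definition dg_cycle (i : int) (X Y : A) : submodule (mor X Y) :=
  @Submodule k (mor X Y) (fun f => dg_deg i f /\ dg_d f = 0) _ _.
Next Obligation. by move=> i X Y; split; [exact: sm_0 | exact: dg_d0]. Qed.
Next Obligation.
move=> i X Y a u v [hu du] [hv dv]; split; first exact: sm_lin.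
by rewrite dg_d_lin du dv scaler0 addr0.
Qed.

Program Definition dg_bound (i : int) (X Y : A) : submodule (mor X Y) :=
  @Submodule k (mor X Y) (fun f => exists2 g, dg_deg (i - 1) g & f = dg_d g) _ _.
Next Obligation. by move=> i X Y; exists 0; [exact: sm_0 | rewrite dg_d0]. Qed.
Next Obligation.
move=> i X Y a _ _ [u hu ->] [v hv ->]; exists (a *: u + v); first exact: sm_lin.
by rewrite dg_d_lin.
Qed.

Lemma dg_cycleM (X Y Z : A) i j m (g : mor Y Z) (f : mor X Y) : m = i + j ->
  dg_cycle i Y Z g -> dg_cycle j X Y f -> dg_cycle m X Z (g ∘ f).
Proof.
move=> -> [gi gd] [fj fd]; split; first exact: dg_degM.
by rewrite (dg_leibniz _ gi) gd fd comp0m compm0 scaler0 addr0.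
Qed.

Lemma dg_boundMl (X Y Z : A) i j m (g : mor Y Z) (f : mor X Y) : m = i + j ->
  dg_bound i Y Z g -> dg_cycle j X Y f -> dg_bound m X Z (g ∘ f).
Proof.
move=> -> [g' gi ->] [fj fd]; exists (g' ∘ f).
  by rewrite addrAC; exact: dg_degM.
by rewrite (dg_leibniz _ gi) fd compm0 scaler0 addr0.
Qed.

Lemma dg_boundMr (X Y Z : A) i j m (g : mor Y Z) (f : mor X Y) : m = i + j ->
  dg_cycle i Y Z g -> dg_bound j X Y f -> dg_bound m X Z (g ∘ f).
Proof.
move=> -> [gi gd] [f' fj ->]; exists ((-1) ^+ `|i|%N *: (g ∘ f')).
  by apply: smZ; rewrite -addrA; exact: dg_degM.
rewrite -[_ *: _]addr0 dg_d_lin dg_d0 addr0 (dg_leibniz _ gi) gd comp0m add0r.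
by rewrite scalerA -expr2 sqrr_sign scale1r.
Qed.

Lemma dg_cycle1 (X : A) : dg_cycle 0 X X (idmor X).
Proof.
split; first exact: dg_deg1.
have := dg_leibniz (idmor X) (dg_deg1 X).
rewrite comp1m compm1 comp1m expr0 scale1r => h.
by apply: (addrI (dg_d (idmor X))); rewrite addr0 -h.
Qed.

Definition H0_hom (X Y : A) : lmodType k := subquot (dg_cycle 0 X Y) (dg_bound 0 X Y).

Definition H0_cls (X Y : A) (f : mor X Y) (hf : dg_cycle 0 X Y f) : H0_hom X Y :=
  cls (dg_bound 0 X Y) hf.

Definition H0_comp (X Y Z : A) (G : H0_hom Y Z) (F : H0_hom X Y) : H0_hom X Z :=
  H0_cls (dg_cycleM (esym (addr0 0)) (sq_reprP G) (sq_reprP F)).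

Lemma H0_compE (X Y Z : A) (g : mor Y Z) (f : mor X Y)
    (hg : dg_cycle 0 Y Z g) (hf : dg_cycle 0 X Y f) :
  H0_comp (H0_cls hg) (H0_cls hf) = H0_cls (dg_cycleM (esym (addr0 0)) hg hf).
Proof.
apply/cls_eqP; set g' := sq_repr _; set f' := sq_repr _.
have -> : g' ∘ f' - g ∘ f = (g' - g) ∘ f' + g ∘ (f' - f).
  by rewrite compBm compmB addrA subrK.
apply: smD.
  apply: (@dg_boundMl _ _ _ 0 0) => //; first exact: sq_repr_cls.
  exact: sq_reprP.
by apply: (@dg_boundMr _ _ _ 0 0) => //; exact: sq_repr_cls.
Qed.

Lemma H0_clsP (X Y : A) (F : H0_hom X Y) :
  exists f, exists hf : dg_cycle 0 X Y f, F = H0_cls hf.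
Proof. by exists (sq_repr F), (sq_reprP F); rewrite /H0_cls sq_reprK. Qed.

Lemma H0_cls_ext (X Y : A) (f g : mor X Y) (hf : dg_cycle 0 X Y f)
  (hg : dg_cycle 0 X Y g) : f = g -> H0_cls hf = H0_cls hg.
Proof. exact: cls_ext. Qed.

Lemma H0_linE (X Y : A) a (f g : mor X Y) (hf : dg_cycle 0 X Y f)
  (hg : dg_cycle 0 X Y g) :
  a *: H0_cls hf + H0_cls hg = H0_cls (sm_lin a hf hg).
Proof. exact: cls_linE. Qed.

Program Definition H0 : kcat k :=
  @KCat k A H0_hom (fun X => H0_cls (dg_cycle1 X)) H0_comp _ _ _ _ _.
Next Obligation.
move=> X Y Z W h g f.
have [h' [hh ->]] := H0_clsP h; have [g' [hg ->]] := H0_clsP g.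
have [f' [hf ->]] := H0_clsP f; rewrite !H0_compE.
by apply: H0_cls_ext; rewrite compA.
Qed.
Next Obligation.
move=> X Y f; have [f' [hf ->]] := H0_clsP f; rewrite !H0_compE.
by apply: H0_cls_ext; rewrite comp1m.
Qed.
Next Obligation.
move=> X Y f; have [f' [hf ->]] := H0_clsP f; rewrite !H0_compE.
by apply: H0_cls_ext; rewrite compm1.
Qed.
Next Obligation.
move=> X Y Z a g g' f.
have [h [hh ->]] := H0_clsP g; have [h' [hh' ->]] := H0_clsP g'.
have [f' [hf ->]] := H0_clsP f; rewrite H0_linE !H0_compE H0_linE.
by apply: H0_cls_ext; rewrite comp_linl.
Qed.
Next Obligation.
move=> X Y Z a g f f'.
have [h [hh ->]] := H0_clsP f; have [h' [hh' ->]] := H0_clsP f'.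
have [g' [hg ->]] := H0_clsP g; rewrite H0_linE !H0_compE H0_linE.
by apply: H0_cls_ext; rewrite comp_linr.
Qed.

(* w is a closed element of A(-,X)[n] at X' whose Yoneda map
   A(-,X') -> A(-,X)[n] is a quasi-isomorphism: X' is a shift X[n]. *)
Definition dg_shift (n : int) (X X' : A) (w : mor X' X) : Prop :=
  dg_cycle n X' X w /\
  forall (W : A) (i : int),
    (forall g, dg_cycle i W X' g -> dg_bound (n + i) W X (w ∘ g) ->
       dg_bound i W X' g) /\
    (forall x, dg_cycle (n + i) W X x ->
       exists2 g, dg_cycle i W X' g & dg_bound (n + i) W X (w ∘ g - x)).

(* For f closed of degree 0, the DG-module M = Cone(A(-,f)) is
     M(W)^i = A(W,X)^(i+1) (+) A(W,Y)^i,  d(x,y) = (- d x, f x + d y). *)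
Definition cone_cycle (X Y : A) (f : mor X Y) (W : A) (i : int)
    (x : mor W X) (y : mor W Y) : Prop :=
  [/\ dg_deg (i + 1) x, dg_deg i y, dg_d x = 0 & f ∘ x + dg_d y = 0].

Definition cone_bound (X Y : A) (f : mor X Y) (W : A) (i : int)
    (x : mor W X) (y : mor W Y) : Prop :=
  exists x' y', [/\ dg_deg i x', dg_deg (i - 1) y', x = - dg_d x' &
                    y = f ∘ x' + dg_d y'].

(* (p, s) is a closed element of degree 0 of M at C whose Yoneda map
   A(-,C) -> M is a quasi-isomorphism. *)
Definition dg_cone (X Y C : A) (f : mor X Y) (p : mor C X) (s : mor C Y) : Prop :=
  cone_cycle f 0 p s /\
  forall (W : A) (i : int),
    (forall g, dg_cycle i W C g -> cone_bound f i (p ∘ g) (s ∘ g) ->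
       dg_bound i W C g) /\
    (forall x y, cone_cycle f i x y ->
       exists2 g, dg_cycle i W C g & cone_bound f i (p ∘ g - x) (s ∘ g - y)).

(* The essential image of H0 A in the derived category of A is a triangulated
   subcategory: it contains 0 and is closed under [1], [-1] and cones.
   As representable DG-modules are h-projective, a DG-module is isomorphic
   to A(-,C) in the derived category iff it receives a quasi-isomorphism from
   A(-,C). *)
Definition pretriangulated_dg : Prop :=
  [/\ exists Z : A, dg_bound 0 Z Z (idmor Z),
      forall X : A, exists (X' : A) (w : mor X' X), dg_shift 1 w,
      forall X : A, exists (X' : A) (w : mor X' X), dg_shift (-1) w &
      forall (X Y : A) (f : mor X Y), dg_cycle 0 X Y f ->
        exists (C : A) (p : mor C X) (s : mor C Y), dg_cone f p s].

Record dg_suspension := DGSuspension {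
  dgs_ob : A -> A;
  dgs_w : forall X, mor (dgs_ob X) X;
  dgs_shift : forall X, dg_shift 1 (dgs_w X)
}.

Section HomotopyTriangles.
Variable S : dg_suspension.

(* G is the image of F under the shift functor: w G = F w in H^1. *)
Definition H0_sh_rel (X Y : A) (F : H0_hom X Y)
    (G : H0_hom (dgs_ob S X) (dgs_ob S Y)) : Prop :=
  dg_bound 1 (dgs_ob S X) Y (dgs_w S Y ∘ sq_repr G - sq_repr F ∘ dgs_w S X).

Lemma H0_sh_relE (X Y : A) (f : mor X Y) (hf : dg_cycle 0 X Y f)
    (g : mor (dgs_ob S X) (dgs_ob S Y)) (hg : dg_cycle 0 _ _ g) :
  H0_sh_rel (H0_cls hf) (H0_cls hg) <->
  dg_bound 1 (dgs_ob S X) Y (dgs_w S Y ∘ g - f ∘ dgs_w S X).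
Proof.
rewrite /H0_sh_rel; set g' := sq_repr _; set f' := sq_repr _.
have wX := (dgs_shift S X).1; have wY := (dgs_shift S Y).1.
have hgg : dg_bound 1 (dgs_ob S X) Y (dgs_w S Y ∘ (g' - g)).
  by apply: (dg_boundMr _ wY (sq_repr_cls _ hg)); rewrite addr0.
have hff : dg_bound 1 (dgs_ob S X) Y ((f' - f) ∘ dgs_w S X).
  by apply: (dg_boundMl _ (sq_repr_cls _ hf) wX); rewrite add0r.
have e : dgs_w S Y ∘ g' - f' ∘ dgs_w S X - (dgs_w S Y ∘ g - f ∘ dgs_w S X)
         = dgs_w S Y ∘ (g' - g) - (f' - f) ∘ dgs_w S X.
  by rewrite compmB compBm !opprD !opprK addrACA.
have he : dg_bound 1 (dgs_ob S X) Y
    (dgs_w S Y ∘ g' - f' ∘ dgs_w S X - (dgs_w S Y ∘ g - f ∘ dgs_w S X)).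
  by rewrite e; exact: smB.
split=> h; last by have := smD he h; rewrite subrK.
by have := smB h he; rewrite opprB addrC subrK.
Qed.

Lemma H0_sh_ex (X Y : A) (F : H0_hom X Y) : exists G, H0_sh_rel F G.
Proof.
have [f [hf ->]] := H0_clsP F.
have [wX _] := dgs_shift S X; have [_ /(_ (dgs_ob S X) 0)[_ sY]] := dgs_shift S Y.
have [|g hg hb] := sY (f ∘ dgs_w S X).
  by apply: (dg_cycleM _ hf wX); rewrite addr0 add0r.
by exists (H0_cls hg); apply/H0_sh_relE; rewrite addr0 in hb.
Qed.

Lemma H0_sh_uniq (X Y : A) (F : H0_hom X Y) G G' :
  H0_sh_rel F G -> H0_sh_rel F G' -> G = G'.
Proof.
have [f [hf ->]] := H0_clsP F.
have [g [hg ->]] := H0_clsP G; have [g' [hg' ->]] := H0_clsP G'.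
move=> /H0_sh_relE h /H0_sh_relE h'; apply/cls_eqP.
have [_ /(_ (dgs_ob S X) 0)[iY _]] := dgs_shift S Y.
apply: iY; first exact: smB.
by rewrite addr0 compmB; have := smB h h'; rewrite opprB addrA subrK.
Qed.

Definition H0_sh_map (X Y : A) (F : H0_hom X Y) :
  H0_hom (dgs_ob S X) (dgs_ob S Y) := projT1 (cid (H0_sh_ex F)).

Lemma H0_sh_mapP (X Y : A) (F : H0_hom X Y) : H0_sh_rel F (H0_sh_map F).
Proof. by rewrite /H0_sh_map; case: cid. Qed.

Program Definition H0_sh : functor H0 H0 :=
  @Functor k H0 H0 (dgs_ob S) H0_sh_map _ _.
Next Obligation.
move=> X; apply: (H0_sh_uniq (H0_sh_mapP _)); apply/H0_sh_relE.
by rewrite compm1 comp1m subrr; exact: sm_0.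
Qed.
Next Obligation.
move=> X Y Z G F /=; apply: (H0_sh_uniq (H0_sh_mapP _)).
move: (H0_sh_map G) (H0_sh_mapP G) (H0_sh_map F) (H0_sh_mapP F) => G' + F'.
have [g [hg ->]] := H0_clsP G; have [f [hf ->]] := H0_clsP F.
have [g' [hg' ->]] := H0_clsP G'; have [f' [hf' ->]] := H0_clsP F'.
move=> /H0_sh_relE hG /H0_sh_relE hF; rewrite /= !H0_compE; apply/H0_sh_relE.
have -> : dgs_w S Z ∘ (g' ∘ f') - g ∘ f ∘ dgs_w S X =
  (dgs_w S Z ∘ g' - g ∘ dgs_w S Y) ∘ f' + g ∘ (dgs_w S Y ∘ f' - f ∘ dgs_w S X).
  by rewrite compBm compmB !compA addrA subrK.
apply: smD.
  by apply: (dg_boundMl _ hG hf'); rewrite addr0.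
by apply: (dg_boundMr _ hg hF); rewrite add0r.
Qed.

(* The triangle X -> Y -> C -> X[1] of a cone C of f, where A(-,C) is
   identified with Cone(A(-,f)): i corresponds to the inclusion (0, 1) of Y and
   q to the projection onto X[1]. *)
Definition H0_std_triangle (X Y C : A)
    (F : H0_hom X Y) (I : H0_hom Y C) (Q : H0_hom C (dgs_ob S X)) : Prop :=
  exists (p : mor C X) (s : mor C Y),
    [/\ dg_cone (sq_repr F) p s,
        cone_bound (sq_repr F) 0 (p ∘ sq_repr I) (s ∘ sq_repr I - idmor Y) &
        dg_bound 1 C X (dgs_w S X ∘ sq_repr Q - p)].

Definition H0_tri : tridata k :=
  @TriData k H0 H0_sh (fun X Y Z f g h =>
    exists (X' Y' Z' : H0) (f' : mor X' Y') (g' : mor Y' Z')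
      (h' : mor Z' (H0_sh X')),
      H0_std_triangle f' g' h' /\ tri_iso f' g' h' f g h).

End HomotopyTriangles.
End DGCategories.

Definition algebraic (k : comPzRingType) (D : triangulated k) : Prop :=
  exists (A : dgcat k) (S : dg_suspension A), pretriangulated_dg A /\
  exists (F : functor D (H0_tri S)) (phi : forall X, mor (F (sh D X)) (sh (H0_tri S) (F X))),
    triangle_equivalence phi.

Section Shifts.
Variables (k : comPzRingType) (D : triangulated k).

Definition shz (i : int) : functor D D :=
  match i with
  | Posz n => fiter n (sh D)
  | Negz n => fiter n.+1 (shV D)
  end.

Definition iso_ob (C : kcat k) (X Y : C) : Prop := exists u : mor X Y, is_iso u.

End Shifts.

(* D^{>=1} = D^{>=0}[-1] consists of the Y with Y[1] in D^{>=0}. *)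
Record tstructure (k : comPzRingType) (D : triangulated k) := TStructure {
  ts_le0 : D -> Prop;
  ts_ge0 : D -> Prop;
  ts_le_iso : forall X Y, iso_ob X Y -> ts_le0 X -> ts_le0 Y;
  ts_ge_iso : forall X Y, iso_ob X Y -> ts_ge0 X -> ts_ge0 Y;
  ts_orth : forall X Y (f : mor X Y), ts_le0 X -> ts_ge0 (sh D Y) -> f = 0;
  ts_le_sh : forall X, ts_le0 X -> ts_le0 (sh D X);
  ts_ge_sh : forall X, ts_ge0 (sh D X) -> ts_ge0 X;
  ts_tri : forall X, exists (A B : D) (f : mor A X) (g : mor X B)
    (h : mor B (sh D A)), [/\ dist f g h, ts_le0 A & ts_ge0 (sh D B)]
}.

Definition t_le (k : comPzRingType) (D : triangulated k) (t : tstructure D)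
  (m : int) (X : D) : Prop := ts_le0 t (shz D m X).
Definition t_ge (k : comPzRingType) (D : triangulated k) (t : tstructure D)
  (m : int) (X : D) : Prop := ts_ge0 t (shz D m X).

(* The functors tau_{<=m} (resp. tau_{>=m}) are the right (resp. left) adjoints of
   the inclusions of D^{<=m} (resp. D^{>=m}) into D. *)
Record truncation (k : comPzRingType) (D : triangulated k) (t : tstructure D) :=
  Truncation {
    tau_le : int -> functor D D;
    tau_le_map : forall m X, mor (tau_le m X) X;
    tau_leP : forall m X, t_le t m (tau_le m X);
    tau_le_nat : forall m (X Y : D) (f : mor X Y),
      tau_le_map m Y ∘ fmap (tau_le m) f = f ∘ tau_le_map m X;
    tau_le_univ : forall m (W X : D) (f : mor W X), t_le t m W ->
      exists! g : mor W (tau_le m X), tau_le_map m X ∘ g = f;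
    tau_ge : int -> functor D D;
    tau_ge_map : forall m X, mor X (tau_ge m X);
    tau_geP : forall m X, t_ge t m (tau_ge m X);
    tau_ge_nat : forall m (X Y : D) (f : mor X Y),
      fmap (tau_ge m) f ∘ tau_ge_map m X = tau_ge_map m Y ∘ f;
    tau_ge_univ : forall m (X W : D) (f : mor X W), t_ge t m W ->
      exists! g : mor (tau_ge m X) W, g ∘ tau_ge_map m X = f
  }.
Arguments tau_le_map {k D t} _ m X.
Arguments tau_ge_map {k D t} _ m X.

(* D^{[-n+1,0]} *)
Definition t_range (k : comPzRingType) (D : triangulated k) (t : tstructure D)
  (n : nat) (X : D) : Prop := t_le t 0 X /\ t_ge t (- n%:Z + 1) X.

Definition t_heart (k : comPzRingType) (D : triangulated k) (t : tstructure D)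
  (X : D) : Prop := t_le t 0 X /\ t_ge t 0 X.

Section TStructureTheory.
Variables (k : comPzRingType).

Section Isos.
Variable C : kcat k.

Lemma iso_id (X : C) : is_iso (idmor X).
Proof. by exists (idmor X); rewrite comp1m. Qed.

Lemma iso_ob_refl (X : C) : iso_ob X X.
Proof. by exists (idmor X); exact: iso_id. Qed.

Lemma iso_ob_sym (X Y : C) : iso_ob X Y -> iso_ob Y X.
Proof. by move=> [u [v [h1 h2]]]; exists v, u. Qed.

Lemma iso_ob_trans (Y X Z : C) : iso_ob X Y -> iso_ob Y Z -> iso_ob X Z.
Proof.
move=> [u [u' [h1 h2]]] [v [v' [h3 h4]]]; exists (v ∘ u), (u' ∘ v').
split; first by rewrite compA -(compA u') h3 compm1.
by rewrite compA -(compA v) h2 compm1.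
Qed.

Lemma iso_ob_fmap (E : kcat k) (F : functor C E) (X Y : C) :
  iso_ob X Y -> iso_ob (F X) (F Y).
Proof.
move=> [u [v [h1 h2]]]; exists (fmap F u), (fmap F v).
by rewrite -!fmapM h1 h2 !fmap1.
Qed.

End Isos.

Variable D : triangulated k.
Implicit Types X Y Z W V : D.

Lemma sh0 X Y : fmap (sh D) (0 : mor X Y) = 0.
Proof.
have := sh_linear 1 (0 : mor X Y) 0; rewrite !scale1r addr0 => h.
by apply: (addrI (fmap (sh D) (0 : mor X Y))); rewrite addr0 -h.
Qed.

Lemma sh_inj X Y : injective (@fmap _ _ _ (sh D) X Y).
Proof.
move=> f g e; have [v [hv _]] := sh_unit_iso Y.
have := sh_unit_nat f; rewrite e -sh_unit_nat => e'.
by have := congr1 (fun x => v ∘ x) e'; rewrite /= !compA hv !comp1m.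
Qed.

Lemma shV_inj X Y : injective (@fmap _ _ _ (shV D) X Y).
Proof.
move=> f g e; have [v [_ hv]] := sh_counit_iso X.
have := sh_counit_nat f; rewrite e -sh_counit_nat => e'.
by have := congr1 (fun x => x ∘ v) e'; rewrite /= -!compA hv !compm1.
Qed.

Lemma sh_full X Y (g : mor (sh D X) (sh D Y)) : exists f, fmap (sh D) f = g.
Proof.
have [v [hv1 hv2]] := sh_unit_iso Y.
exists (v ∘ fmap (shV D) g ∘ sh_unit X); apply: shV_inj.
have [w [hw1 hw2]] := sh_unit_iso X.
have h := sh_unit_nat (v ∘ fmap (shV D) g ∘ sh_unit X).
have := congr1 (fun x => x ∘ w) h; rewrite /= -!compA hw2 !compm1 => <-.
by rewrite compA hv2 comp1m.
Qed.

Lemma shV0 X Y : fmap (shV D) (0 : mor X Y) = 0.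
Proof.
apply: sh_inj; rewrite sh0.
have [v [hv1 hv2]] := sh_counit_iso Y.
have := congr1 (fun x => v ∘ x) (sh_counit_nat (0 : mor X Y)).
by rewrite /= comp0m compm0 compA hv1 comp1m.
Qed.

Lemma shV_full X Y (g : mor (shV D X) (shV D Y)) : exists f, fmap (shV D) f = g.
Proof.
have [v [hv1 hv2]] := sh_counit_iso X.
exists (sh_counit Y ∘ fmap (sh D) g ∘ v); apply: sh_inj.
have h := sh_counit_nat (sh_counit Y ∘ fmap (sh D) g ∘ v).
have [w [hw1 hw2]] := sh_counit_iso Y.
have := congr1 (fun x => w ∘ x) h; rewrite /= !compA hw1 !comp1m => <-.
by rewrite -!compA hv1 compm1.
Qed.

Lemma fiter_inj n (F : functor D D) :
  (forall X Y, injective (@fmap _ _ _ F X Y)) ->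
  forall X Y, injective (@fmap _ _ _ (fiter n F) X Y).
Proof.
by move=> hF; elim: n => [|n IH] X Y f g //= e; apply: IH; exact: hF e.
Qed.

Lemma fiter_full n (F : functor D D) :
  (forall X Y (g : mor (F X) (F Y)), exists f, fmap F f = g) ->
  forall X Y (g : mor (fiter n F X) (fiter n F Y)), exists f, fmap (fiter n F) f = g.
Proof.
move=> hF; elim: n => [|n IH] X Y g /=; first by exists g.
by have [f <-] := hF _ _ g; have [f' <-] := IH _ _ f; exists f'.
Qed.

Lemma fiter0 n (F : functor D D) :
  (forall X Y, fmap F (0 : mor X Y) = 0) ->
  forall X Y, fmap (fiter n F) (0 : mor X Y) = 0.
Proof. by move=> hF; elim: n => [|n IH] X Y //=; rewrite IH hF. Qed.

Lemma fiter_ess n (F : functor D D) :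
  (forall X, exists Y, iso_ob (F Y) X) ->
  forall X, exists Y, iso_ob (fiter n F Y) X.
Proof.
move=> hF; elim: n => [|n IH] X /=; first by exists X; exact: iso_ob_refl.
have [Y hY] := hF X; have [Z hZ] := IH Y; exists Z.
exact: iso_ob_trans (iso_ob_fmap F hZ) hY.
Qed.

Lemma fiter_sh n (F : functor D D) :
  (forall X, iso_ob (sh D (F X)) (F (sh D X))) ->
  forall X, iso_ob (sh D (fiter n F X)) (fiter n F (sh D X)).
Proof.
move=> hF; elim: n => [|n IH] X /=; first exact: iso_ob_refl.
exact: iso_ob_trans (hF _) (iso_ob_fmap F (IH X)).
Qed.

Lemma sh_shV X : iso_ob (sh D (shV D X)) X.
Proof. by exists (sh_counit X); exact: sh_counit_iso. Qed.

Lemma shV_sh X : iso_ob (shV D (sh D X)) X.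
Proof. by apply: iso_ob_sym; exists (sh_unit X); exact: sh_unit_iso. Qed.

Lemma shz_inj i X Y : injective (@fmap _ _ _ (shz D i) X Y).
Proof.
by case: i => n; apply: fiter_inj => *; [exact: sh_inj | exact: shV_inj].
Qed.

Lemma shz_full i X Y (g : mor (shz D i X) (shz D i Y)) :
  exists f, fmap (shz D i) f = g.
Proof.
by case: i g => n; apply: fiter_full => *; [exact: sh_full | exact: shV_full].
Qed.

Lemma shz0 i X Y : fmap (shz D i) (0 : mor X Y) = 0.
Proof. by case: i => n; apply: fiter0 => *; [exact: sh0 | exact: shV0]. Qed.

Lemma shz_ess i X : exists Y, iso_ob (shz D i Y) X.
Proof.
case: i => n; apply: fiter_ess => Y.
  by exists (shV D Y); exact: sh_shV.
by exists (sh D Y); exact: shV_sh.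
Qed.

Lemma shz_sh i X : iso_ob (sh D (shz D i X)) (shz D i (sh D X)).
Proof.
case: i => n; apply: fiter_sh => Y; first exact: iso_ob_refl.
exact: iso_ob_trans (sh_shV Y) (iso_ob_sym (shV_sh Y)).
Qed.

Lemma shz_step i X : iso_ob (sh D (shz D i X)) (shz D (i + 1) X).
Proof.
case: i => [n|[|n]].
- have -> : Posz n + 1 = n.+1 by rewrite -addn1.
  exact: iso_ob_refl.
- exact: sh_shV.
- have -> : Negz n.+1 + 1 = Negz n.
    by rewrite !NegzE -[n.+2]addn1 PoszD opprD subrK.
  exact: sh_shV.
Qed.

Lemma dist_exact X Y Z W (f : mor X Y) (g : mor Y Z) (h : mor Z (sh D X))
    (u : mor W Y) : dist f g h -> g ∘ u = 0 -> exists v, u = f ∘ v.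
Proof.
move=> d e; have [[O hO] _] := tri_additive D.
have d1 := (tr_rot _ _ _).1 d; have d2 := (tr_rot _ _ _).1 (tr_id W hO).
have [|c [_ hc]] := tr_mor (a := u) (b := 0 : mor O Z) d2 d1.
  by rewrite e compm0.
have [v hv] := sh_full c; exists v; apply: sh_inj; rewrite fmapM hv.
move: hc; rewrite fmap1 -[- idmor _]scaleN1r compmZ compm1 => hc.
by apply: oppr_inj; rewrite -scaleN1r hc -scaleN1r compZm scaleN1r.
Qed.

Lemma dist_coexact X Y Z W (f : mor X Y) (g : mor Y Z) (h : mor Z (sh D X))
    (u : mor Z W) : dist f g h -> u ∘ g = 0 -> exists v, u = v ∘ h.
Proof.
move=> d e; have [[O hO] _] := tri_additive D.
have [w [hw1 hw2]] := sh_counit_iso W.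
have d1 := (tr_rot _ _ _).1 d.
have d2 := (tr_rot _ _ _).1 ((tr_rot _ _ _).1 (tr_id (shV D W) hO)).
have [|c [hc _]] := tr_mor (a := 0 : mor Y O) (b := w ∘ u) d1 d2.
  by rewrite -compA e !compm0.
exists (- (sh_counit W ∘ c)).
rewrite -scaleN1r compZm -compA hc fmap1 -[- idmor _]scaleN1r compZm comp1m.
by rewrite compmZ scalerA mulrNN mulr1 scale1r compA hw2 comp1m.
Qed.

Variable t : tstructure D.

Lemma ge1_perp Y :
  (forall W, ts_le0 t W -> forall f : mor W Y, f = 0) -> ts_ge0 t (sh D Y).
Proof.
move=> hY; have [A [B [a [b [c [d hA hB]]]]]] := ts_tri t Y.
have a0 : a = 0 by exact: hY.
have idA : idmor (sh D A) = 0.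
  have d2 := (tr_rot _ _ _).1 d.
  have d3 := (tr_rot _ _ _).1 d2.
  have [|v hv] := @dist_exact _ _ _ _ _ _ _ (idmor (sh D A)) d3.
    by rewrite a0 sh0 oppr0 comp0m.
  by rewrite hv (ts_orth v (ts_le_sh hA) hB) compm0.
apply: (ts_ge_iso (X := sh D B)) => //; apply: iso_ob_fmap; apply: iso_ob_sym.
have d2 := (tr_rot _ _ _).1 d.
have [|s hs] := @dist_exact _ _ _ _ _ _ _ (idmor B) d2.
  by rewrite compm1 -[c]comp1m idA comp0m.
exists b, s; split=> //; apply/eqP; rewrite -subr_eq0; apply/eqP.
have [|v ->] := @dist_exact _ _ _ _ _ _ _ (s ∘ b - idmor Y) d.
  by rewrite compmB compA -hs comp1m compm1 subrr.
by rewrite a0 comp0m.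
Qed.

Lemma le0_perp X :
  (forall W, ts_ge0 t (sh D W) -> forall f : mor X W, f = 0) -> ts_le0 t X.
Proof.
move=> hX; have [A [B [a [b [c [d hA hB]]]]]] := ts_tri t X.
have b0 : b = 0 by exact: hX.
have idB : idmor B = 0.
  have [|v hv] := @dist_coexact _ _ _ _ _ _ _ (idmor B) d.
    by rewrite b0 compm0.
  by rewrite hv (ts_orth v (ts_le_sh hA) hB) comp0m.
apply: (ts_le_iso (X := A)) => //.
have [|s hs] := @dist_exact _ _ _ _ _ _ _ (idmor X) d.
  by rewrite b0 comp0m.
exists a, s; split=> //; apply/eqP; rewrite -subr_eq0; apply/eqP.
apply: sh_inj; rewrite sh0.
have d3 := (tr_rot _ _ _).1 ((tr_rot _ _ _).1 d).
have [|v ->] := @dist_exact _ _ _ _ _ _ _ (fmap (sh D) (s ∘ a - idmor A)) d3.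
  rewrite -scaleN1r compZm -fmapM compmB compA -hs comp1m compm1 subrr sh0.
  by rewrite scaler0.
by rewrite -[c]compm1 idB compm0 comp0m.
Qed.

Lemma t_ge_perp i Y :
  t_ge t i Y <-> forall W, t_le t (i - 1) W -> forall f : mor W Y, f = 0.
Proof.
have e : iso_ob (sh D (shz D (i - 1) Y)) (shz D i Y).
  by have := shz_step (i - 1) Y; rewrite subrK.
split=> [hY W hW f|hY].
  apply: (shz_inj (i := i - 1)); rewrite shz0; apply: (ts_orth _ hW).
  exact: ts_ge_iso (iso_ob_sym e) hY.
apply: ts_ge_iso e _; apply: ge1_perp => V hV f.
have [W hW] := shz_ess (i - 1) V; have [u [v [hu hv]]] := hW.
have [g hg] := shz_full (f ∘ u).
have g0 : g = 0 by apply: hY; exact: ts_le_iso (iso_ob_sym hW) hV.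
by rewrite -[f]compm1 -hv compA -hg g0 shz0 comp0m.
Qed.

Lemma t_le_perp i X :
  t_le t i X <-> forall W, t_ge t (i + 1) W -> forall f : mor X W, f = 0.
Proof.
split=> [hX W hW f|hX].
  apply: (shz_inj (i := i)); rewrite shz0; apply: (ts_orth _ hX).
  exact: ts_ge_iso (iso_ob_sym (shz_step i W)) hW.
apply: le0_perp => V hV f.
have [W hW] := shz_ess i V; have [u [v [hu hv]]] := iso_ob_sym hW.
have [g hg] := shz_full (u ∘ f).
have g0 : g = 0.
  apply: hX; apply: ts_ge_iso (shz_step i W) _.
  exact: ts_ge_iso (iso_ob_fmap (sh D) (iso_ob_sym hW)) hV.
by rewrite -[f]comp1m -hu -compA -hg g0 shz0 compm0.
Qed.

Lemma t_le_sh i X : t_le t i X -> t_le t i (sh D X).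
Proof. by move=> hX; apply: ts_le_iso (shz_sh i X) _; exact: ts_le_sh. Qed.

Lemma t_ge_shV i X : t_ge t i X -> t_ge t i (shV D X).
Proof.
move=> hX; apply/t_ge_perp => W hW f; apply: sh_inj; rewrite sh0.
have [v [hv _]] := sh_counit_iso X.
have e : sh_counit X ∘ fmap (sh D) f = 0.
  exact: (proj1 (t_ge_perp _ _) hX _ (t_le_sh hW)).
by rewrite -[LHS]comp1m -hv -compA e compm0.
Qed.

Lemma t_le1 i X : t_le t i X -> t_le t (i + 1) X.
Proof. by move=> hX; apply: ts_le_iso (shz_step i X) _; exact: ts_le_sh. Qed.

Lemma t_le_mono i j X : i <= j -> t_le t i X -> t_le t j X.
Proof.
move=> ij; have -> : j = i + `|j - i|%N.
  by rewrite gez0_abs ?subr_ge0 // [RHS]addrC subrK.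
elim: `|j - i|%N => [|n IH] hX; first by rewrite addr0.
by rewrite -addn1 PoszD addrA; apply: t_le1; exact: IH.
Qed.

Lemma t_ge_mono i j X : i <= j -> t_ge t j X -> t_ge t i X.
Proof.
move=> ij /t_ge_perp hX; apply/t_ge_perp => W hW; apply: hX.
by apply: t_le_mono hW; rewrite lerD2r.
Qed.

Variable T : truncation t.

Lemma tau_le_inj m W X (f g : mor W (tau_le T m X)) : t_le t m W ->
  tau_le_map T m X ∘ f = tau_le_map T m X ∘ g -> f = g.
Proof.
move=> hW e; have [x [_ hx]] := tau_le_univ T (tau_le_map T m X ∘ f) hW.
by rewrite -(hx f) // -(hx g).
Qed.

Lemma tau_ge_inj m X W (f g : mor (tau_ge T m X) W) : t_ge t m W ->
  f ∘ tau_ge_map T m X = g ∘ tau_ge_map T m X -> f = g.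
Proof.
move=> hW e; have [x [_ hx]] := tau_ge_univ T (f ∘ tau_ge_map T m X) hW.
by rewrite -(hx f) // -(hx g).
Qed.

Lemma tau_le_ge m i X : t_ge t i X -> t_ge t i (tau_le T m X).
Proof.
move=> hX; apply/t_ge_perp => W hW f.
have [le_im|lt_mi] := leP (i - 1) m.
  apply: tau_le_inj; first exact: t_le_mono hW.
  by rewrite compm0; exact: (proj1 (t_ge_perp _ _) hX _ hW).
have h0 : idmor (tau_le T m X) = 0.
  apply: tau_le_inj; first exact: tau_leP.
  rewrite compm0 compm1; apply: (proj1 (t_ge_perp _ _) hX).
  by apply: t_le_mono (tau_leP T m X); exact: ltW.
by rewrite -[f]comp1m h0 comp0m.
Qed.

Lemma tau_ge_le m i X : t_le t i X -> t_le t i (tau_ge T m X).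
Proof.
move=> hX; apply/t_le_perp => W hW f.
have [le_mi|lt_im] := leP m (i + 1).
  apply: tau_ge_inj; first exact: t_ge_mono hW.
  by rewrite comp0m; exact: (proj1 (t_le_perp _ _) hX _ hW).
have h0 : idmor (tau_ge T m X) = 0.
  apply: tau_ge_inj; first exact: tau_geP.
  rewrite comp0m comp1m; apply: (proj1 (t_le_perp _ _) hX).
  by apply: t_ge_mono (tau_geP T m X); exact: ltW.
by rewrite -[f]compm1 h0 compm0.
Qed.

Lemma heart_tau X : t_heart t (tau_le T 0 (tau_ge T 0 X)).
Proof. by split; [exact: tau_leP | apply: tau_le_ge; exact: tau_geP]. Qed.

Lemma Omega_range n X : t_range t n X -> t_range t n (tau_le T 0 (shV D X)).
Proof.
by case=> _ h; split; [exact: tau_leP | apply: tau_le_ge; exact: t_ge_shV].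
Qed.

Lemma Sigma_range n X :
  t_range t n X -> t_range t n (tau_ge T (- n%:Z + 1) (sh D X)).
Proof.
by case=> h _; split; [apply: tau_ge_le; exact: t_le_sh | exact: tau_geP].
Qed.

Definition ext_heart (n : nat) : kcat k := fullsub (t_range t n).

Definition heart : kcat k := fullsub (t_heart t).

Definition Hcoh (i : int) : functor D heart :=
  fcorestr (F := fcomp (tau_le T 0) (fcomp (tau_ge T 0) (shz D i)))
    (fun X => heart_tau (shz D i X)).

Definition Hext (n : nat) (i : int) : functor (ext_heart n) heart :=
  fcomp (Hcoh i) (fincl (t_range t n)).

Definition Omega (n : nat) : functor (ext_heart n) (ext_heart n) :=
  fcorestr (F := fcomp (fcomp (tau_le T 0) (shV D)) (fincl (t_range t n)))
    (fun X : ext_heart n => Omega_range (fs_valP X)).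

Definition Sigma (n : nat) : functor (ext_heart n) (ext_heart n) :=
  fcorestr (F := fcomp (fcomp (tau_ge T (- n%:Z + 1)) (sh D)) (fincl (t_range t n)))
    (fun X : ext_heart n => Sigma_range (fs_valP X)).

(* Isomorphisms of triangles are taken in D, of which D^{[-n+1,0]} is a strictly
   full subcategory. The map v is the composite
   tau_{<=0}(Z[-1]) -> Z[-1] -> X0[1][-1] = X0; the triangle
   Y0[-1] -> Z[-1] -> X0 -> Y0 carries no signs, as negating two consecutive maps
   gives an isomorphic triangle. *)
Definition Delta (n : nat) (A B C : ext_heart n)
    (h : mor (Omega n A) C) (g : mor C B) (f : mor B A) : Prop :=
  let J := fincl (t_range t n) in
  exists (X0 Y0 : ext_heart n) (f0 : mor X0 Y0)
    (Z : D) (i : mor (J Y0) Z) (p : mor Z (sh D (J X0)))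
    (v : mor (tau_le T 0 (shV D Z)) (J X0)),
    [/\ dist (fmap J f0) i p,
        sh_unit (J X0) ∘ v = fmap (shV D) p ∘ tau_le_map T 0 (shV D Z) &
  exists (c : mor (tau_le T 0 (shV D Z)) (J C)) (b : mor (J X0) (J B))
    (a : mor (J Y0) (J A)),
    [/\ is_iso c, is_iso b & is_iso a] /\
    [/\ fmap J h ∘ fmap (tau_le T 0) (fmap (shV D) a)
        = c ∘ fmap (tau_le T 0) (fmap (shV D) i),
        fmap J g ∘ c = b ∘ v &
        fmap J f ∘ b = a ∘ fmap J f0]].

Definition Nabla (n : nat) (A B C : ext_heart n)
    (f : mor A B) (g : mor B C) (h : mor C (Sigma n A)) : Prop :=
  let J := fincl (t_range t n) in
  let m : int := - n%:Z + 1 in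
  exists (X0 Y0 : ext_heart n) (f0 : mor X0 Y0)
    (Z : D) (i : mor (J Y0) Z) (p : mor Z (sh D (J X0))),
    dist (fmap J f0) i p /\
  exists (a : mor (J X0) (J A)) (b : mor (J Y0) (J B))
    (c : mor (tau_ge T m Z) (J C)),
    [/\ is_iso a, is_iso b & is_iso c] /\
    [/\ fmap J f ∘ a = b ∘ fmap J f0,
        fmap J g ∘ b = c ∘ (tau_ge_map T m Z ∘ i) &
        fmap J h ∘ c
        = fmap (tau_ge T m) (fmap (sh D) a) ∘ fmap (tau_ge T m) p].

End TStructureTheory.

Section Pretriangulated.
Variable k : comPzRingType.

Definition ltriangles (C : kcat k) (Om : functor C C) : Type :=
  forall A B E : C, mor (Om A) E -> mor E B -> mor B A -> Prop.

Definition rtriangles (C : kcat k) (Si : functor C C) : Type :=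
  forall A B E : C, mor A B -> mor B E -> mor E (Si A) -> Prop.

Definition left_triangulated (C : kcat k) (Om : functor C C)
    (Del : ltriangles Om) : Prop :=
  [/\ additive_cat C,
      additive_functor Om &
      (forall (A B E A' B' E' : C)
          (h : mor (Om A) E) (g : mor E B) (f : mor B A)
          (h' : mor (Om A') E') (g' : mor E' B') (f' : mor B' A')
          (c : mor E E') (b : mor B B') (a : mor A A'),
        is_iso c -> is_iso b -> is_iso a ->
        c ∘ h = h' ∘ fmap Om a -> b ∘ g = g' ∘ c -> a ∘ f = f' ∘ b ->
        Del A B E h g f -> Del A' B' E' h' g' f')]
  /\
  [/\ (* LT1 *)
      (forall A Z : C, is_zero_ob Z -> Del Z A A 0 (idmor A) 0) /\
      (forall (A B : C) (f : mor B A),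
        exists (E : C) (h : mor (Om A) E) (g : mor E B), Del A B E h g f),
      (* LT2 *)
      forall (A B E : C) (h : mor (Om A) E) (g : mor E B) (f : mor B A),
        Del A B E h g f -> Del B E (Om A) (- fmap Om f) h g,
      (* LT3 *)
      forall (A B E A' B' E' : C)
          (h : mor (Om A) E) (g : mor E B) (f : mor B A)
          (h' : mor (Om A') E') (g' : mor E' B') (f' : mor B' A')
          (b : mor B B') (a : mor A A'),
        Del A B E h g f -> Del A' B' E' h' g' f' -> a ∘ f = f' ∘ b ->
        exists c : mor E E', c ∘ h = h' ∘ fmap Om a /\ b ∘ g = g' ∘ c &
      (* LT4 *)
      forall (A B F C0 E : C)
          (f2 : mor (Om A) F) (f1 : mor F B) (f : mor B A)
          (g2 : mor (Om B) E) (g1 : mor E C0) (g : mor C0 B),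
        Del A B F f2 f1 f -> Del B C0 E g2 g1 g ->
        exists (G : C) (v2 : mor (Om A) G) (v1 : mor G C0)
          (u2 : mor (Om F) E) (u1 : mor E G) (u : mor G F),
          [/\ Del A C0 G v2 v1 (f ∘ g) & Del F G E u2 u1 u] /\
          [/\ v1 ∘ u1 = g1, f1 ∘ u = g ∘ v1, u ∘ v2 = f2,
              u2 = g2 ∘ fmap Om f1 & u1 ∘ g2 = v2 ∘ fmap Om f]].

Definition right_triangulated (C : kcat k) (Si : functor C C)
    (Nab : rtriangles Si) : Prop :=
  @left_triangulated (opcat C) (opfunctor Si) (fun A B E h g f => Nab A B E f g h).

Definition pretriangulated (C : kcat k) (Si Om : functor C C)
    (Phi : adjunction Si Om) (Del : ltriangles Om) (Nab : rtriangles Si) : Prop :=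
  [/\ left_triangulated Del,
      right_triangulated Nab,
      forall (A B E A' B' E' : C)
          (f : mor A B) (g : mor B E) (h : mor E (Si A))
          (h' : mor (Om E') A') (g' : mor A' B') (f' : mor B' E')
          (a : mor A (Om E')) (b : mor B A') (a' : mor (Si A) E'),
        Nab A B E f g h -> Del E' B' A' h' g' f' ->
        adj Phi a' = a -> b ∘ f = h' ∘ a ->
        exists c : mor E B', c ∘ g = g' ∘ b /\ a' ∘ h = f' ∘ c &
      forall (A B E A' B' E' : C)
          (f : mor A B) (g : mor B E) (h : mor E (Si A))
          (h' : mor (Om E') A') (g' : mor A' B') (f' : mor B' E')
          (c : mor E B') (a' : mor (Si A) E'),
        Nab A B E f g h -> Del E' B' A' h' g' f' ->
        a' ∘ h = f' ∘ c ->
        exists b : mor B A', b ∘ f = h' ∘ adj Phi a' /\ c ∘ g = g' ∘ b].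

End Pretriangulated.

Section Extriangulated.
Variables (k : comPzRingType) (C : kcat k).

(* [bf_ob X A] is E(X, A), contravariant in X and covariant in A. *)
Record bilinear_functor := BilinearFunctor {
  bf_ob : C -> C -> lmodType k;
  bf_push : forall X A A', mor A A' -> bf_ob X A -> bf_ob X A';
  bf_pull : forall X X' A, bf_ob X A -> mor X' X -> bf_ob X' A;
  bf_push1 : forall X A (d : bf_ob X A), bf_push (idmor A) d = d;
  bf_pull1 : forall X A (d : bf_ob X A), bf_pull d (idmor X) = d;
  bf_pushM : forall X A A' A'' (b : mor A' A'') (a : mor A A') (d : bf_ob X A),
    bf_push (b ∘ a) d = bf_push b (bf_push a d);
  bf_pullM : forall X X' X'' A (d : bf_ob X A) (c : mor X' X) (b : mor X'' X'),
    bf_pull d (c ∘ b) = bf_pull (bf_pull d c) b;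
  bf_pushpull : forall X X' A A' (a : mor A A') (d : bf_ob X A) (c : mor X' X),
    bf_push a (bf_pull d c) = bf_pull (bf_push a d) c;
  bf_push_lin : forall X A A' (a : mor A A') r (d e : bf_ob X A),
    bf_push a (r *: d + e) = r *: bf_push a d + bf_push a e;
  bf_pull_lin : forall X X' A (c : mor X' X) r (d e : bf_ob X A),
    bf_pull (r *: d + e) c = r *: bf_pull d c + bf_pull e c;
  bf_linl : forall X A A' (a a' : mor A A') r (d : bf_ob X A),
    bf_push (r *: a + a') d = r *: bf_push a d + bf_push a' d;
  bf_linr : forall X X' A (c c' : mor X' X) r (d : bf_ob X A),
    bf_pull d (r *: c + c') = r *: bf_pull d c + bf_pull d c'
}.

Variable E : bilinear_functor.

(* [s d f g] means that (f, g) belongs to the equivalence class s(d). *)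
Definition realization : Type :=
  forall A B X : C, bf_ob E X A -> mor A B -> mor B X -> Prop.

Definition seq_equiv (A B B' X : C) (f : mor A B) (g : mor B X)
    (f' : mor A B') (g' : mor B' X) : Prop :=
  exists b : mor B B', [/\ is_iso b, b ∘ f = f' & g' ∘ b = g].

Definition additive_realization (s : realization) : Prop :=
  [/\
      forall (A X : C) (d : bf_ob E X A),
        exists (B : C) (f : mor A B) (g : mor B X),
          s A B X d f g /\
          forall (B' : C) (f' : mor A B') (g' : mor B' X),
            s A B' X d f' g' <-> seq_equiv f g f' g',
      forall (A0 B0 X0 A1 B1 X1 : C) (d0 : bf_ob E X0 A0) (d1 : bf_ob E X1 A1)
          (f0 : mor A0 B0) (g0 : mor B0 X0) (f1 : mor A1 B1) (g1 : mor B1 X1)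
          (a : mor A0 A1) (c : mor X0 X1),
        s A0 B0 X0 d0 f0 g0 -> s A1 B1 X1 d1 f1 g1 ->
        bf_push a d0 = bf_pull d1 c ->
        exists b : mor B0 B1, b ∘ f0 = f1 ∘ a /\ c ∘ g0 = g1 ∘ b,
      forall (A X : C) (P : biproduct A X),
        s A (bp_ob P) X 0 (bp_in1 P) (bp_pr2 P) &
      forall (A0 B0 X0 A1 B1 X1 : C) (d0 : bf_ob E X0 A0) (d1 : bf_ob E X1 A1)
          (f0 : mor A0 B0) (g0 : mor B0 X0) (f1 : mor A1 B1) (g1 : mor B1 X1)
          (PA : biproduct A0 A1) (PB : biproduct B0 B1) (PX : biproduct X0 X1),
        s A0 B0 X0 d0 f0 g0 -> s A1 B1 X1 d1 f1 g1 ->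
        s (bp_ob PA) (bp_ob PB) (bp_ob PX)
          (bf_push (bp_in1 PA) (bf_pull d0 (bp_pr1 PX)) +
           bf_push (bp_in2 PA) (bf_pull d1 (bp_pr2 PX)))
          (bp_map PA PB f0 f1) (bp_map PB PX g0 g1)].

Definition inflation (s : realization) (A B : C) (f : mor A B) : Prop :=
  exists (X : C) (g : mor B X) (d : bf_ob E X A), s A B X d f g.

Definition deflation (s : realization) (B X : C) (g : mor B X) : Prop :=
  exists (A : C) (f : mor A B) (d : bf_ob E X A), s A B X d f g.

Definition extriangulated (s : realization) : Prop :=
  additive_cat C /\ additive_realization s /\
  [/\ (* ET3 *)
      forall (A B X A' B' X' : C) (d : bf_ob E X A) (d' : bf_ob E X' A')
          (f : mor A B) (g : mor B X) (f' : mor A' B') (g' : mor B' X')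
          (a : mor A A') (b : mor B B'),
        s A B X d f g -> s A' B' X' d' f' g' -> b ∘ f = f' ∘ a ->
        exists c : mor X X', c ∘ g = g' ∘ b /\ bf_push a d = bf_pull d' c,
      (* ET3' *)
      forall (A B X A' B' X' : C) (d : bf_ob E X A) (d' : bf_ob E X' A')
          (f : mor A B) (g : mor B X) (f' : mor A' B') (g' : mor B' X')
          (b : mor B B') (c : mor X X'),
        s A B X d f g -> s A' B' X' d' f' g' -> c ∘ g = g' ∘ b ->
        exists a : mor A A', b ∘ f = f' ∘ a /\ bf_push a d = bf_pull d' c,
      (* ET4 *)
      forall (A B G X F : C) (f : mor A B) (f' : mor B G) (d : bf_ob E G A)
          (g : mor B X) (g' : mor X F) (d' : bf_ob E F B),
        s A B G d f f' -> s B X F d' g g' ->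
        exists (H : C) (h : mor X H) (d'' : bf_ob E H A)
          (u : mor G H) (e : mor H F),
          [/\ s A X H d'' (g ∘ f) h & s G H F (bf_push f' d') u e] /\
          [/\ u ∘ f' = h ∘ g, e ∘ h = g', d = bf_pull d'' u &
              bf_push f d'' = bf_pull d' e] &
      (* ET4' *)
      forall (A B G X F : C) (f : mor B A) (f' : mor G B) (d : bf_ob E A G)
          (g : mor X B) (g' : mor F X) (d' : bf_ob E B F),
        s G B A d f' f -> s F X B d' g' g ->
        exists (H : C) (h : mor H X) (d'' : bf_ob E A H)
          (u : mor H G) (e : mor F H),
          [/\ s H X A d'' h (f ∘ g) & s F H G (bf_pull d' f') e u] /\
          [/\ f' ∘ u = g ∘ h, h ∘ e = g', d = bf_push u d'' &
              bf_pull d'' f = bf_push e d']].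

End Extriangulated.

(* The restriction to D^{[-n+1,0]} of E(X, A) = D(X, A[1]). *)
Section ExtBifunctor.
Variables (k : comPzRingType) (D : triangulated k) (t : tstructure D) (n : nat).

Let J := fincl (t_range t n).

Program Definition ext_bifunctor : bilinear_functor (ext_heart t n) :=
  @BilinearFunctor k (ext_heart t n)
    (fun X A => mor (J X) (sh D (J A)))
    (fun X A A' a d => fmap (sh D) (fmap J a) ∘ d)
    (fun X X' A d c => d ∘ fmap J c) _ _ _ _ _ _ _ _ _.
Next Obligation.
move=> X A d; have e : fmap (sh D) (idmor (J A)) ∘ d = d by rewrite fmap1 comp1m.
exact: e.
Qed.
Next Obligation. by move=> X A d; exact: (compm1 (d : mor (J X) (sh D (J A)))). Qed.
Next Obligation.
move=> X A A' A'' b a d; have e : fmap (sh D) (fmap J b ∘ fmap J a) ∘ d =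
  fmap (sh D) (fmap J b) ∘ (fmap (sh D) (fmap J a) ∘ d) by rewrite fmapM compA.
exact: e.
Qed.
Next Obligation. by move=> X X' X'' A d c b; exact: compA. Qed.
Next Obligation. by move=> X X' A A' a d c; exact: compA. Qed.
Next Obligation. by move=> X A A' a r d e; exact: comp_linr. Qed.
Next Obligation. by move=> X X' A c r d e; exact: comp_linl. Qed.
Next Obligation.
move=> X A A' a a' r d.
exact: (etrans (congr1 (ccomp^~ d) (sh_linear r (fmap J a) (fmap J a')))
  (comp_linl _ _ _ _)).
Qed.
Next Obligation. by move=> X X' A c c' r d; exact: comp_linr. Qed.

End ExtBifunctor.

Definition has_unique_factorization (k : comPzRingType) (C : kcat k)
    (PE PM : forall X Y : C, mor X Y -> Prop) : Prop :=
  forall (X Y : C) (f : mor X Y),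
    (exists (Z : C) (e : mor X Z) (m : mor Z Y),
      [/\ f = m ∘ e, PE X Z e & PM Z Y m]) /\
    (forall (Z Z' : C) (e : mor X Z) (m : mor Z Y)
        (e' : mor X Z') (m' : mor Z' Y),
      f = m ∘ e -> PE X Z e -> PM Z Y m ->
      f = m' ∘ e' -> PE X Z' e' -> PM Z' Y m' ->
      exists u : mor Z Z', [/\ is_iso u, u ∘ e = e' & m' ∘ u = m]).

(* Main.v *)
(* All notions involved are detected by Hom functors. For a morphism f of
   D^{[a,c]}, each of "H^a(f) is mono", "Omega^{c-a}(f) is mono" and "the cone of
   f lies in D^{>=a}" says that Hom(V, f) is injective for every V in D^{<=a};
   "the cone of f lies in D^{<=a-1}" says that Hom(f, V) is injective for V in
   D^{>=a} and bijective for V in D^{>=a+1}, and this is what the conditions on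
   H^i(e), respectively on Sigma^i(e), in (iii) amount to. The factorization of f
   comes from truncating its cone by means of the octahedral axiom, and its
   uniqueness from orthogonality.

   A left triangle of D^{[a,c]} is a triangle W -> B -> A -> W[1] of D together
   with a coreflection E -> W into D^{<=c}. Objects of D^{>=c+1} are invisible to
   Hom(V, -) for V in D^{<=c}, so each axiom follows from the corresponding axiom
   of D and a five lemma relative to D^{<=c}. Right triangles, deflations and
   (iii)' are treated by passing to the opposite triangulated category, which
   exchanges [a,c] and [-c,-a]. *)
From mathcomp Require Import all_boot all_order all_algebra.
From mathcomp Require Import boolp zify.
Require Import Defs.

Set Implicit Arguments.
Unset Strict Implicit.
Unset Printing Implicit Defensive.

Import Order.TTheory GRing.Theory Num.Theory.
Local Open Scope ring_scope.
Local Open Scope cat_scope.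

(** * Hom tests in linear categories *)

(** Say that f is tested at level j when Hom(V, f) is examined for all V in D^{<=j}. Since maps from
    V to a loop object are maps from V[1], each loop lowers the level by one: the exponent n-1 is
    the number of steps from 0 down to -n+1. Consecutive levels are linked through cohomology: once
    f is bijective at level i-1, H^i(f) is a monomorphism exactly when f is injective at level i.
    Conditions on a range of H^i can therefore be assembled by induction from an end of the interval
    beyond which all Homs vanish, without exact sequences in the heart. Two points resist a plain
    appeal to duality. H^0 is defined by truncations in a fixed order, so induced maps on cohomology
    need a self-dual description. Signs matter as well: left triangles involve a fibre, hence a
    rotation and a sign, while right triangles involve a cone and none; the triangles of the
    opposite category are normalized so that these two conventions correspond. *)

Section LinearCategory.
Variables (k : comPzRingType) (C : kcat k).
Implicit Types X Y Z V W : C.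

Lemma compDm X Y Z (g g' : mor Y Z) (f : mor X Y) : (g + g') ∘ f = g ∘ f + g' ∘ f.
Proof. by rewrite -[g]scale1r comp_linl !scale1r. Qed.

Lemma compmD X Y Z (g : mor Y Z) (f f' : mor X Y) : g ∘ (f + f') = g ∘ f + g ∘ f'.
Proof. by rewrite -[f]scale1r comp_linr !scale1r. Qed.

Lemma compNm X Y Z (g : mor Y Z) (f : mor X Y) : (- g) ∘ f = - (g ∘ f).
Proof. by rewrite -scaleN1r compZm scaleN1r. Qed.

Lemma compmN X Y Z (g : mor Y Z) (f : mor X Y) : g ∘ (- f) = - (g ∘ f).
Proof. by rewrite -scaleN1r compmZ scaleN1r. Qed.

Lemma iso_opp X Y (f : mor X Y) : is_iso f -> is_iso (- f).
Proof. by move=> [g [g1 g2]]; exists (- g); rewrite !compNm !compmN !opprK. Qed.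

Lemma iso_monoP X Y (f : mor X Y) : is_iso f -> is_mono f.
Proof.
by move=> [g [g1 _]] W u v e; rewrite -[u]comp1m -[v]comp1m -g1 -!compA e.
Qed.

Lemma iso_epiP X Y (f : mor X Y) : is_iso f -> is_epi f.
Proof.
by move=> [g [_ g2]] W u v e; rewrite -[u]compm1 -[v]compm1 -g2 !compA e.
Qed.

Lemma zero_obP Z : idmor Z = 0 -> is_zero_ob Z.
Proof.
move=> e X; split=> f; first by rewrite -[f]comp1m e comp0m.
by rewrite -[f]compm1 e compm0.
Qed.

Definition inj_from (P : C -> Prop) X Y (f : mor X Y) : Prop :=
  forall V, P V -> forall u v : mor V X, f ∘ u = f ∘ v -> u = v.
Definition surj_from (P : C -> Prop) X Y (f : mor X Y) : Prop :=
  forall V, P V -> forall u : mor V Y, exists v : mor V X, f ∘ v = u.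
Definition bij_from (P : C -> Prop) X Y (f : mor X Y) : Prop :=
  inj_from P f /\ surj_from P f.
Definition coreflection (P : C -> Prop) X Y (f : mor X Y) : Prop :=
  P X /\ bij_from P f.

(** This and the next three notions unfold to the preceding ones in [opcat], so that lemmas on maps
    out of test objects dualize by instantiation. *)
Definition inj_to (P : C -> Prop) X Y (f : mor X Y) : Prop :=
  forall V, P V -> forall u v : mor Y V, u ∘ f = v ∘ f -> u = v.
Definition surj_to (P : C -> Prop) X Y (f : mor X Y) : Prop :=
  forall V, P V -> forall u : mor X V, exists v : mor Y V, v ∘ f = u.
Definition bij_to (P : C -> Prop) X Y (f : mor X Y) : Prop :=
  inj_to P f /\ surj_to P f.
Definition reflection (P : C -> Prop) X Y (f : mor X Y) : Prop :=
  P Y /\ bij_to P f.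

Lemma inj_from0 (P : C -> Prop) X Y (f : mor X Y) :
  (forall V, P V -> forall u : mor V X, f ∘ u = 0 -> u = 0) -> inj_from P f.
Proof.
move=> h V hV u v e; apply/eqP; rewrite -subr_eq0; apply/eqP.
by apply: h; rewrite // compmB e subrr.
Qed.

Lemma iso_bij_from P X Y (f : mor X Y) : is_iso f -> bij_from P f.
Proof.
move=> hf; split=> [V _ u v|V _ u]; first exact: iso_monoP.
by case: hf => g [_ g2]; exists (g ∘ u); rewrite compA g2 comp1m.
Qed.

(** Yoneda inside P: lifting the identity of Y gives a right inverse, which injectivity on maps out
    of X makes two-sided. *)
Lemma bij_from_iso (P : C -> Prop) X Y (f : mor X Y) :
  P X -> P Y -> bij_from P f -> is_iso f.
Proof.
move=> hX hY [fi fs]; have [g hg] := fs _ hY (idmor Y); exists g; split=> //.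
by apply: (fi _ hX); rewrite compA hg comp1m compm1.
Qed.

Lemma inj_from_comp P X Y Z (g : mor Y Z) (f : mor X Y) :
  inj_from P g -> inj_from P f -> inj_from P (g ∘ f).
Proof. by move=> hg hf V hV u v; rewrite -!compA => /hg e; apply: hf => //; apply: e. Qed.

Lemma surj_from_comp P X Y Z (g : mor Y Z) (f : mor X Y) :
  surj_from P g -> surj_from P f -> surj_from P (g ∘ f).
Proof.
move=> hg hf V hV u; have [v <-] := hg V hV u; have [w <-] := hf V hV v.
by exists w; rewrite compA.
Qed.

Lemma bij_from_comp P X Y Z (g : mor Y Z) (f : mor X Y) :
  bij_from P g -> bij_from P f -> bij_from P (g ∘ f).
Proof.
by move=> [gi gs] [fi fs]; split; [exact: inj_from_comp | exact: surj_from_comp].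
Qed.

Lemma inj_from_cancel P X Y Z (g : mor Y Z) (f : mor X Y) :
  inj_from P (g ∘ f) -> inj_from P f.
Proof. by move=> h V hV u v e; apply: h => //; rewrite -!compA e. Qed.

Lemma bij_from_cancel P X Y Z (g : mor Y Z) (f : mor X Y) :
  inj_from P g -> bij_from P (g ∘ f) -> bij_from P f.
Proof.
move=> hg [gfi gfs]; split; first exact: inj_from_cancel gfi.
move=> V hV u; have [v hv] := gfs V hV (g ∘ u); exists v.
by apply: (hg V) => //; rewrite -hv compA.
Qed.

Lemma bij_from_cancelr P X Y Z (g : mor Y Z) (f : mor X Y) :
  bij_from P f -> bij_from P (g ∘ f) -> bij_from P g.
Proof.
move=> [fi fs] [gfi gfs]; split=> [V hV u v e|V hV u].
  have [u' eu] := fs V hV u; have [v' ev] := fs V hV v.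
  rewrite -eu -ev; congr (_ ∘ _); apply: (gfi V) => //.
  by rewrite -!compA eu ev.
by have [v hv] := gfs V hV u; exists (f ∘ v); rewrite compA.
Qed.

Lemma inj_from_cancelr P X Y Z (g : mor Y Z) (f : mor X Y) :
  surj_from P f -> inj_from P (g ∘ f) -> inj_from P g.
Proof.
move=> fs gfi V hV u v e.
have [u' eu] := fs V hV u; have [v' ev] := fs V hV v.
rewrite -eu -ev; congr (_ ∘ _); apply: (gfi V) => //.
by rewrite -!compA eu ev.
Qed.

Lemma inj_from_square P X Y X' Y' (f : mor X Y) (f' : mor X' Y') (a : mor X X') (b : mor Y Y') :
  is_iso a -> is_iso b -> b ∘ f = f' ∘ a -> inj_from P f <-> inj_from P f'.
Proof.
move=> ha hb e; have [ai as_] := iso_bij_from P ha; have [bi _] := iso_bij_from P hb.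
split=> h; first by apply: inj_from_cancelr as_ _; rewrite -e; exact: inj_from_comp.
by apply: (@inj_from_cancel _ _ _ _ b); rewrite e; exact: inj_from_comp.
Qed.

Lemma bij_from_square P X Y X' Y' (f : mor X Y) (f' : mor X' Y') (a : mor X X') (b : mor Y Y') :
  is_iso a -> is_iso b -> b ∘ f = f' ∘ a -> bij_from P f <-> bij_from P f'.
Proof.
move=> ha hb e; have ba := iso_bij_from P ha; have bb := iso_bij_from P hb.
split=> h; first by apply: bij_from_cancelr ba _; rewrite -e; exact: bij_from_comp.
by apply: (bij_from_cancel bb.1); rewrite e; exact: bij_from_comp.
Qed.

End LinearCategory.

Lemma iso_fmap (k : comPzRingType) (C E : kcat k) (F : functor C E) (X Y : C) (f : mor X Y) :
  is_iso f -> is_iso (fmap F f).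
Proof. by move=> [g [g1 g2]]; exists (fmap F g); rewrite -!fmapM g1 g2 !fmap1. Qed.

(** * Triangulated categories *)

Section Triangles.
Variables (k : comPzRingType) (D : triangulated k).
Implicit Types A B X Y Z V W : D.
Notation S := (sh D).

Lemma shD X Y (f g : mor X Y) : fmap S (f + g) = fmap S f + fmap S g.
Proof. by rewrite -[f]scale1r sh_linear !scale1r. Qed.

Lemma shN X Y (f : mor X Y) : fmap S (- f) = - fmap S f.
Proof. by rewrite -scaleN1r -[_ *: _]addr0 sh_linear sh0 addr0 scaleN1r. Qed.

(** Maps V → X[1] amount to maps V[-1] → X; this form is what moves a Hom test by one shift. *)
Lemma counit_factor V X (u : mor V (S X)) :
  exists u' : mor (shV D V) X, fmap S u' = u ∘ sh_counit V.
Proof. exact: sh_full. Qed.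

Lemma counit_epi V X (u v : mor V X) : u ∘ sh_counit V = v ∘ sh_counit V -> u = v.
Proof. exact: iso_epiP (sh_counit_iso V) _ _ _. Qed.

Lemma dist_iso2 X Y Z Y' Z' f g h (f' : mor X Y') (g' : mor Y' Z') h'
    (b : mor Y Y') (c : mor Z Z') : is_iso b -> is_iso c ->
  @dist _ D X Y Z f g h -> b ∘ f = f' -> c ∘ g = g' ∘ b -> h = h' ∘ c -> dist f' g' h'.
Proof.
move=> hb hc hd e1 e2 e3; apply: tr_iso hd; exists (idmor X), b, c.
by rewrite fmap1 comp1m compm1; split; [split=> //; exact: iso_id | split].
Qed.

Lemma dist_rot X Y Z f g h : @dist _ D X Y Z f g h -> dist g h (- fmap S f).
Proof. exact: (proj1 (tr_rot _ _ _)). Qed.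

Lemma dist_neg X Y Z f g h : @dist _ D X Y Z f g h -> dist (- f) (- g) h.
Proof.
move=> hd; apply: (@dist_iso2 _ _ _ _ _ f g h _ _ _ (- idmor Y) (idmor Z)) => //.
- exact: iso_opp (iso_id Y).
- exact: iso_id.
- by rewrite compNm comp1m.
- by rewrite comp1m compmN compNm opprK compm1.
- by rewrite compm1.
Qed.

Lemma dist_neg2 X Y Z f g h : @dist _ D X Y Z f g h -> dist f (- g) (- h).
Proof.
move=> hd; apply: (@dist_iso2 _ _ _ _ _ f g h _ _ _ (idmor Y) (- idmor Z)) => //.
- exact: iso_id.
- exact: iso_opp (iso_id Z).
- by rewrite comp1m.
- by rewrite compNm comp1m compm1.
- by rewrite compNm compmN opprK compm1.
Qed.

(** Three rotations put a sign on all three shifted maps, and signs on two consecutive maps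
    cancel. *)
Lemma dist_sh X Y Z f g h : @dist _ D X Y Z f g h <->
  dist (fmap S f) (fmap S g) (- fmap S h).
Proof.
split=> [/dist_rot/dist_rot/dist_rot/dist_neg|hd]; first by rewrite !opprK.
by do 3! apply/tr_rot; have := dist_neg hd.
Qed.

Lemma dist_sh_neg X Y Z f g (h : mor Z (S X)) :
  dist (fmap S f) (fmap S g) (fmap S (- h)) -> @dist _ D X Y Z f g h.
Proof. by rewrite shN => hd; apply/dist_sh. Qed.

Lemma tr_id_r X Z : is_zero_ob Z -> dist (0 : mor Z X) (idmor X) (0 : mor X (S Z)).
Proof.
move=> hZ; apply/tr_rot; rewrite sh0 oppr0; apply: tr_id.
by apply: zero_obP; rewrite -fmap1 ((hZ Z).1 (idmor Z)) sh0.
Qed.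

Lemma dist_comp0 X Y Z f g h : @dist _ D X Y Z f g h -> g ∘ f = 0.
Proof.
move=> hd; have [[O hO] _] := tri_additive D.
have [|c [hc _]] := tr_mor (a := idmor X) (b := f) (tr_id X hO) hd.
  by rewrite !compm1.
by rewrite -hc compm0.
Qed.

Lemma dist_comp0r X Y Z f g h : @dist _ D X Y Z f g h -> h ∘ g = 0.
Proof. by move/dist_rot/dist_comp0. Qed.

Lemma dist_comp0s X Y Z f g h : @dist _ D X Y Z f g h -> fmap S f ∘ h = 0.
Proof. by move/dist_rot/dist_rot/dist_comp0; rewrite compNm => /eqP; rewrite oppr_eq0 => /eqP. Qed.

Lemma dist_exact_r X Y Z W f g h (u : mor W Z) :
  @dist _ D X Y Z f g h -> h ∘ u = 0 -> exists v, u = g ∘ v.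
Proof. by move/dist_rot => hd; exact: dist_exact hd. Qed.

Lemma dist_exact_s X Y Z W f g h (u : mor W (S X)) :
  @dist _ D X Y Z f g h -> fmap S f ∘ u = 0 -> exists v, u = h ∘ v.
Proof.
by move/dist_rot/dist_rot => hd e; apply: (dist_exact hd); rewrite compNm e oppr0.
Qed.

Lemma dist_coexact_l X Y Z W f g h (u : mor Y W) :
  @dist _ D X Y Z f g h -> u ∘ f = 0 -> exists v, u = v ∘ g.
Proof.
move=> hd e; have [[O hO] _] := tri_additive D.
have [|c [hc _]] := tr_mor (a := 0) (b := u) hd (tr_id_r W hO).
  by rewrite comp0m.
by exists c; rewrite hc comp1m.
Qed.

(** After one rotation the missing map is the third one, as in [tr_mor]; fullness of the shift then
    desuspends it. *)
Lemma tr_mor1 X Y Z X' Y' Z' f g h f' g' h' (b : mor Y Y') (c : mor Z Z') :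
  @dist _ D X Y Z f g h -> @dist _ D X' Y' Z' f' g' h' -> c ∘ g = g' ∘ b ->
  exists a : mor X X', b ∘ f = f' ∘ a /\ fmap S a ∘ h = h' ∘ c.
Proof.
move=> /dist_rot hd /dist_rot hd' e.
have [a' [e1 e2]] := tr_mor hd hd' e; have [a ea] := sh_full a'.
exists a; rewrite ea; split=> //; apply: sh_inj; rewrite !fmapM ea.
by apply: oppr_inj; rewrite -compmN e2 compNm.
Qed.

Lemma tr_mor2 X Y Z X' Y' Z' f g h f' g' h' (a : mor X X') (c : mor Z Z') :
  @dist _ D X Y Z f g h -> @dist _ D X' Y' Z' f' g' h' ->
  fmap S a ∘ h = h' ∘ c ->
  exists b : mor Y Y', b ∘ f = f' ∘ a /\ c ∘ g = g' ∘ b.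
Proof.
move=> /dist_rot hd /dist_rot hd' e.
have [b [e1 e2]] := tr_mor1 hd hd' e; exists b; split=> //.
by apply: sh_inj; rewrite !fmapM; apply: oppr_inj; rewrite -compmN e2 compNm.
Qed.

Lemma fibre_ex Y Z (f : mor Y Z) :
  exists (W : D) (w : mor W Y) (d : mor Z (S W)), dist w f d.
Proof.
have [U [i [p hd]]] := tr_cone f.
have [w hw] := sh_full (- (p ∘ sh_counit U)).
have [c [hc1 hc2]] := sh_counit_iso U.
exists (shV D U), w, (c ∘ i); apply/tr_rot; rewrite hw opprK.
apply: (@dist_iso2 _ _ _ _ _ f i p _ _ _ (idmor Z) c) => //.
- exact: iso_id.
- by exists (sh_counit U).
- by rewrite comp1m.
- by rewrite compm1.
- by rewrite -compA hc2 compm1.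
Qed.

(* Relative five lemma: it is applied with P the aisle of a t-structure, which is
   stable under the positive shift only. *)
Lemma five_bij_from (P : D -> Prop) X Y Z X' Y' Z' f g h f' g' h'
    (a : mor X X') (b : mor Y Y') (c : mor Z Z') :
  (forall V, P V -> P (S V)) ->
  @dist _ D X Y Z f g h -> @dist _ D X' Y' Z' f' g' h' ->
  b ∘ f = f' ∘ a -> c ∘ g = g' ∘ b -> fmap S a ∘ h = h' ∘ c ->
  bij_from P b -> bij_from P c -> bij_from P a.
Proof.
move=> hP hd hd' e1 e2 e3 [bi bs] [ci cs]; split.
  apply: inj_from0 => V hV u au; have hSV := hP _ hV.
  have fu : f ∘ u = 0 by apply: (bi V) => //; rewrite compA e1 -compA au !compm0.
  have [|z ez] := dist_exact_s (u := fmap S u) hd; first by rewrite -fmapM fu sh0.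
  have [|y' ey'] := dist_exact_r (u := c ∘ z) hd'.
    by rewrite compA -e3 -compA -ez -fmapM au sh0.
  have [y ey] := bs _ hSV y'.
  have ezy : z = g ∘ y by apply: (ci _ hSV); rewrite ey' -ey !compA e2.
  by apply: sh_inj; rewrite ez ezy compA (dist_comp0r hd) comp0m sh0.
move=> V hV u; have hSV := hP _ hV; have [y ey] := bs V hV (f' ∘ u).
have gy : g ∘ y = 0.
  apply: (ci V) => //; rewrite compA e2 -compA ey compA.
  by rewrite (dist_comp0 hd') comp0m compm0.
have [x ex] := dist_exact hd gy.
have [|z' ez'] := dist_exact_s (u := fmap S (a ∘ x - u)) hd'.
  by rewrite -fmapM compmB compA -e1 -compA -ex ey subrr sh0.
have [z ez] := cs _ hSV z'.
have [x2 ex2] := sh_full (h ∘ z).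
exists (x - x2); rewrite compmB; apply/eqP; rewrite subr_eq addrC -subr_eq; apply/eqP.
by apply: sh_inj; rewrite ez' -ez compA -e3 -compA -ex2 fmapM.
Qed.

(** The relative five lemma concludes about the first map, so the triangles are rotated once to
    bring the middle map there, and every object is allowed as a test. *)
Lemma five_iso X Y Z X' Y' Z' f g h f' g' h'
    (a : mor X X') (b : mor Y Y') (c : mor Z Z') :
  @dist _ D X Y Z f g h -> @dist _ D X' Y' Z' f' g' h' ->
  b ∘ f = f' ∘ a -> c ∘ g = g' ∘ b -> fmap S a ∘ h = h' ∘ c ->
  is_iso a -> is_iso c -> is_iso b.
Proof.
move=> /dist_rot hd /dist_rot hd' e1 e2 e3 ia ic.
apply: (@bij_from_iso _ _ (fun=> True)) => //.
apply: (five_bij_from _ hd hd' e2 e3) => //; try exact: iso_bij_from.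
  by rewrite compmN -!fmapM e1 compNm fmapM.
by apply: iso_bij_from; exact: iso_fmap.
Qed.

Lemma dist_zero_iso X Y Z f g h : @dist _ D X Y Z f g h -> is_zero_ob Z -> is_iso f.
Proof.
move=> hd hZ; have [s hs] : exists s, idmor Y = f ∘ s.
  by apply: (dist_exact hd); exact: (hZ Y).1.
exists s; split=> //; apply: sh_inj; rewrite fmap1; apply/eqP.
rewrite -subr_eq0 -(fmap1 S X) -shN -shD; apply/eqP.
have [|v ->] := dist_exact_s (u := fmap S (s ∘ f - idmor X)) hd.
  by rewrite -fmapM compmB compA -hs comp1m compm1 subrr sh0.
by rewrite ((hZ _).2 h) comp0m.
Qed.

(** In the rotated triangles the cones are shifts of the given fibres; [tr_oct] is applied there and
    its output desuspended, the sign of the rotation being absorbed by [dist_sh_neg]. *)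
Lemma tr_oct_fibre A B G X F H (f' : mor G B) (f : mor B A) (d : mor A (S G))
    (g' : mor F X) (g : mor X B) (d' : mor B (S F))
    (h : mor H X) (d'' : mor A (S H)) :
  dist f' f d -> dist g' g d' -> dist h (f ∘ g) d'' ->
  exists (u : mor H G) (e : mor F H), dist e u (d' ∘ f') /\
    [/\ f' ∘ u = g ∘ h, h ∘ e = g', d = fmap S u ∘ d'' &
        d'' ∘ f = fmap S e ∘ d'].
Proof.
move=> /dist_rot hf /dist_rot hg /dist_rot hfg.
have [u1 [v1 [huv [e1 e2 e3 e4]]]] := tr_oct hg hf hfg.
have [e ee] := sh_full u1; have [u eu] := sh_full v1; exists u, e.
move: huv e1 e2 e3 e4; rewrite -ee -eu compmN -fmapM -shN => huv e1 e2 e3 e4.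
split; first exact: dist_sh_neg.
split=> //; apply: sh_inj; rewrite ?fmapM; apply: oppr_inj.
  by rewrite -compNm e4 compmN.
by rewrite -compNm e2.
Qed.

End Triangles.

(** * Opposite triangulated categories and t-structures *)

Section OppositeCategory.
Variables (k : comPzRingType) (C : kcat k).

Lemma op_iso (X Y : C) (f : mor X Y) : @is_iso k (opcat C) Y X f <-> is_iso f.
Proof. by split=> -[g [g1 g2]]; exists g. Qed.

Lemma op_zero (Z : C) : @is_zero_ob k (opcat C) Z <-> is_zero_ob Z.
Proof. by split=> h X; have [h1 h2] := h X. Qed.

Definition op_biproduct (A B : C) (P : biproduct A B) : @biproduct k (opcat C) A B :=
  @Biproduct k (opcat C) A B (bp_ob P) (bp_pr1 P) (bp_pr2 P) (bp_in1 P) (bp_in2 P)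
    (bp_11 P) (bp_22 P) (bp_21 P) (bp_12 P) (bp_sum P).

Lemma op_additive : additive_cat C -> additive_cat (opcat C).
Proof.
move=> [[Z hZ] hP]; split; first by exists Z; apply/op_zero.
by move=> A B; have [P] := hP A B; split; exact: op_biproduct P.
Qed.

End OppositeCategory.

Section Reflections.
Variables (k : comPzRingType) (C : kcat k).

Lemma iso_bij_to P (X Y : C) (f : mor X Y) : is_iso f -> bij_to P f.
Proof. by move=> /op_iso hf; exact: (@iso_bij_from k (opcat C)). Qed.

Lemma bij_to_comp P (X Y Z : C) (g : mor Y Z) (f : mor X Y) :
  bij_to P g -> bij_to P f -> bij_to P (g ∘ f).
Proof. by move=> hg hf; exact: (@bij_from_comp k (opcat C) P Z Y X f g hf hg). Qed.

Lemma bij_to_iso (P : C -> Prop) (X Y : C) (f : mor X Y) :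
  P X -> P Y -> bij_to P f -> is_iso f.
Proof.
by move=> hX hY hf; apply/op_iso; exact: (@bij_from_iso k (opcat C) P Y X f hY hX hf).
Qed.

End Reflections.

Section OppositeTriangulated.
Variables (k : comPzRingType) (D : triangulated k).
Notation S := (sh D).

(* With this sign, (f, g, h) is distinguished in the opposite category iff
   X[-1] -> Z -> Y -> X is, without sign, a rotated triangle of D: this is the
   convention of [Delta]. *)
Definition op_dist (X Y Z : D) (f : mor Y X) (g : mor Z Y) (h : mor (shV D X) Z) :
    Prop :=
  exists d : mor X (S Z), d ∘ sh_counit X = - fmap S h /\ dist g f d.

Definition op_tridata : tridata k :=
  @TriData k (opcat D) (opfunctor (shV D)) op_dist.

Lemma shV_linear : linear_functor (shV D).
Proof.
move=> X Y a f g; apply: sh_inj; rewrite sh_linear.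
have [c [hc1 hc2]] := sh_counit_iso Y.
apply: (iso_monoP (sh_counit_iso Y)).
by rewrite -sh_counit_nat comp_linl comp_linr -!sh_counit_nat.
Qed.

Lemma op_tr_iso (X Y Z X' Y' Z' : D)
    (f : mor Y X) (g : mor Z Y) (h : mor (shV D X) Z)
    (f' : mor Y' X') (g' : mor Z' Y') (h' : mor (shV D X') Z') :
  @tri_iso k op_tridata (opfunctor (shV D)) X Y Z X' Y' Z' f g h f' g' h' ->
  op_dist f g h -> op_dist f' g' h'.
Proof.
move=> [a [b [c [[ia ib ic] [/= e1 e2 e3]]]]] [d [ed hd]].
have [a' [/= a2 a1]] := ia; have [b' [/= b2 b1]] := ib; have [c' [/= c2 c1]] := ic.
change (@mor k D X' X : Type) in (type of a).
change (@mor k D Y' Y : Type) in (type of b).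
change (@mor k D Z' Z : Type) in (type of c).
change (@mor k D X X' : Type) in (type of a').
change (@mor k D Y Y' : Type) in (type of b').
change (@mor k D Z Z' : Type) in (type of c').
exists (fmap S c' ∘ d ∘ a); split.
  rewrite -compA sh_counit_nat compA -(compA (fmap S c')) ed compmN compNm -!fmapM.
  by rewrite -compA e3 compA c1 comp1m.
apply: (tr_iso _ hd); exists c', b', a'; split; first split.
- by exists c.
- by exists b.
- by exists a.
split.
- by rewrite -[LHS]compm1 -c2 (compA (b' ∘ g)) -(compA b') e2 (compA b') b1 comp1m.
- by rewrite -[LHS]compm1 -b2 (compA (a' ∘ f)) -(compA a') e1 (compA a') a1 comp1m.
by rewrite -!compA a2 compm1.
Qed.

Lemma op_tr_id (X Z : op_tridata) : is_zero_ob Z ->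
  dist (idmor X) (0 : mor X Z) (0 : mor Z (sh op_tridata X)).
Proof.
move=> /op_zero hZ; exists 0; split; first by rewrite comp0m sh0 oppr0.
exact: tr_id_r.
Qed.

Lemma op_tr_cone (X Y : op_tridata) (f : mor X Y) :
  exists (Z : op_tridata) (g : mor Y Z) (h : mor Z (sh op_tridata X)), dist f g h.
Proof.
have [W [w [d hd]]] := @fibre_ex k D Y X f.
have [h hh] := sh_full (- (d ∘ sh_counit X)).
by exists W, w, h; exists d; rewrite hh opprK.
Qed.

Lemma op_tr_rot (X Y Z : op_tridata)
    (f : mor X Y) (g : mor Y Z) (h : mor Z (sh op_tridata X)) :
  dist f g h <-> dist g h (- fmap (sh op_tridata) f).
Proof.
have [c [hc1 hc2]] := sh_counit_iso (X : D).
have ic : is_iso c by exists (sh_counit (X : D)).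
split=> -[d [/= ed hd]].
  (* Read in D, the rotated triangle starts at X[-1], so its connecting map must land in X[-1][1];
     the inverse [c] of the counit takes it there. *)
  exists (c ∘ f); split.
    rewrite shN opprK; apply: (iso_monoP (sh_counit_iso (X : D))).
    by rewrite !compA hc2 comp1m sh_counit_nat.
  apply/tr_rot; apply: (dist_iso2 (iso_id _) ic hd); rewrite ?comp1m ?compm1 //.
  by rewrite -ed -compA hc2 compm1.
exists (- (fmap S h ∘ c)); split.
  by rewrite compNm -compA hc1 compm1.
move: hd => /dist_rot hd.
apply: (dist_iso2 (iso_id _) (sh_counit_iso (X : D)) hd); rewrite ?comp1m ?compm1 //.
  rewrite shN opprK in ed; apply: counit_epi.
  by rewrite -compA ed -sh_counit_nat.
by rewrite compNm -compA hc1 compm1.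
Qed.

Lemma op_tr_mor (X Y Z X' Y' Z' : op_tridata)
    (f : mor X Y) (g : mor Y Z) (h : mor Z (sh op_tridata X))
    (f' : mor X' Y') (g' : mor Y' Z') (h' : mor Z' (sh op_tridata X'))
    (a : mor X X') (b : mor Y Y') :
  dist f g h -> dist f' g' h' -> b ∘ f = f' ∘ a ->
  exists c : mor Z Z',
    c ∘ g = g' ∘ b /\ fmap (sh op_tridata) a ∘ h = h' ∘ c.
Proof.
move=> [d [ed hd]] [d' [ed' hd']] /= e.
have [c [e1 e2]] := tr_mor1 hd' hd (esym e); exists c; split=> //=.
apply: sh_inj; apply: oppr_inj; rewrite !fmapM -compNm -ed -compA -sh_counit_nat.
by rewrite compA -e2 -compA ed' compmN.
Qed.

(** Third vertices in the opposite category are fibres in D, so this is the fibre form of the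
    octahedral axiom. *)
Lemma op_tr_oct (X Y Z Z' X' Y' : op_tridata) (f : mor X Y) (g : mor Y Z)
    (f' : mor Y Z') (f'' : mor Z' (sh op_tridata X))
    (g' : mor Z X') (g'' : mor X' (sh op_tridata Y))
    (h' : mor Z Y') (h'' : mor Y' (sh op_tridata X)) :
  dist f f' f'' -> dist g g' g'' -> dist (g ∘ f) h' h'' ->
  exists (u : mor Z' Y') (v : mor Y' X'),
    dist u v (fmap (sh op_tridata) f' ∘ g'') /\
    [/\ u ∘ f' = h' ∘ g, h'' ∘ u = f'', v ∘ h' = g' &
        g'' ∘ v = fmap (sh op_tridata) f ∘ h''].
Proof.
move=> [d [ed hd]] [d' [ed' hd']] [d'' [ed'' hd'']].
have [u [v [huv [e1 e2 e3 e4]]]] := tr_oct_fibre hd hd' hd''.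
exists u, v; split.
  exists (d' ∘ f'); split=> //=.
  by rewrite -compA sh_counit_nat compA ed' compNm -fmapM.
split=> //=; apply: sh_inj; apply: oppr_inj.
  by rewrite -ed fmapM -compmN -ed'' e3 compA.
by rewrite !fmapM -compmN -compNm -ed' -ed'' compA -e4 -!compA -sh_counit_nat.
Qed.

(** The adjoint equivalence is reversed: [1] becomes the quasi-inverse of [-1], unit and counit
    trade places, and so do the two triangle identities. *)
Definition optri : triangulated k :=
  @Triangulated k op_tridata (op_additive (tri_additive D)) (fun X Y => @shV_linear Y X)
    (opfunctor S) (@sh_counit k D) (@sh_unit k D)
    (fun X => proj2 (op_iso (@sh_counit k D X)) (sh_counit_iso X))
    (fun X => proj2 (op_iso (@sh_unit k D X)) (sh_unit_iso X))
    (fun X Y f => @sh_counit_nat k D Y X f) (fun X Y f => @sh_unit_nat k D Y X f)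
    (@sh_triangle2 k D) (@sh_triangle1 k D)
    op_tr_iso op_tr_id op_tr_cone op_tr_rot op_tr_mor op_tr_oct.

End OppositeTriangulated.

Section OppositeTStructure.
Variables (k : comPzRingType) (D : triangulated k) (t : tstructure D).

Lemma op_iso_ob (X Y : D) : @iso_ob k (opcat D) X Y -> iso_ob Y X.
Proof. by move=> [u hu]; exists u; exact/op_iso. Qed.

Lemma opts_orth (X Y : D) (f : mor Y X) : ts_ge0 t X -> ts_le0 t (shV D Y) -> f = 0.
Proof.
move=> hX hY; apply: shV_inj; rewrite shV0; apply: ts_orth hY _.
exact: ts_ge_iso (iso_ob_sym (sh_shV X)) hX.
Qed.

Lemma opts_le_sh (X : D) : ts_ge0 t X -> ts_ge0 t (shV D X).
Proof. by move=> hX; apply: ts_ge_sh; exact: ts_ge_iso (iso_ob_sym (sh_shV X)) hX. Qed.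

Lemma opts_ge_sh (X : D) : ts_le0 t (shV D X) -> ts_le0 t X.
Proof. by move=> hX; exact: ts_le_iso (sh_shV X) (ts_le_sh hX). Qed.

(** The opposite t-structure has to cut X between degrees -1 and 0, whereas [ts_tri] cuts between 0
    and 1; hence the triangle of X[-1], shifted back. *)
Lemma opts_tri (X : optri D) : exists (A B : optri D) (f : mor A X) (g : mor X B)
  (h : mor B (sh (optri D) A)), [/\ dist f g h, ts_ge0 t A & ts_le0 t (shV D B)].
Proof.
have [A [B [f [g [h [/dist_sh hd hA hB]]]]]] := ts_tri t (shV D X).
have [c [hc1 hc2]] := sh_counit_iso (X : D).
pose d := - fmap (sh D) h.
have [h' eh] := sh_full (- (d ∘ sh_counit (sh D B))).
exists (sh D B), (sh D A), (fmap (sh D) g ∘ c), (@sh_counit k D X ∘ fmap (sh D) f), h'.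
split=> //; last exact: ts_le_iso (iso_ob_sym (shV_sh A)) hA.
exists d; split; first by rewrite eh opprK.
apply: (dist_iso2 (sh_counit_iso (X : D)) (iso_id (sh D B)) hd) => //.
  by rewrite comp1m -compA hc1 compm1.
by rewrite compm1.
Qed.

Definition opts : tstructure (optri D) :=
  @TStructure k (optri D) (ts_ge0 t) (ts_le0 t)
    (fun X Y h => ts_ge_iso (iso_ob_sym (op_iso_ob h)))
    (fun X Y h => ts_le_iso (iso_ob_sym (op_iso_ob h)))
    (fun X Y f => @opts_orth X Y f) opts_le_sh opts_ge_sh opts_tri.

Lemma shz_op m (X : D) : shz (optri D) m X = shz D (- m) X :> D.
Proof.
have fiter_op n (F : functor D D) : fiter n (opfunctor F) X = fiter n F X :> D.
  by elim: n => //= n ->.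
by case: m => [[|n]|n] //=; rewrite fiter_op.
Qed.

(** Stated as an equality of predicates, so that results of the opposite category are translated by
    rewriting. *)
Lemma t_le_op m : t_le opts m = t_ge t (- m) :> (D -> Prop).
Proof. by apply/funext => X; rewrite /t_le /t_ge shz_op. Qed.

Lemma t_ge_op m : t_ge opts m = t_le t (- m) :> (D -> Prop).
Proof. by apply/funext => X; rewrite /t_le /t_ge shz_op. Qed.

End OppositeTStructure.

(** * Truncations and Hom tests *)

Section ShiftedTests.
Variables (k : comPzRingType) (D : triangulated k).
Variables (P Q : D -> Prop).
Hypothesis PQ : forall V, P V -> Q (sh D V).
Hypothesis QP : forall V, Q V -> P (shV D V).

Lemma inj_from_sh (X Y : D) (f : mor X Y) : inj_from P f <-> inj_from Q (fmap (sh D) f).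
Proof.
split=> h V hV u v e; last first.
  by apply: sh_inj; apply: (h _ (PQ hV)); rewrite -!fmapM e.
have [u' eu] := counit_factor u; have [v' ev] := counit_factor v.
apply: counit_epi; rewrite -eu -ev; congr fmap; apply: (h _ (QP hV)).
by apply: sh_inj; rewrite !fmapM eu ev !compA e.
Qed.

Lemma surj_from_sh (X Y : D) (f : mor X Y) :
  surj_from P f <-> surj_from Q (fmap (sh D) f).
Proof.
split=> h V hV u; last first.
  have [v ev] := h _ (PQ hV) (fmap (sh D) u); have [v' ev'] := sh_full v.
  by exists v'; apply: sh_inj; rewrite fmapM ev'.
have [u' eu] := counit_factor u; have [v' ev] := h _ (QP hV) u'.
have [c [hc _]] := sh_counit_iso V.
exists (fmap (sh D) v' ∘ c); apply: counit_epi.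
by rewrite -!compA hc compm1 -fmapM ev.
Qed.

Lemma bij_from_sh (X Y : D) (f : mor X Y) : bij_from P f <-> bij_from Q (fmap (sh D) f).
Proof. by rewrite /bij_from inj_from_sh surj_from_sh. Qed.

End ShiftedTests.

Section TStructure.
Variables (k : comPzRingType) (D : triangulated k) (t : tstructure D).
Implicit Types A B X Y Z V W : D.
Notation S := (sh D).

Lemma t_le_iso m X Y : iso_ob X Y -> t_le t m X -> t_le t m Y.
Proof. by move=> h; apply: ts_le_iso; exact: iso_ob_fmap. Qed.

Lemma t_ge_iso m X Y : iso_ob X Y -> t_ge t m X -> t_ge t m Y.
Proof. by move=> h; apply: ts_ge_iso; exact: iso_ob_fmap. Qed.

Lemma t_le_shE m X : t_le t m (S X) <-> t_le t (m + 1) X.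
Proof.
have h := iso_ob_trans (iso_ob_sym (shz_sh m X)) (shz_step m X).
by split; apply: ts_le_iso => //; exact: iso_ob_sym.
Qed.

Lemma t_ge_shE m X : t_ge t m (S X) <-> t_ge t (m + 1) X.
Proof.
have h := iso_ob_trans (iso_ob_sym (shz_sh m X)) (shz_step m X).
by split; apply: ts_ge_iso => //; exact: iso_ob_sym.
Qed.

Lemma t_le_shVE m X : t_le t (m + 1) (shV D X) <-> t_le t m X.
Proof.
rewrite -t_le_shE; split; apply: t_le_iso; first exact: sh_shV.
exact: iso_ob_sym (sh_shV X).
Qed.

Lemma t_ge_shVE m X : t_ge t (m + 1) (shV D X) <-> t_ge t m X.
Proof.
rewrite -t_ge_shE; split; apply: t_ge_iso; first exact: sh_shV.
exact: iso_ob_sym (sh_shV X).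
Qed.

Lemma t_orth m X Y (f : mor X Y) : t_le t m X -> t_ge t (m + 1) Y -> f = 0.
Proof. by move=> hX hY; exact: (proj1 (t_le_perp _ _ _) hX _ hY). Qed.

Lemma t_le_ext m X Y Z f g h : @dist _ D X Y Z f g h ->
  t_le t m X -> t_le t m Z -> t_le t m Y.
Proof.
move=> hd hX hZ; apply/t_le_perp => W hW u.
have [|v ->] := dist_coexact_l (u := u) hd; first exact: t_orth hX hW.
by rewrite (t_orth v hZ hW) comp0m.
Qed.

Lemma t_ge_ext m X Y Z f g h : @dist _ D X Y Z f g h ->
  t_ge t m X -> t_ge t m Z -> t_ge t m Y.
Proof.
move=> hd hX hZ; apply/t_ge_perp => W hW u.
rewrite -(subrK 1 m) in hX hZ.
have [|v ->] := dist_exact (u := u) hd; first exact: t_orth hW hZ.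
by rewrite (t_orth v hW hX) compm0.
Qed.

Lemma t_le_cone m X Y Z f g h : @dist _ D X Y Z f g h ->
  t_le t (m + 1) X -> t_le t m Y -> t_le t m Z.
Proof. by move=> /dist_rot hd hX hY; apply: (t_le_ext hd) => //; apply/t_le_shE. Qed.

Lemma t_ge_fibre m X Y Z f g h : @dist _ D X Y Z f g h ->
  t_ge t (m + 1) Y -> t_ge t m Z -> t_ge t (m + 1) X.
Proof.
move=> /dist_rot/dist_rot hd hY hZ; apply/t_ge_shE; apply: (t_ge_ext hd) => //.
exact/t_ge_shE.
Qed.

Lemma t_le_zero m Z : is_zero_ob Z -> t_le t m Z.
Proof. by move=> hZ; apply/t_le_perp => W _ f; exact: (hZ W).2. Qed.

Lemma t_ge_zero m Z : is_zero_ob Z -> t_ge t m Z.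
Proof. by move=> hZ; apply/t_ge_perp => W _ f; exact: (hZ W).1. Qed.

Lemma t_zero m X : t_le t m X -> t_ge t (m + 1) X -> is_zero_ob X.
Proof. by move=> h1 h2; apply: zero_obP; exact: t_orth h1 h2. Qed.

(** A truncation triangle of X[1] at level i, shifted back, is one of X at level i+1, and
    conversely; from level 0 this reaches every integer. *)
Lemma trunc_triangle m X : exists (A B : D) (f : mor A X) (g : mor X B) (h : mor B (S A)),
  [/\ dist f g h, t_le t m A & t_ge t (m + 1) B].
Proof.
have up i : (forall X, exists (A B : D) (f : mor A X) (g : mor X B) (h : mor B (S A)),
    [/\ dist f g h, t_le t i A & t_ge t (i + 1) B]) ->
  forall X, exists (A B : D) (f : mor A X) (g : mor X B) (h : mor B (S A)),
    [/\ dist f g h, t_le t (i + 1) A & t_ge t (i + 1 + 1) B].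
  move=> IH {}X; have [A [B [f [g [h [hd hA hB]]]]]] := IH (S X).
  have [cA [cA1 cA2]] := sh_counit_iso A; have [cB [cB1 cB2]] := sh_counit_iso B.
  have [f0 ef] := sh_full (f ∘ sh_counit A); have [g0 eg] := sh_full (cB ∘ g).
  have [h0 eh] := sh_full (- (fmap S cA ∘ h ∘ sh_counit B)).
  exists (shV D A), (shV D B), f0, g0, h0; split; last first.
  - by apply/t_ge_shVE.
  - by apply/t_le_shVE.
  apply/dist_sh; rewrite ef eg eh opprK; apply: (tr_iso _ hd).
  exists cA, (idmor _), cB; split; first split.
  - by exists (sh_counit A).
  - exact: iso_id.
  - by exists (sh_counit B).
  by rewrite comp1m compm1 -!compA cA2 cB2 !compm1.
have down i : (forall X, exists (A B : D) (f : mor A X) (g : mor X B) (h : mor B (S A)),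
    [/\ dist f g h, t_le t (i + 1) A & t_ge t (i + 1 + 1) B]) ->
  forall X, exists (A B : D) (f : mor A X) (g : mor X B) (h : mor B (S A)),
    [/\ dist f g h, t_le t i A & t_ge t (i + 1) B].
  move=> IH {}X; have [A [B [f [g [h [/dist_sh hd hA hB]]]]]] := IH (shV D X).
  have [c [c1 c2]] := sh_counit_iso X.
  exists (S A), (S B), (sh_counit X ∘ fmap S f), (fmap S g ∘ c), (- fmap S h).
  split; [|exact/t_le_shE|exact/t_ge_shE].
  apply: (dist_iso2 (sh_counit_iso X) (iso_id _) hd) => //.
    by rewrite comp1m -compA c1 compm1.
  by rewrite compm1.
elim: m X => [X|n IH X|n IH X].
- by have [A [B [f [g [h [hd hA hB]]]]]] := ts_tri t X; exists A, B, f, g, h.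
- by have := up n IH X; rewrite -addn1 PoszD.
- apply: down; have e : - n.+1%:Z + 1 = - n%:Z by rewrite -addn1 PoszD opprD subrK.
  by rewrite e; exact: IH.
Qed.

(** For V in D^{<=m} both Hom(V, B) and Hom(V[1], B) vanish, the second because the aisle is stable
    under [1]. *)
Lemma trunc_coreflection m A X B f g h : @dist _ D A X B f g h ->
  t_le t m A -> t_ge t (m + 1) B -> coreflection (t_le t m) f.
Proof.
move=> hd hA hB; split=> //; split=> [|V hV u]; last first.
  have [|v ->] := dist_exact (u := u) hd; first exact: t_orth hV hB.
  by exists v.
apply: inj_from0 => V hV u e; apply: sh_inj; rewrite sh0.
have [|v ->] := dist_exact_s (u := fmap S u) hd; first by rewrite -fmapM e sh0.
by rewrite (@t_orth m _ _ v (t_le_sh hV) hB) compm0.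
Qed.

Lemma trunc_reflection m A X B f g h : @dist _ D A X B f g h ->
  t_le t m A -> t_ge t (m + 1) B -> reflection (t_ge t (m + 1)) g.
Proof.
move=> hd hA hB; split=> //; split=> [V hV u v e|V hV u]; last first.
  have [|v ->] := dist_coexact_l (u := u) hd; first exact: t_orth hA hV.
  by exists v.
apply/eqP; rewrite -subr_eq0; apply/eqP.
have [|w ->] := dist_coexact (u := u - v) hd; first by rewrite compBm e subrr.
by rewrite (@t_orth m _ _ w (t_le_sh hA) hV) comp0m.
Qed.

Lemma from_le_sh j X Y (f : mor X Y) :
  (inj_from (t_le t j) (fmap S f) <-> inj_from (t_le t (j + 1)) f) /\
  (bij_from (t_le t j) (fmap S f) <-> bij_from (t_le t (j + 1)) f).
Proof.
have h1 V : t_le t (j + 1) V -> t_le t j (S V) by move=> h; exact/t_le_shE.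
have h2 V : t_le t j V -> t_le t (j + 1) (shV D V) by move=> h; exact/t_le_shVE.
by split; apply: iff_sym; [exact: inj_from_sh | exact: bij_from_sh].
Qed.

Lemma from_le_shV j X Y (f : mor X Y) :
  (inj_from (t_le t (j + 1)) (fmap (shV D) f) <-> inj_from (t_le t j) f) /\
  (bij_from (t_le t (j + 1)) (fmap (shV D) f) <-> bij_from (t_le t j) f).
Proof.
have [<- <-] := from_le_sh j (fmap (shV D) f); have e := esym (sh_counit_nat f).
by split; [apply: inj_from_square e | apply: bij_from_square e]; exact: sh_counit_iso.
Qed.

Lemma from_le_shz i j X Y (f : mor X Y) :
  (inj_from (t_le t j) (fmap (shz D i) f) <-> inj_from (t_le t (j + i)) f) /\
  (bij_from (t_le t j) (fmap (shz D i) f) <-> bij_from (t_le t (j + i)) f).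
Proof.
case: i => n.
  elim: n j => [|n IH] j; first by rewrite addr0.
  have [IH1 IH2] := IH (j + 1); have -> : j + n.+1%:Z = j + 1 + n%:Z by lia.
  by rewrite -IH1 -IH2; exact: from_le_sh.
rewrite NegzE; elim: n j => [|n IH] j.
  by have := from_le_shV (j - 1) f; rewrite subrK.
have [IH1 IH2] := IH (j - 1); have -> : j - n.+2%:Z = j - 1 - n.+1%:Z by lia.
by rewrite -IH1 -IH2; have := from_le_shV (j - 1) (fmap (shz D (Negz n)) f); rewrite subrK.
Qed.

Lemma inj_from_le_mono i j X Y (f : mor X Y) : i <= j ->
  inj_from (t_le t j) f -> inj_from (t_le t i) f.
Proof. by move=> ij h V hV; apply: h; exact: t_le_mono hV. Qed.

Lemma bij_from_le_mono i j X Y (f : mor X Y) : i <= j ->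
  bij_from (t_le t j) f -> bij_from (t_le t i) f.
Proof.
by move=> ij [h1 h2]; split=> V hV; [apply: h1 | apply: h2]; exact: t_le_mono hV.
Qed.

(* In terms of cohomology: the cone of f lies in D^{>=j} iff H^i(f) is an
   isomorphism for i < j and a monomorphism for i = j. *)
Lemma cone_ge_inj j X Y Z f g h : @dist _ D X Y Z f g h -> t_ge t j Z ->
  inj_from (t_le t j) f /\ bij_from (t_le t (j - 1)) f.
Proof.
move=> hd hZ; have hZ' : t_ge t (j - 1 + 1) Z by rewrite subrK.
have inj : inj_from (t_le t j) f.
  apply: inj_from0 => V hV u e; apply: sh_inj; rewrite sh0.
  have [|v ->] := dist_exact_s (u := fmap S u) hd; first by rewrite -fmapM e sh0.
  rewrite (@t_orth (j - 1) _ _ v) ?compm0 //; apply/t_le_shE; by rewrite subrK.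
split=> //; split; first by apply: inj_from_le_mono inj; lia.
move=> V hV u; have [|v ->] := dist_exact (u := u) hd; first exact: t_orth hV hZ'.
by exists v.
Qed.

(** A map V → Z with V in D^{<=j-1} becomes zero in X[1], because it gives a map V[-1] → X killed by
    f and V[-1] lies in D^{<=j}. It thus comes from Y, then from X by surjectivity, and so
    vanishes. *)
Lemma inj_cone_ge j X Y Z f g h : @dist _ D X Y Z f g h ->
  inj_from (t_le t j) f -> surj_from (t_le t (j - 1)) f -> t_ge t j Z.
Proof.
move=> hd fi fs; apply/t_ge_perp => V hV u.
have hu : h ∘ u = 0.
  have [u' eu'] := counit_factor (h ∘ u); apply: counit_epi; rewrite comp0m -eu' -sh0.
  congr fmap; apply: (fi (shV D V)); first by rewrite -(subrK 1 j); exact/t_le_shVE.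
  by apply: sh_inj; rewrite !fmapM eu' sh0 compm0 !compA (dist_comp0s hd) !comp0m.
have [v ->] := dist_exact_r hd hu; have [w <-] := fs _ hV v.
by rewrite compA (dist_comp0 hd) comp0m.
Qed.

Lemma op_triangle X Y Z (f : mor X Y) (g : mor Y Z) (h : mor Z (S X)) : dist f g h ->
  exists h' : mor (shV D Z) X, @dist k (optri D) Z Y X g f h'.
Proof.
move=> hd; have [h' eh'] := sh_full (- (h ∘ sh_counit Z)).
by exists h', h; rewrite eh' opprK.
Qed.

End TStructure.

Section OppositeTests.
Variables (k : comPzRingType) (D : triangulated k) (t : tstructure D).
Implicit Types A B X Y Z V W : D.
Notation S := (sh D).

Lemma fibre_le_inj j X Y Z f g h : @dist _ D X Y Z f g h -> t_le t j X ->
  inj_to (t_ge t j) g /\ bij_to (t_ge t (j + 1)) g.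
Proof.
move=> /op_triangle[h' hd] hX.
have := @cone_ge_inj k (optri D) (opts t) (- j) Z Y X g f h' hd.
by rewrite t_ge_op !t_le_op opprB !opprK addrC => /(_ hX).
Qed.

Lemma inj_fibre_le j X Y Z f g h : @dist _ D X Y Z f g h ->
  inj_to (t_ge t j) g -> surj_to (t_ge t (j + 1)) g -> t_le t j X.
Proof.
move=> /op_triangle[h' hd] gi gs.
have := @inj_cone_ge k (optri D) (opts t) (- j) Z Y X g f h' hd.
rewrite t_ge_op !t_le_op opprB !opprK addrC; exact.
Qed.

Lemma to_ge_shV j X Y (f : mor X Y) :
  (inj_to (t_ge t (j + 1)) (fmap (shV D) f) <-> inj_to (t_ge t j) f) /\
  (bij_to (t_ge t (j + 1)) (fmap (shV D) f) <-> bij_to (t_ge t j) f).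
Proof.
have := @from_le_sh k (optri D) (opts t) (- (j + 1)) Y X f.
have -> : - (j + 1) + 1 = - j by lia.
by rewrite !t_le_op !opprK.
Qed.

Lemma to_ge_sh j X Y (f : mor X Y) :
  (inj_to (t_ge t j) (fmap S f) <-> inj_to (t_ge t (j + 1)) f) /\
  (bij_to (t_ge t j) (fmap S f) <-> bij_to (t_ge t (j + 1)) f).
Proof.
have := @from_le_shV k (optri D) (opts t) (- (j + 1)) Y X f.
have -> : - (j + 1) + 1 = - j by lia.
by rewrite !t_le_op !opprK.
Qed.

Lemma to_ge_shz i j X Y (f : mor X Y) :
  (inj_to (t_ge t j) (fmap (shz D i) f) <-> inj_to (t_ge t (j + i)) f) /\
  (bij_to (t_ge t j) (fmap (shz D i) f) <-> bij_to (t_ge t (j + i)) f).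
Proof.
case: i => n.
  elim: n j => [|n IH] j; first by rewrite addr0.
  have [IH1 IH2] := IH (j + 1); have -> : j + n.+1%:Z = j + 1 + n%:Z by lia.
  by rewrite -IH1 -IH2; exact: to_ge_sh.
rewrite NegzE; elim: n j => [|n IH] j.
  by have := to_ge_shV (j - 1) f; rewrite subrK.
have [IH1 IH2] := IH (j - 1); have -> : j - n.+2%:Z = j - 1 - n.+1%:Z by lia.
by rewrite -IH1 -IH2; have := to_ge_shV (j - 1) (fmap (shz D (Negz n)) f); rewrite subrK.
Qed.

Lemma inj_to_ge_mono i j X Y (f : mor X Y) : i <= j ->
  inj_to (t_ge t i) f -> inj_to (t_ge t j) f.
Proof. by move=> ij h V hV; apply: h; exact: t_ge_mono hV. Qed.

Lemma bij_to_ge_mono i j X Y (f : mor X Y) : i <= j ->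
  bij_to (t_ge t i) f -> bij_to (t_ge t j) f.
Proof.
by move=> ij [h1 h2]; split=> V hV; [apply: h1 | apply: h2]; exact: t_ge_mono hV.
Qed.

End OppositeTests.

(** * Pretriangulated structure on an interval of a t-structure *)

(* J identifies C with D^{[a,c]}. Working up to such an identification, with
   arbitrary bounds, makes the setting stable under passing to opposites. *)
Record interval_embedding (k : comPzRingType) (D : triangulated k) (t : tstructure D)
    (a c : int) (C : kcat k) (J : functor C D) : Prop := {
  ie_ac : a <= c;
  ie_add : additive_functor J;
  ie_inj : forall X Y, injective (@fmap _ _ _ J X Y);
  ie_full : forall X Y (g : mor (J X) (J Y)), exists f, fmap J f = g;
  ie_le : forall X, t_le t c (J X);
  ie_ge : forall X, t_ge t a (J X);
  ie_ess : forall X, t_le t c X -> t_ge t a X -> exists Y, iso_ob (J Y) X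
}.

(* w exhibits Om as the composite of [-1] with the truncation below c, in
   adjoint form. *)
Definition loop_counit (k : comPzRingType) (D : triangulated k) (t : tstructure D)
    (c : int) (C : kcat k) (J : functor C D) (Om : functor C C)
    (w : forall X, mor (sh D (J (Om X))) (J X)) : Prop :=
  (forall (X Y : C) (f : mor X Y),
     w Y ∘ fmap (sh D) (fmap J (fmap Om f)) = fmap J f ∘ w X) /\
  (forall (X : C) (V : D), t_le t c V -> forall u : mor (sh D V) (J X),
     exists! v : mor V (J (Om X)), w X ∘ fmap (sh D) v = u).

(* The sign is that of the triangle A[-1] -> W -> B -> A, rotated to
   W -> B -> A -> W[1]. *)
Definition left_triangle (k : comPzRingType) (D : triangulated k) (t : tstructure D)
    (c : int) (C : kcat k) (J : functor C D) (Om : functor C C)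
    (w : forall X, mor (sh D (J (Om X))) (J X)) (A B E : C)
    (h : mor (Om A) E) (g : mor E B) (f : mor B A) : Prop :=
  exists (W : D) (p : mor W (J B)) (d : mor (J A) (sh D W)) (q : mor (J E) W),
    [/\ dist p (fmap J f) d, coreflection (t_le t c) q, p ∘ q = fmap J g &
        fmap (sh D) (q ∘ fmap J h) = - (d ∘ w A)].

Section IntervalEmbedding.
Variables (k : comPzRingType) (D : triangulated k) (t : tstructure D) (a c : int).
Variables (C : kcat k) (J : functor C D) (HJ : interval_embedding t a c J).
Implicit Types A B E F G X Y Z : C.
Notation S := (sh D).

Lemma fmapJ0 X Y : fmap J (0 : mor X Y) = 0.
Proof. by apply: (addrI (fmap J (0 : mor X Y))); rewrite -(ie_add HJ) !addr0. Qed.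

Lemma fmapJN X Y (f : mor X Y) : fmap J (- f) = - fmap J f.
Proof. by apply: (addrI (fmap J f)); rewrite -(ie_add HJ) !subrr fmapJ0. Qed.

Lemma isoJ X Y (f : mor X Y) : is_iso (fmap J f) <-> is_iso f.
Proof.
split; last exact: iso_fmap.
move=> [g [g1 g2]]; have [g' eg] := ie_full HJ g; exists g'.
by split; apply: (ie_inj HJ); rewrite fmapM eg fmap1.
Qed.

Lemma zeroJ Z : is_zero_ob (J Z) <-> is_zero_ob Z.
Proof.
split=> hZ; apply: zero_obP; last by rewrite -fmap1 ((hZ Z).1 (idmor Z)) fmapJ0.
by apply: (ie_inj HJ); rewrite fmapJ0; exact: (hZ _).1.
Qed.

(** Both bounds are orthogonality conditions, hence inherited by the biproduct formed in D; its
    structure maps are carried along an isomorphism with an object of C. *)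
Lemma interval_additive : additive_cat C.
Proof.
have [[Z hZ] hP] := tri_additive D; split.
  have [Z' [u [v [uv vu]]]] := ie_ess HJ (t_le_zero t c hZ) (t_ge_zero t a hZ).
  by exists Z'; apply/zeroJ/zero_obP; rewrite -uv ((hZ _).1 u) compm0.
move=> A B; have [P] := hP (J A) (J B).
have orth V : (forall u : mor V (J A), u = 0) -> (forall u : mor V (J B), u = 0) ->
    forall u : mor V (bp_ob P), u = 0.
  move=> hA hB u; rewrite -[u]comp1m -(bp_sum P) compDm -!compA.
  by rewrite [bp_pr1 P ∘ u]hA [bp_pr2 P ∘ u]hB !compm0 addr0.
have orth' V : (forall u : mor (J A) V, u = 0) -> (forall u : mor (J B) V, u = 0) ->
    forall u : mor (bp_ob P) V, u = 0.
  move=> hA hB u; rewrite -[u]compm1 -(bp_sum P) compmD !compA.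
  by rewrite [u ∘ bp_in1 P]hA [u ∘ bp_in2 P]hB !comp0m addr0.
have hle : t_le t c (bp_ob P).
  by apply/t_le_perp => W hW; apply: orth' => u; exact: t_orth (ie_le HJ _) hW.
have hge : t_ge t a (bp_ob P).
  by apply/t_ge_perp => W hW; apply: orth => u; exact: (proj1 (t_ge_perp _ _ _) (ie_ge HJ _)).
have [Q [u [v [vu uv]]]] := ie_ess HJ hle hge.
have [i1 e1] := ie_full HJ (v ∘ bp_in1 P); have [i2 e2] := ie_full HJ (v ∘ bp_in2 P).
have [p1 e3] := ie_full HJ (bp_pr1 P ∘ u); have [p2 e4] := ie_full HJ (bp_pr2 P ∘ u).
have cancel (X Y : D) (p : mor (bp_ob P) Y) (i : mor X (bp_ob P)) :
  p ∘ u ∘ (v ∘ i) = p ∘ i by rewrite compA -(compA p) uv compm1.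
split; apply: (@Biproduct _ C A B Q i1 i2 p1 p2); apply: (ie_inj HJ).
- by rewrite fmapM fmap1 e1 e3 cancel bp_11.
- by rewrite fmapM fmap1 e2 e4 cancel bp_22.
- by rewrite fmapM fmapJ0 e2 e3 cancel bp_12.
- by rewrite fmapM fmapJ0 e1 e4 cancel bp_21.
rewrite (ie_add HJ) !fmapM fmap1 e1 e2 e3 e4 !compA -compDm -!(compA v) -compmD.
by rewrite (bp_sum P) compm1.
Qed.

Section LeftTriangulated.
Variables (Om : functor C C) (w : forall X, mor (S (J (Om X))) (J X)).
Hypothesis Hw : loop_counit t c w.

Lemma loop_nat X Y (f : mor X Y) : w Y ∘ fmap S (fmap J (fmap Om f)) = fmap J f ∘ w X.
Proof. exact: Hw.1. Qed.

Lemma loop_factor X V (u : mor (S V) (J X)) : t_le t c V ->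
  exists v : mor V (J (Om X)), w X ∘ fmap S v = u.
Proof. by move=> hV; have [v [hv _]] := Hw.2 X V hV u; exists v. Qed.

Lemma loop_inj X V (u v : mor V (J (Om X))) : t_le t c V ->
  w X ∘ fmap S u = w X ∘ fmap S v -> u = v.
Proof.
by move=> hV e; have [x [_ hx]] := Hw.2 X V hV (w X ∘ fmap S u); rewrite -(hx u) // -(hx v).
Qed.

(** Additivity is forced by the uniqueness in the universal property of [w]. *)
Lemma loop_additive : additive_functor Om.
Proof.
move=> X Y f g; apply: (ie_inj HJ); apply: loop_inj; first exact: (ie_le HJ).
by rewrite loop_nat !(ie_add HJ) shD compmD !loop_nat compDm.
Qed.

Notation Del := (left_triangle t c w).

Lemma left_triangle_iso A B E A' B' E'
    (h : mor (Om A) E) (g : mor E B) (f : mor B A)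
    (h' : mor (Om A') E') (g' : mor E' B') (f' : mor B' A')
    (e : mor E E') (b : mor B B') (x : mor A A') :
  is_iso e -> is_iso b -> is_iso x ->
  e ∘ h = h' ∘ fmap Om x -> b ∘ g = g' ∘ e -> x ∘ f = f' ∘ b ->
  Del h g f -> Del h' g' f'.
Proof.
move=> [e' [e1 e2]] hb hx eh eg ef [W [p [d [q [hd [hE hq] pq qh]]]]].
have [x' [x1 x2]] := hx.
have ie' : is_iso (fmap J e') by apply: iso_fmap; exists e.
exists W, (fmap J b ∘ p), (d ∘ fmap J x'), (q ∘ fmap J e'); split.
- apply: tr_iso hd; exists (idmor W), (fmap J b), (fmap J x).
  split; first by split; [exact: iso_id | exact: iso_fmap | exact: iso_fmap].
  split; first by rewrite compm1.
    by rewrite -!fmapM ef.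
  by rewrite fmap1 comp1m -compA -fmapM x1 fmap1 compm1.
- by split; [exact: (ie_le HJ) | apply: bij_from_comp => //; exact: iso_bij_from].
- rewrite compA -(compA _ p) pq -!fmapM; congr fmap.
  by rewrite eg -compA e2 compm1.
have -> : h' = e ∘ h ∘ fmap Om x' by rewrite eh -compA -fmapM x2 fmap1 compm1.
rewrite -compA -fmapM !compA e1 comp1m.
rewrite (fmapM J) compA (fmapM S) qh.
by rewrite compNm -!compA loop_nat.
Qed.

(** The fibre W of f respects the lower bound but may exceed the upper one by a degree, so E is its
    truncation below c; the connecting map, once desuspended, lifts along this coreflection because
    [Om A] lies in D^{<=c}. *)
Lemma left_triangle_ex A B (f : mor B A) :
  exists (E : C) (h : mor (Om A) E) (g : mor E B), Del h g f.
Proof.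
have [W [p [d hd]]] := fibre_ex (fmap J f).
have hW : t_ge t a W.
  rewrite -(subrK 1 a); apply: (t_ge_fibre hd); rewrite ?subrK; first exact: ie_ge HJ _.
  by apply: t_ge_mono (ie_ge HJ A); lia.
have [E0 [R [q0 [r [s [htr hE hR]]]]]] := trunc_triangle t c W.
have hE' : t_ge t a E0.
  rewrite -(subrK 1 a); apply: (t_ge_fibre htr); rewrite ?subrK //.
  by apply: t_ge_mono hR; have := ie_ac HJ; lia.
have [E [v hv]] := ie_ess HJ hE hE'.
have [_ q0bij] := trunc_coreflection htr hE hR.
pose q := q0 ∘ v.
have qbij : bij_from (t_le t c) q by apply: bij_from_comp => //; exact: iso_bij_from.
have [b eb] := sh_full (- (d ∘ w A)).
have [h0 eh0] := qbij.2 _ (ie_le HJ (Om A)) b.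
have [h eh] := ie_full HJ h0; have [g eg] := ie_full HJ (p ∘ q).
exists E, h, g, W, p, d, q; split=> //; first by split=> //; exact: (ie_le HJ).
by rewrite eh eh0 eb.
Qed.

Lemma left_triangle_id A Z : is_zero_ob Z -> Del (0 : mor (Om Z) A) (idmor A) (0 : mor A Z).
Proof.
move=> /zeroJ hZ; exists (J A), (idmor _), 0, (idmor _); split.
- by rewrite fmapJ0; exact: tr_id.
- by split; [exact: (ie_le HJ) | apply: iso_bij_from; exact: iso_id].
- by rewrite compm1 fmap1.
- by rewrite fmapJ0 compm0 sh0 comp0m oppr0.
Qed.

(** The fibre of g = p ∘ q maps to A[-1], the fibre of p, and by the relative five lemma this
    comparison is bijective on maps from D^{<=c}, as q is. Hence [Om A], the coreflection of A[-1],
    is also that of the fibre of g. *)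
Lemma left_triangle_rot A B E (h : mor (Om A) E) (g : mor E B) (f : mor B A) :
  Del h g f -> Del (- fmap Om f) h g.
Proof.
move=> [W [p [d [q [hd [hE qbij] pq qh]]]]].
have [ci [c1 c2]] := sh_counit_iso (J A).
have ici : is_iso ci by exists (sh_counit (J A)).
have [l el] := sh_full (- (d ∘ sh_counit (J A))).
have hd1 : dist l p (ci ∘ fmap J f).
  apply/tr_rot; rewrite el opprK.
  apply: (dist_iso2 (iso_id _) ici hd); rewrite ?comp1m ?compm1 //.
  by rewrite -compA c2 compm1.
have [W2 [p2 [d2 hd2]]] := fibre_ex (fmap J g).
have [|r [r1 r2]] := tr_mor1 (b := q) (c := idmor _) hd2 hd1; first by rewrite comp1m.
rewrite compm1 in r2.
have rbij : bij_from (t_le t c) r.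
  apply: (five_bij_from (@t_le_sh _ _ t c) (c := idmor _) hd2 hd1 r1) => //;
    rewrite ?comp1m ?compm1 //; exact: iso_bij_from (iso_id _).
have [o eo] := sh_full (ci ∘ w A).
have ew : sh_counit (J A) ∘ fmap S o = w A by rewrite eo compA c2 comp1m.
have hOm X : t_le t c (J (Om X)) := ie_le HJ _.
have obij : bij_from (t_le t c) o.
  split=> V hV u; first by move=> v e; apply: loop_inj => //; rewrite -ew -!compA -!fmapM e.
  have [v ev] := loop_factor (sh_counit (J A) ∘ fmap S u) hV; exists v.
  apply: sh_inj; rewrite fmapM; apply: (iso_monoP (sh_counit_iso _)).
  by rewrite compA ew.
have [q2 eq2] := rbij.2 _ (hOm A) o.
have q2bij : bij_from (t_le t c) q2 by apply: bij_from_cancel rbij.1 _; rewrite eq2.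
exists W2, p2, d2, q2; split=> //.
- apply: (qbij.1 _ (hOm A)); rewrite compA r1 -compA eq2; apply: sh_inj.
  by rewrite qh fmapM el compNm -compA ew.
have [b eb] := sh_full (d2 ∘ w B).
rewrite -eb fmapJN compmN shN; congr (- fmap S _).
apply: (rbij.1 _ (hOm B)); rewrite compA eq2; apply: sh_inj.
apply: (iso_monoP (sh_counit_iso _)); rewrite !fmapM compA ew loop_nat eb.
by rewrite (compA (fmap S r)) r2 !compA c2 comp1m.
Qed.

(** The morphism is filled in between the fibres in D and then restricted to their coreflections. *)
Lemma left_triangle_mor A B E A' B' E'
    (h : mor (Om A) E) (g : mor E B) (f : mor B A)
    (h' : mor (Om A') E') (g' : mor E' B') (f' : mor B' A')
    (b : mor B B') (x : mor A A') :
  Del h g f -> Del h' g' f' -> x ∘ f = f' ∘ b ->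
  exists e : mor E E', e ∘ h = h' ∘ fmap Om x /\ b ∘ g = g' ∘ e.
Proof.
move=> [W [p [d [q [hd [hE qbij] pq qh]]]]] [W' [p' [d' [q' [hd' [hE' qbij'] pq' qh']]]]] e.
have [|y [y1 y2]] := tr_mor1 (b := fmap J b) (c := fmap J x) hd hd'.
  by rewrite -!fmapM e.
have [v ev] := qbij'.2 _ hE (y ∘ q); have [z ez] := ie_full HJ v.
exists z; split; apply: (ie_inj HJ); rewrite !fmapM ez; last first.
  by rewrite -pq' -compA ev compA -y1 -compA pq.
apply: (qbij'.1 _ (ie_le HJ _)); rewrite !compA ev -compA; apply: sh_inj.
rewrite (fmapM S y) qh compmN compA y2 -compA -loop_nat (fmapM S (q' ∘ _)) qh'.
by rewrite compNm compA.
Qed.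

(** The octahedron of D gives a triangle of fibres Wg → W → Wf, whose coreflections are E → G → F.
    For the second left triangle, the fibre V of u is compared with Wg by the relative five lemma,
    so that E is the coreflection of V too. *)
Lemma left_triangle_oct A B F C0 E
    (f2 : mor (Om A) F) (f1 : mor F B) (f : mor B A)
    (g2 : mor (Om B) E) (g1 : mor E C0) (g : mor C0 B) :
  Del f2 f1 f -> Del g2 g1 g ->
  exists (G : C) (v2 : mor (Om A) G) (v1 : mor G C0)
    (u2 : mor (Om F) E) (u1 : mor E G) (u : mor G F),
    [/\ Del v2 v1 (f ∘ g) & Del u2 u1 u] /\
    [/\ v1 ∘ u1 = g1, f1 ∘ u = g ∘ v1, u ∘ v2 = f2,
        u2 = g2 ∘ fmap Om f1 & u1 ∘ g2 = v2 ∘ fmap Om f].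
Proof.
move=> [Wf [pf [df [qf [hdf [hF qfbij] pqf qhf]]]]].
move=> [Wg [pg [dg [qg [hdg [hE qgbij] pqg qhg]]]]].
have [G [v2 [v1 hDv]]] := left_triangle_ex (f ∘ g).
have [W [p [d [q [hd [hG qbij] pq qh]]]]] := hDv; rewrite fmapM in hd.
have [y [z [hyz [e1 e2 e3 e4]]]] := tr_oct_fibre hdf hdg hd.
have [u0 eu0] := qfbij.2 _ hG (y ∘ q); have [u eu] := ie_full HJ u0.
have [s0 es0] := qbij.2 _ hE (z ∘ qg); have [u1 eu1] := ie_full HJ s0.
have hOm X : t_le t c (J (Om X)) := ie_le HJ _.
have v1u1 : v1 ∘ u1 = g1.
  by apply: (ie_inj HJ); rewrite fmapM eu1 -pq -compA es0 compA e2 pqg.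
have f1u : f1 ∘ u = g ∘ v1.
  by apply: (ie_inj HJ); rewrite !fmapM eu -pqf -compA eu0 compA e1 -compA pq.
exists G, v2, v1, (g2 ∘ fmap Om f1), u1, u; split; last split=> //; last 2 first.
- apply: (ie_inj HJ); apply: (qfbij.1 _ (hOm A)); rewrite fmapM eu compA eu0 -compA.
  by apply: sh_inj; rewrite (fmapM S y) qh qhf compmN compA -e3.
- apply: (ie_inj HJ); apply: (qbij.1 _ (hOm B)); rewrite !fmapM eu1 !compA es0 -compA.
  apply: sh_inj; rewrite (fmapM S z) qhg compmN compA -e4.
  by rewrite -compA -loop_nat (fmapM S (q ∘ _)) qh compNm compA.
split=> //; have [V [pv [dv hdv]]] := fibre_ex (fmap J u).
have [|r [r1 r2]] := tr_mor1 (b := q) (c := qf) hdv hyz; first by rewrite eu eu0.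
have rbij : bij_from (t_le t c) r.
  by apply: (five_bij_from (@t_le_sh _ _ t c) hdv hyz r1 _ r2 qbij qfbij); rewrite eu eu0.
have [qv eqv] := rbij.2 _ hE qg.
exists V, pv, dv, qv; split=> //.
- by split=> //; apply: bij_from_cancel rbij.1 _; rewrite eqv.
- by apply: (qbij.1 _ hE); rewrite compA r1 -compA eqv eu1 es0.
have [b eb] := sh_full (- (dv ∘ w F)); rewrite -eb; congr fmap.
apply: (rbij.1 _ (hOm F)); apply: sh_inj; rewrite (fmapM S r b) eb compmN (compA (fmap S r)) r2.
rewrite compA eqv (fmapM J) compA (fmapM S) qhg compNm -!compA loop_nat; congr (- (_ ∘ _)).
by rewrite !compA pqf.
Qed.

Lemma interval_left_triangulated : @left_triangulated k C Om (fun A B E h g f => Del h g f).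
Proof.
split; first split; [exact: interval_additive | exact: loop_additive | |].
  by move=> *; apply: left_triangle_iso; eauto.
split; [split| | |].
- by move=> *; exact: left_triangle_id.
- by move=> *; exact: left_triangle_ex.
- by move=> *; exact: left_triangle_rot.
- by move=> *; apply: left_triangle_mor; eauto.
- by move=> *; exact: left_triangle_oct.
Qed.

End LeftTriangulated.
End IntervalEmbedding.

(** * Right triangles, through the opposite category *)

Definition suspension_unit (k : comPzRingType) (D : triangulated k) (t : tstructure D)
    (a : int) (C : kcat k) (J : functor C D) (Si : functor C C)
    (v : forall X, mor (sh D (J X)) (J (Si X))) : Prop :=
  (forall (X Y : C) (f : mor X Y),
     fmap J (fmap Si f) ∘ v X = v Y ∘ fmap (sh D) (fmap J f)) /\
  (forall X : C, bij_to (t_ge t a) (v X)).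

(** No sign appears, in contrast with [left_triangle]: the cone triangle A → B → W → A[1] is used
    without rotation. *)
Definition right_triangle (k : comPzRingType) (D : triangulated k) (t : tstructure D)
    (a : int) (C : kcat k) (J : functor C D) (Si : functor C C)
    (v : forall X, mor (sh D (J X)) (J (Si X))) (A B E : C)
    (f : mor A B) (g : mor B E) (h : mor E (Si A)) : Prop :=
  exists (W : D) (p : mor (J B) W) (d : mor W (sh D (J A))) (q : mor W (J E)),
    [/\ dist (fmap J f) p d, reflection (t_ge t a) q, q ∘ p = fmap J g &
        fmap J h ∘ q = v A ∘ d].

Section OppositeInterval.
Variables (k : comPzRingType) (D : triangulated k) (t : tstructure D) (a c : int).
Variables (C : kcat k) (J : functor C D) (HJ : interval_embedding t a c J).
Notation S := (sh D).

Lemma op_interval_embedding : interval_embedding (opts t) (- c) (- a) (opfunctor J).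
Proof.
split.
- by have := ie_ac HJ; lia.
- by move=> X Y f g; exact: (ie_add HJ).
- by move=> X Y; exact: (@ie_inj _ _ _ _ _ _ _ HJ Y X).
- by move=> X Y; exact: (@ie_full _ _ _ _ _ _ _ HJ Y X).
- by move=> X; rewrite t_le_op opprK; exact: (ie_ge HJ).
- by move=> X; rewrite t_ge_op opprK; exact: (ie_le HJ).
move=> X; rewrite t_le_op t_ge_op !opprK => h1 h2.
have [Y [u [u' [u1 u2]]]] := ie_ess HJ h2 h1.
by exists Y, u', u; split.
Qed.

Variables (Si : functor C C) (v : forall X, mor (S (J X)) (J (Si X))).
Hypothesis Hv : suspension_unit t a v.

(** The map X → (Si X)[-1] adjoint to [v X] under the equivalence of [1] and [-1]; in the opposite
    category it points the way a loop counit must. *)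
Definition op_loop (X : C) : mor (J X) (shV D (J (Si X))) :=
  fmap (shV D) (v X) ∘ sh_unit (J X).

Lemma op_loop_counit :
  @loop_counit k (optri D) (opts t) (- a) (opcat C) (opfunctor J) (opfunctor Si) op_loop.
Proof.
(* The adjunction bijection between maps X[1] → V and X → V[-1]. *)
have unitK (X : C) (V : D) (x : mor (S (J X)) V) (y : mor (J X) (shV D V)) :
    fmap (shV D) x ∘ sh_unit (J X) = y <-> x = sh_counit V ∘ fmap S y.
  split=> [<-|->].
    by rewrite fmapM compA -sh_counit_nat -compA sh_triangle1 compm1.
  by rewrite fmapM -compA -sh_unit_nat compA sh_triangle2 comp1m.
split=> [X Y f|X V].
  rewrite /= /op_loop compA -fmapM (proj1 Hv) fmapM -!compA; congr (_ ∘ _).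
  by rewrite -sh_unit_nat.
rewrite t_le_op opprK => hV u; have [vi vs] := Hv.2 X.
have [r er] := vs V hV (@sh_counit k D V ∘ fmap S u); exists r; split.
  by rewrite /= /op_loop compA -fmapM; apply/unitK.
move=> r' /=; rewrite /op_loop compA -fmapM => /unitK e.
by apply: (vi V hV); rewrite er e.
Qed.

(** The sign in the opposite triangles and the sign in [left_triangle] cancel, which leaves the
    unsigned condition on h. *)
Lemma right_triangleP (A B E : C) (f : mor A B) (g : mor B E) (h : mor E (Si A)) :
  right_triangle t a v f g h <->
  @left_triangle k (optri D) (opts t) (- a) (opcat C) (opfunctor J) (opfunctor Si)
    op_loop A B E h g f.
Proof.
have key (W : D) (d : mor W (S (J A))) (d0 : mor (shV D W) (J A)) (q : mor W (J E)) :
    d ∘ sh_counit W = - fmap S d0 ->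
    fmap J h ∘ q = v A ∘ d <-> fmap (shV D) (fmap J h ∘ q) = - (op_loop A ∘ d0).
  move=> ed; have -> : op_loop A ∘ d0 = - fmap (shV D) (v A ∘ d).
    apply: sh_inj; apply: (iso_monoP (sh_counit_iso _)).
    rewrite shN compmN -sh_counit_nat -compA ed compmN opprK.
    rewrite /op_loop !fmapM !compA -sh_counit_nat -(compA (v A)) sh_triangle1.
    by rewrite compm1.
  by rewrite opprK; split=> [->//|]; exact: shV_inj.
split=> [[W [p [d [q [hd [hE hq] pq qh]]]]]|[W [p [d0 [q [[d [ed hd]] [hE hq] pq qh]]]]]].
  have [d0 ed] := sh_full (- (d ∘ sh_counit W)).
  have ed' : d ∘ sh_counit W = - fmap S d0 by rewrite ed opprK.
  exists W, p, d0, q; split=> //; first by exists d.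
    by split; rewrite t_le_op opprK.
  exact/(key _ _ _ _ ed').
rewrite t_le_op opprK in hE hq; exists W, p, d, q; split=> //.
exact/(key _ _ _ _ ed).
Qed.

Lemma interval_right_triangulated :
  @right_triangulated k C Si (fun A B E f g h => right_triangle t a v f g h).
Proof.
rewrite /right_triangulated.
have -> : (fun A B E h g f => right_triangle t a v f g h) =
    (fun A B E => @left_triangle k (optri D) (opts t) (- a) (opcat C) (opfunctor J)
       (opfunctor Si) op_loop A B E).
  do 6! apply: functional_extensionality_dep => ?.
  by apply/propext; exact: right_triangleP.
exact: (interval_left_triangulated op_interval_embedding op_loop_counit).
Qed.

End OppositeInterval.

(** * The adjunction and the ladders between right and left triangles *)

Section Pretriangulated.
Variables (k : comPzRingType) (D : triangulated k) (t : tstructure D) (a c : int).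
Variables (C : kcat k) (J : functor C D) (HJ : interval_embedding t a c J).
Variables (Om : functor C C) (w : forall X, mor (sh D (J (Om X))) (J X)).
Variables (Si : functor C C) (v : forall X, mor (sh D (J X)) (J (Si X))).
Hypotheses (Hw : loop_counit t c w) (Hv : suspension_unit t a v).
Notation S := (sh D).

(** Both Hom(Si A, B) and Hom(A, Om B) are identified with D(A[1], B); adjoint maps are those with
    the same image there. *)
Definition loop_adj_rel (A B : C) (f : mor (Si A) B) (g : mor A (Om B)) : Prop :=
  w B ∘ fmap S (fmap J g) = fmap J f ∘ v A.

Lemma loop_adj_ex A B (f : mor (Si A) B) : exists g, loop_adj_rel f g.
Proof.
have [g0 eg0] := loop_factor Hw (fmap J f ∘ v A) (ie_le HJ A).
by have [g eg] := ie_full HJ g0; exists g; rewrite /loop_adj_rel eg.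
Qed.

Lemma loop_adj_inj A B (f : mor (Si A) B) (g g' : mor A (Om B)) :
  loop_adj_rel f g -> loop_adj_rel f g' -> g = g'.
Proof.
move=> h h'; apply: (ie_inj HJ); apply: (loop_inj Hw (ie_le HJ A)).
by rewrite h h'.
Qed.

Definition loop_adj A B (f : mor (Si A) B) : mor A (Om B) :=
  projT1 (cid (loop_adj_ex f)).

Lemma loop_adjP A B (f : mor (Si A) B) : loop_adj_rel f (loop_adj f).
Proof. exact: (projT2 (cid (loop_adj_ex f))). Qed.

Lemma loop_adj_bij A B : bijective (@loop_adj A B).
Proof.
have ex (g : mor A (Om B)) : exists f, loop_adj_rel f g.
  have [f0 ef0] := (Hv.2 A).2 _ (ie_ge HJ B) (w B ∘ fmap S (fmap J g)).
  by have [f ef] := ie_full HJ f0; exists f; rewrite /loop_adj_rel ef.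
exists (fun g => projT1 (cid (ex g))) => [f|g]; case: cid => [f' /= hf'].
  apply: (ie_inj HJ); apply: ((Hv.2 A).1 _ (ie_ge HJ B)).
  by rewrite -hf' (loop_adjP f).
exact: loop_adj_inj (loop_adjP _) hf'.
Qed.

Lemma loop_adj_nat A A' B B' (x : mor A' A) (f : mor (Si A) B) (b : mor B B') :
  loop_adj (b ∘ f ∘ fmap Si x) = fmap Om b ∘ loop_adj f ∘ x.
Proof.
apply: loop_adj_inj (loop_adjP _) _.
rewrite /loop_adj_rel !fmapM !compA (loop_nat Hw) -(compA (fmap J b)) (loop_adjP f).
by rewrite -!compA (proj1 Hv).
Qed.

Definition loop_adjunction : adjunction Si Om := Adjunction loop_adj_bij loop_adj_nat.

(** The rotated triangle B → W → A[1] is mapped to W' → B' → E'; the sign of the rotation cancels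
    the one in [left_triangle], so the outer maps are compatible. The filler W → B' then extends
    along the reflection q to E, as B' lies in D^{>=a}. *)
Lemma right_left_ladder (A B E A' B' E' : C)
    (f : mor A B) (g : mor B E) (h : mor E (Si A))
    (h' : mor (Om E') A') (g' : mor A' B') (f' : mor B' E')
    (x : mor A (Om E')) (b : mor B A') (y : mor (Si A) E') :
  right_triangle t a v f g h -> left_triangle t c w h' g' f' ->
  loop_adj_rel y x -> b ∘ f = h' ∘ x ->
  exists z : mor E B', z ∘ g = g' ∘ b /\ y ∘ h = f' ∘ z.
Proof.
move=> [W [p [d [q [hd [hE [qi qs]] qp hq]]]]] [W' [p' [d' [q' [hd' [hA' [qi' qs']] pq' qh']]]]].
move=> xy e.
have [|z0 [z1 z2]] := tr_mor2 (a := q' ∘ fmap J b) (c := fmap J y ∘ v A) (dist_rot hd) hd'.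
  rewrite compmN -fmapM -compA -fmapM e (fmapM J) compA (fmapM S) qh' compNm opprK.
  by rewrite -compA xy.
have [z' ez'] := qs _ (ie_ge HJ B') z0; have [z ez] := ie_full HJ z'.
exists z; split; apply: (ie_inj HJ); rewrite !fmapM ez.
  by rewrite -qp -pq' compA ez' z1 compA.
by apply: (qi _ (ie_ge HJ E')); rewrite -!compA hq ez' compA z2.
Qed.

(** With the same two triangles, the first map B → W' is now the one filled in; it lifts along the
    coreflection q' because B lies in D^{<=c}. *)
Lemma left_right_ladder (A B E A' B' E' : C)
    (f : mor A B) (g : mor B E) (h : mor E (Si A))
    (h' : mor (Om E') A') (g' : mor A' B') (f' : mor B' E')
    (z : mor E B') (x : mor A (Om E')) (y : mor (Si A) E') :
  right_triangle t a v f g h -> left_triangle t c w h' g' f' ->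
  loop_adj_rel y x -> y ∘ h = f' ∘ z ->
  exists b : mor B A', b ∘ f = h' ∘ x /\ z ∘ g = g' ∘ b.
Proof.
move=> [W [p [d [q [hd [hE [qi qs]] qp hq]]]]] [W' [p' [d' [q' [hd' [hA' [qi' qs']] pq' qh']]]]].
move=> xy e.
have [|b0 [b1 b2]] := tr_mor1 (b := fmap J z ∘ q) (c := fmap J y ∘ v A) (dist_rot hd) hd'.
  by rewrite compA -fmapM -e fmapM -!compA hq.
have [b' eb'] := qs' _ (ie_le HJ B) b0; have [b eb] := ie_full HJ b'.
exists b; split; apply: (ie_inj HJ); rewrite !fmapM eb.
  apply: (qi' _ (ie_le HJ A)); apply: sh_inj; rewrite !compA eb' (fmapM S b0).
  by apply: oppr_inj; rewrite -compmN b2 -xy compA fmapM qh' compNm opprK.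
by rewrite -qp -pq' compA b1 -compA eb'.
Qed.

Lemma interval_pretriangulated :
  @pretriangulated k C Si Om loop_adjunction
    (fun A B E h g f => left_triangle t c w h g f)
    (fun A B E f g h => right_triangle t a v f g h).
Proof.
split; [exact: (interval_left_triangulated HJ Hw) | exact: (interval_right_triangulated HJ Hv) | |].
  move=> A B E A' B' E' f g h h' g' f' x b y hr hl <- e.
  exact: right_left_ladder hr hl (loop_adjP y) e.
move=> A B E A' B' E' f g h h' g' f' z y hr hl e.
exact: left_right_ladder hr hl (loop_adjP y) e.
Qed.

End Pretriangulated.

(** * The category D^{[-n+1,0]} *)

Section ExtendedHeart.
Variables (k : comPzRingType) (D : triangulated k) (t : tstructure D) (T : truncation t).
Variables (n : nat) (hn : (0 < n)%N).
Notation S := (sh D).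
Notation J := (fincl (t_range t n)).

Lemma tau_le_coreflection m (X : D) : coreflection (t_le t m) (tau_le_map T m X).
Proof.
split; first exact: tau_leP.
split=> V hV u; first by move=> v; exact: tau_le_inj.
by have [g [eg _]] := tau_le_univ T u hV; exists g.
Qed.

Lemma tau_ge_reflection m (X : D) : reflection (t_ge t m) (tau_ge_map T m X).
Proof.
split; first exact: tau_geP.
split=> V hV u; first by move=> v; exact: tau_ge_inj.
by have [g [eg _]] := tau_ge_univ T u hV; exists g.
Qed.

Lemma ext_heart_embedding : interval_embedding t (- n%:Z + 1) 0 J.
Proof.
split; try by [].
- lia.
- by move=> X Y f g.
- by move=> X Y g; exists g.
- by move=> X; case: (fs_valP X).
- by move=> X; case: (fs_valP X).
by move=> X h1 h2; exists (FullsubOb (conj h1 h2)); exact: iso_ob_refl.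
Qed.

Definition Omega_counit (X : ext_heart t n) : mor (S (J (Omega T n X))) (J X) :=
  sh_counit (J X) ∘ fmap S (tau_le_map T 0 (shV D (J X))).

Definition Sigma_unit (X : ext_heart t n) : mor (S (J X)) (J (Sigma T n X)) :=
  tau_ge_map T (- n%:Z + 1) (S (J X)).

Lemma Omega_loop_counit : loop_counit t 0 Omega_counit.
Proof.
split=> [X Y f|X V hV u].
  rewrite /Omega_counit -compA -fmapM tau_le_nat fmapM !compA; congr (_ ∘ _).
  exact: esym (sh_counit_nat _).
have [ci [c1 c2]] := sh_counit_iso (J X).
have [u' eu'] := sh_full (ci ∘ u).
have [_ [qi qs]] := tau_le_coreflection 0 (shV D (J X)).
have [v ev] := qs V hV u'; exists v; split.
  by rewrite /Omega_counit -compA -fmapM ev eu' compA c2 comp1m.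
move=> v' e; apply: (qi V hV); rewrite ev; apply: sh_inj.
by rewrite eu' -e /Omega_counit fmapM !compA c1 comp1m.
Qed.

Lemma Sigma_suspension_unit : suspension_unit t (- n%:Z + 1) Sigma_unit.
Proof.
split=> [X Y f|X]; first exact: tau_ge_nat.
exact: (tau_ge_reflection _ _).2.
Qed.

Lemma sh_unitV (X : D) (r : mor (shV D (S X)) X) : sh_unit X ∘ r = idmor _ ->
  fmap S r = sh_counit (S X).
Proof.
by move=> hr; rewrite -[LHS]comp1m -(sh_triangle1 X) -compA -fmapM hr fmap1 compm1.
Qed.

(** The fibre W corresponds to Z[-1], and the cone Z to W[1]. The cone inclusion enters with a minus
    sign, which offsets the sign that [left_triangle] puts on h. *)
Lemma DeltaP (A B E : ext_heart t n) (h : mor (Omega T n A) E) (g : mor E B) (f : mor B A) :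
  Delta h g f <-> left_triangle t 0 Omega_counit h g f.
Proof.
split.
  move=> [X0 [Y0 [f0 [Z [i [p [v [hd ev [x [b [y [[ix ib iy] [e1 e2 e3]]]]]]]]]]]]].
  have [x' [x1 x2]] := ix; have [y' [y1 y2]] := iy.
  have [z [z1 z2]] := sh_counit_iso Z; have [r [r1 r2]] := sh_unit_iso (J X0).
  exists (shV D Z), (b ∘ r ∘ fmap (shV D) p), (- (z ∘ i ∘ y')),
    (tau_le_map T 0 (shV D Z) ∘ x').
  split.
  - apply/tr_rot; apply: tr_iso (dist_neg2 hd); exists b, y, z.
    split; first by split=> //; exists (sh_counit Z).
    split=> //; first by rewrite compmN compNm -!compA y1 compm1.
    rewrite compmN compNm; congr (- _); rewrite !fmapM (sh_unitV r2) -!compA.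
    by congr (_ ∘ _); rewrite compA -sh_counit_nat -compA z2 compm1.
  - split; first by case: (fs_valP E).
    apply: bij_from_comp; first exact: (tau_le_coreflection _ _).2.
    by apply: iso_bij_from; exists x.
  - rewrite -!compA (compA _ _ x') -ev (compA r) (compA r) r1 comp1m (compA b) -e2.
    by rewrite -compA x2 compm1.
  have -> : fmap J h = x ∘ fmap (tau_le T 0) (fmap (shV D) (i ∘ y')).
    rewrite !fmapM compA -e1 -compA. 
    rewrite -(fmapM (tau_le T 0)) -(fmapM (shV D)) y2 !fmap1; exact: esym (compm1 _).
  rewrite (compA _ x) -(compA _ x' x) x1 compm1 tau_le_nat compNm opprK /Omega_counit.
  rewrite (fmapM S) (compA (z ∘ i ∘ y')); congr (_ ∘ _); apply: (iso_monoP (sh_counit_iso Z)).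
  by rewrite -sh_counit_nat !compA z2 comp1m.
move=> [W [p [d [q [hd hq pq qh]]]]].
have [r [r1 r2]] := sh_unit_iso (J B); have [s [s1 s2]] := sh_unit_iso W.
have [hE [qi qs]] := hq.
have [hZ hz] := tau_le_coreflection 0 (shV D (S W)).
have [x ex] := qs _ hZ (s ∘ tau_le_map T 0 (shV D (S W))).
(* Rotating W → B → A gives a cone with maps d and -p[1]; both signs are flipped, so that the
   projection is p[1] as [Delta] requires. *)
exists B, A, f, (S W), (- d), (fmap S p),
  (r ∘ fmap (shV D) (fmap S p) ∘ tau_le_map T 0 (shV D (S W))).
split.
- by have := dist_neg2 (dist_rot hd); rewrite opprK.
- by rewrite !compA r2 comp1m.
exists x, (idmor _), (idmor _); split; split.
- apply: (bij_from_iso hZ hE); apply: (bij_from_cancel qi); rewrite ex.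
  by apply: bij_from_comp hz; apply: iso_bij_from; exists (sh_unit W).
- exact: iso_id.
- exact: iso_id.
- rewrite !fmap1 compm1; apply: qi; first by case: (fs_valP (Omega T n A)).
  rewrite compA ex -compA tau_le_nat; apply: sh_inj; rewrite qh !fmapM (sh_unitV s2) compA.
  by rewrite -sh_counit_nat !compNm -compA.
- have e : p ∘ s = r ∘ fmap (shV D) (fmap S p).
    by rewrite -[LHS]comp1m -r1 -compA (compA _ p) sh_unit_nat -!compA s2 compm1.
  by rewrite comp1m -pq -(compA p) ex compA e.
by rewrite compm1 comp1m.
Qed.

Lemma NablaP (A B E : ext_heart t n) (f : mor A B) (g : mor B E) (h : mor E (Sigma T n A)) :
  Nabla f g h <-> right_triangle t (- n%:Z + 1) Sigma_unit f g h.
Proof.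
split.
  move=> [X0 [Y0 [f0 [Z [i [p [hd [x [b [y [[ix ib iy] [e1 e2 e3]]]]]]]]]]]].
  have [y' [y1 y2]] := iy; have [b' [b1 b2]] := ib.
  exists Z, (i ∘ b'), (fmap S x ∘ p), (y ∘ tau_ge_map T (- n%:Z + 1) Z); split.
  - apply: tr_iso hd; exists x, b, (idmor Z).
    split; first by split=> //; exact: iso_id.
    by rewrite compm1 comp1m -compA b1 compm1 e1.
  - have [h1 h2] := tau_ge_reflection (- n%:Z + 1) Z.
    split; first by case: (fs_valP E).
    by apply: bij_to_comp h2; exact: iso_bij_to.
  - by rewrite compA -(compA y) -e2 -compA b2 compm1.
  by rewrite compA e3 -compA tau_ge_nat compA tau_ge_nat -compA.
move=> [W [p [d [q [hd [hE qbij] qp qh]]]]].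
have [hZ [zi zs]] := tau_ge_reflection (- n%:Z + 1) W.
have [y ey] := zs _ hE q.
exists A, B, f, W, p, d; split=> //.
exists (idmor _), (idmor _), y; split; split.
- exact: iso_id.
- exact: iso_id.
- apply: (bij_to_iso hZ hE).
  by apply: (@bij_from_cancel k (opcat D) _ _ _ _ _ y zi); rewrite /= ey.
- by rewrite compm1 comp1m.
- by rewrite compm1 compA ey qp.
apply: zi; first by case: (fs_valP (Sigma T n A)).
by rewrite !fmap1 comp1m -compA ey qh tau_ge_nat.
Qed.

Lemma ext_heart_pretriangulated :
  exists Phi : adjunction (Sigma T n) (Omega T n),
    pretriangulated Phi (@Delta k D t T n) (@Nabla k D t T n).
Proof.
exists (loop_adjunction ext_heart_embedding Omega_loop_counit Sigma_suspension_unit).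
have -> : @Delta k D t T n = fun A B E h g f => left_triangle t 0 Omega_counit h g f.
  by do 6! apply: functional_extensionality_dep => ?; apply/propext; exact: DeltaP.
have -> : @Nabla k D t T n =
    fun A B E f g h => right_triangle t (- n%:Z + 1) Sigma_unit f g h.
  by do 6! apply: functional_extensionality_dep => ?; apply/propext; exact: NablaP.
exact: interval_pretriangulated.
Qed.

End ExtendedHeart.

(** * Extriangulated structure *)

Section SplitTriangles.
Variables (k : comPzRingType) (D : triangulated k).
Implicit Types A B X Y Z V W : D.
Notation S := (sh D).

(** The extension is the fibre of its class d, with the map out of A obtained by desuspension. *)
Lemma extension_ex A X (d : mor X (S A)) :
  exists (B : D) (f : mor A B) (g : mor B X), dist f g d.
Proof.
have [B [g [d' hd]]] := fibre_ex d; have [f ef] := sh_full (- d').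
by exists B, f, g; apply/tr_rot; rewrite ef opprK.
Qed.

Lemma dist_iso_mid A B B' X f g d (f' : mor A B') (g' : mor B' X) (b : mor B B') :
  is_iso b -> b ∘ f = f' -> g' ∘ b = g -> @dist _ D A B X f g d -> dist f' g' d.
Proof.
move=> hb e1 e2 hd; apply: (dist_iso2 hb (iso_id _) hd) => //.
  by rewrite comp1m.
by rewrite compm1.
Qed.

Lemma dist_mid_iso A B B' X f g d (f' : mor A B') (g' : mor B' X) :
  @dist _ D A B X f g d -> dist f' g' d ->
  exists b : mor B B', [/\ is_iso b, b ∘ f = f' & g' ∘ b = g].
Proof.
move=> hd hd'; have [|b [b1 b2]] := tr_mor2 (a := idmor A) (c := idmor X) hd hd'.
  by rewrite fmap1 comp1m compm1.
rewrite comp1m in b2; rewrite compm1 in b1; exists b; split=> //.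
apply: (five_iso (a := idmor _) (c := idmor _) hd hd'); try exact: iso_id.
- by rewrite compm1.
- by rewrite comp1m.
- by rewrite fmap1 comp1m compm1.
Qed.

Lemma bij_iso X Y (f : mor X Y) :
  (forall V (u : mor V X), f ∘ u = 0 -> u = 0) ->
  (forall V (u : mor V Y), exists v, f ∘ v = u) -> is_iso f.
Proof.
move=> h1 h2; apply: (@bij_from_iso _ _ (fun=> True)) => //; split=> [|V _ u].
  by apply: inj_from0 => V _; exact: h1.
exact: h2.
Qed.

(** In a triangle realizing 0 the second map g has a section s, and f ∘ p1 + s ∘ p2 identifies the
    biproduct with the middle term. *)
Lemma dist_biproduct A X P (i1 : mor A P) (i2 : mor X P) (p1 : mor P A) (p2 : mor P X) :
  p1 ∘ i1 = idmor A -> p2 ∘ i2 = idmor X -> p1 ∘ i2 = 0 -> p2 ∘ i1 = 0 ->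
  i1 ∘ p1 + i2 ∘ p2 = idmor P -> dist i1 p2 (0 : mor X (S A)).
Proof.
move=> e11 e22 e12 e21 es; have [Q [f [g hd]]] := extension_ex (0 : mor X (S A)).
have [|s es'] := dist_exact_r (u := idmor X) hd; first by rewrite comp0m.
pose b := f ∘ p1 + s ∘ p2.
have b1 : b ∘ i1 = f by rewrite compDm -!compA e11 e21 compm0 compm1 addr0.
have b2 : g ∘ b = p2.
  by rewrite compmD !compA (dist_comp0 hd) -es' comp0m comp1m add0r.
have bi2 : b ∘ i2 = s by rewrite compDm -!compA e12 e22 compm0 compm1 add0r.
have [b' [b'1 b'2]] : is_iso b.
  apply: bij_iso => V u.
    move=> bu; have p2u : p2 ∘ u = 0 by rewrite -b2 -compA bu compm0.
    have fp : f ∘ (p1 ∘ u) = 0.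
      by move: bu; rewrite compDm -!compA p2u compm0 addr0.
    have p1u : p1 ∘ u = 0.
      apply: sh_inj; rewrite sh0.
      have [|y ->] := dist_exact_s (u := fmap S (p1 ∘ u)) hd; first by rewrite -fmapM fp sh0.
      by rewrite comp0m.
    by rewrite -[u]comp1m -es compDm -!compA p1u p2u !compm0 addr0.
  have [|v ev] := dist_exact (u := u - s ∘ (g ∘ u)) hd.
    by rewrite compmB (compA g) -es' comp1m subrr.
  exists (i1 ∘ v + i2 ∘ (g ∘ u)); rewrite compmD !compA b1 bi2 -ev.
  by rewrite -!compA subrK.
apply: (dist_iso_mid (b := b') _ _ _ hd); first by exists b.
  by rewrite -b1 compA b'1 comp1m.
by rewrite -b2 -compA b'2 compm1.
Qed.

Lemma dist_bp_map A0 A1 B0 B1 X0 X1 (PA : biproduct A0 A1) (PB : biproduct B0 B1)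
    (PX : biproduct X0 X1) f0 g0 d0 f1 g1 d1 :
  @dist _ D A0 B0 X0 f0 g0 d0 -> @dist _ D A1 B1 X1 f1 g1 d1 ->
  dist (bp_map PA PB f0 f1) (bp_map PB PX g0 g1)
    (fmap S (bp_in1 PA) ∘ (d0 ∘ bp_pr1 PX) + fmap S (bp_in2 PA) ∘ (d1 ∘ bp_pr2 PX)).
Proof.
move=> h0 h1; set d := (X in dist _ _ X); have [Q [f [g hd]]] := extension_ex d.
have din1 : d ∘ bp_in1 PX = fmap S (bp_in1 PA) ∘ d0.
  by rewrite /d compDm -!compA bp_11 bp_21 !compm0 compm1 addr0.
have din2 : d ∘ bp_in2 PX = fmap S (bp_in2 PA) ∘ d1.
  by rewrite /d compDm -!compA bp_12 bp_22 !compm0 compm1 add0r.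
have prd1 : fmap S (bp_pr1 PA) ∘ d = d0 ∘ bp_pr1 PX.
  by rewrite /d compmD !compA -!fmapM bp_11 bp_12 fmap1 sh0 !comp0m comp1m addr0.
have prd2 : fmap S (bp_pr2 PA) ∘ d = d1 ∘ bp_pr2 PX.
  by rewrite /d compmD !compA -!fmapM bp_21 bp_22 fmap1 sh0 !comp0m comp1m add0r.
have [b0 [b01 b02]] := tr_mor2 h0 hd (esym din1).
have [b1 [b11 b12]] := tr_mor2 h1 hd (esym din2).
pose b := b0 ∘ bp_pr1 PB + b1 ∘ bp_pr2 PB.
set F := bp_map PA PB f0 f1; set G := bp_map PB PX g0 g1.
have bF : b ∘ F = f.
  rewrite /b /F /bp_map compmD !compDm -!compA !(compA (bp_pr1 PB)) !(compA (bp_pr2 PB)).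
  rewrite bp_11 bp_12 bp_21 bp_22 !comp0m !comp1m !compm0 addr0 add0r.
  by rewrite !compA b01 b11 -!compA -compmD bp_sum compm1.
have gb : g ∘ b = G by rewrite /b /G /bp_map compmD !compA -b02 -b12.
have prF1 : bp_pr1 PB ∘ F = f0 ∘ bp_pr1 PA.
  by rewrite /F /bp_map compmD !compA bp_11 bp_12 !comp0m comp1m addr0.
have prF2 : bp_pr2 PB ∘ F = f1 ∘ bp_pr2 PA.
  by rewrite /F /bp_map compmD !compA bp_21 bp_22 !comp0m comp1m add0r.
have prG1 : bp_pr1 PX ∘ G = g0 ∘ bp_pr1 PB.
  by rewrite /G /bp_map compmD !compA bp_11 bp_12 !comp0m comp1m addr0.
have prG2 : bp_pr2 PX ∘ G = g1 ∘ bp_pr2 PB.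
  by rewrite /G /bp_map compmD !compA bp_21 bp_22 !comp0m comp1m add0r.
have ext P0 P1 (P : biproduct P0 P1) V (u u' : mor V (bp_ob P)) :
    bp_pr1 P ∘ u = bp_pr1 P ∘ u' -> bp_pr2 P ∘ u = bp_pr2 P ∘ u' -> u = u'.
  by move=> e1 e2; rewrite -[u]comp1m -[u']comp1m -(bp_sum P) !compDm -!compA e1 e2.
have lift V (v0 : mor V A0) (v1 : mor V A1) : exists v : mor V (bp_ob PA),
    bp_pr1 PA ∘ v = v0 /\ bp_pr2 PA ∘ v = v1.
  exists (bp_in1 PA ∘ v0 + bp_in2 PA ∘ v1); rewrite !compmD !compA.
  by rewrite bp_11 bp_12 bp_21 bp_22 !comp0m !comp1m addr0 add0r.
have Fd : fmap S F ∘ d = 0.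
  rewrite /F /bp_map shD !fmapM compDm -!compA prd1 prd2 (compA (fmap S f0)).
  by rewrite (compA (fmap S f1)) (dist_comp0s h0) (dist_comp0s h1) !comp0m !compm0 addr0.
have hb : is_iso b.
  apply: bij_iso => V u.
    (* A map killed by [b] has the form F ∘ v with f ∘ v = 0; then v[1] factors through d, and F[1]
       ∘ d = 0. *)
    move=> bu; have Gu : G ∘ u = 0 by rewrite -gb -compA bu compm0.
    have [|v0 ev0] := dist_exact (u := bp_pr1 PB ∘ u) h0.
      by rewrite compA -prG1 -compA Gu compm0.
    have [|v1 ev1] := dist_exact (u := bp_pr2 PB ∘ u) h1.
      by rewrite compA -prG2 -compA Gu compm0.
    have [v [e0 e1]] := lift V v0 v1.
    have eu : u = F ∘ v.
      by apply: ext; rewrite compA ?prF1 ?prF2 -compA ?e0 ?e1.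
    have fv : f ∘ v = 0 by rewrite -bF -compA -eu.
    have [|y ey] := dist_exact_s (u := fmap S v) hd; first by rewrite -fmapM fv sh0.
    by apply: sh_inj; rewrite eu fmapM ey compA Fd comp0m sh0.
  have dgu : d ∘ (g ∘ u) = 0 by rewrite compA (dist_comp0r hd) comp0m.
  have [|y0 ey0] := dist_exact_r (u := bp_pr1 PX ∘ (g ∘ u)) h0.
    by rewrite compA -prd1 -compA dgu compm0.
  have [|y1 ey1] := dist_exact_r (u := bp_pr2 PX ∘ (g ∘ u)) h1.
    by rewrite compA -prd2 -compA dgu compm0.
  pose y := bp_in1 PB ∘ y0 + bp_in2 PB ∘ y1.
  have eG : G ∘ y = g ∘ u.
    apply: ext; rewrite compA ?prG1 ?prG2 ?ey0 ?ey1 -compA; congr (_ ∘ _);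
      rewrite /y compmD !compA ?bp_11 ?bp_12 ?bp_21 ?bp_22 comp0m comp1m ?addr0 ?add0r //.
  have [|v ev] := dist_exact (u := u - b ∘ y) hd.
    by rewrite compmB compA gb eG subrr.
  by exists (y + F ∘ v); rewrite compmD (compA b F) bF -ev addrC subrK.
have [b' [b'1 b'2]] := hb.
apply: (dist_iso_mid (b := b') _ _ _ hd); first by exists b.
  by rewrite -bF compA b'1 comp1m.
by rewrite -gb -compA b'2 compm1.
Qed.

End SplitTriangles.

Section Extriangulated.
Variables (k : comPzRingType) (D : triangulated k) (t : tstructure D).
Variables (n : nat) (hn : (0 < n)%N).
Notation S := (sh D).
Notation C := (ext_heart t n).
Notation J := (fincl (t_range t n)).

Definition ext_realization : realization (ext_bifunctor t n) :=
  fun A B X d f g => @dist k D A B X f g d.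

Lemma range_ext X Y Z f g h : @dist _ D X Y Z f g h ->
  t_range t n X -> t_range t n Z -> t_range t n Y.
Proof.
by move=> hd [x1 x2] [z1 z2]; split; [exact: t_le_ext hd x1 z1 | exact: t_ge_ext hd x2 z2].
Qed.

Lemma ext_additive_realization : additive_realization ext_realization.
Proof.
split.
- move=> A X d; have [B [f [g hd]]] := @extension_ex k D A X d.
  have hB := range_ext hd (fs_valP A) (fs_valP X).
  exists (FullsubOb hB), f, g; split=> // B' f' g'; split.
    move=> hd'; have [b [[b' [b1 b2]] h2 h3]] := dist_mid_iso hd hd'.
    by exists b; split=> //; exists b'.
  move=> [b [[b' [b1 b2]] h2 h3]].
  by apply: (dist_iso_mid _ h2 h3 hd); exists b'.
- move=> A0 B0 X0 A1 B1 X1 d0 d1 f0 g0 f1 g1 a c h0 h1 e.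
  exact: (tr_mor2 h0 h1 e).
- move=> A X P.
  exact: (dist_biproduct (bp_11 P) (bp_22 P) (bp_12 P) (bp_21 P) (bp_sum P)).
move=> A0 B0 X0 A1 B1 X1 d0 d1 f0 g0 f1 g1 PA PB PX h0 h1.
pose val (A B : C) (P : biproduct A B) :=
  @Biproduct k D A B (bp_ob P) (bp_in1 P) (bp_in2 P) (bp_pr1 P) (bp_pr2 P)
    (bp_11 P) (bp_22 P) (bp_12 P) (bp_21 P) (bp_sum P).
exact: (dist_bp_map (val _ _ PA) (val _ _ PB) (val _ _ PX) h0 h1).
Qed.

(** The axioms are those of D on maps and octahedra; the only new object in ET4 and its dual is an
    extension of objects of the interval, hence in it. *)
Lemma ext_heart_extriangulated : extriangulated ext_realization.
Proof.
split; first exact: interval_additive (ext_heart_embedding t hn).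
split; first exact: ext_additive_realization.
split.
- move=> A B X A' B' X' d d' f g f' g' a b h h' e; exact: (tr_mor h h' e).
- move=> A B X A' B' X' d d' f g f' g' b c h h' e; exact: (tr_mor1 h h' e).
- move=> A B G X F f f' d g g' d' h h'.
  have [H [p [d'' hd]]] := @tr_cone k D A X (g ∘ f).
  have [u [e [hue [e1 e2 e3 e4]]]] := tr_oct h h' hd.
  have hH := range_ext hue (fs_valP G) (fs_valP F).
  by exists (FullsubOb hH), p, d'', u, e; split; split.
move=> A B G X F f f' d g g' d' h h'.
have [H [p [d'' hd]]] := @fibre_ex k D X A (f ∘ g).
have [u [e [hue [e1 e2 e3 e4]]]] := tr_oct_fibre h h' hd.
have hH := range_ext hue (fs_valP F) (fs_valP G).
by exists (FullsubOb hH), p, d'', u, e; split; split.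
Qed.

(** The cone of f always lies in D^{<=0}, so being an inflation concerns its lower bound alone. The
    surjectivity part of that criterion is vacuous, since D^{<=-n} has no nonzero map to Y. *)
Lemma inflationP (X Y : C) (f : mor X Y) :
  inflation ext_realization f <-> inj_from (t_le t (- n%:Z + 1)) (fmap J f).
Proof.
split=> [[Z [g [d hd]]]|hf].
  by have [] := cone_ge_inj hd (proj2 (fs_valP Z)).
have [Z [g [d hd]]] := @tr_cone k D X Y f.
have hZ : t_range t n Z.
  split.
    apply: (t_le_cone hd (t_le1 _) _); by case: (fs_valP X); case: (fs_valP Y).
  apply: (inj_cone_ge hd hf) => V hV u; exists 0; rewrite compm0; apply/esym.
  by apply: (t_orth u hV); rewrite subrK; case: (fs_valP Y).
by exists (FullsubOb hZ), g, d.
Qed.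

Lemma deflationP (X Y : C) (f : mor X Y) :
  deflation ext_realization f <-> inj_to (t_ge t 0) (fmap J f).
Proof.
split=> [[Z [g [d hd]]]|hf].
  by have [] := fibre_le_inj hd (proj1 (fs_valP Z)).
have [Z [g [d hd]]] := @fibre_ex k D X Y f.
have hZ : t_range t n Z.
  split; last first.
    apply: (t_ge_fibre hd); first by case: (fs_valP X).
    by apply: t_ge_mono (proj2 (fs_valP Y)); lia.
  apply: (inj_fibre_le hd hf) => V hV u; exists 0; rewrite comp0m; apply/esym.
  by apply: (t_orth u _ hV); case: (fs_valP X).
by exists (FullsubOb hZ), g, d.
Qed.

End Extriangulated.

(** * Loops, suspensions and factorizations *)

Lemma fiter_opfunctor (k : comPzRingType) (C : kcat k) (F : functor C C) i :
  fiter i (opfunctor F) = opfunctor (fiter i F).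
Proof.
have ext (E E' : kcat k) (o : E -> E') (m : forall X Y : E, mor X Y -> mor (o X) (o Y))
    m1 m1' mM mM' : @Functor k E E' o m m1 mM = @Functor k E E' o m m1' mM'.
  by rewrite (Prop_irrelevance m1 m1') (Prop_irrelevance mM mM').
by elim: i => [|i IH] /=; rewrite ?IH; exact: ext.
Qed.

Section Loops.
Variables (k : comPzRingType) (D : triangulated k) (t : tstructure D) (a c : int).
Variables (C : kcat k) (J : functor C D) (HJ : interval_embedding t a c J).
Variables (Om : functor C C) (w : forall X, mor (sh D (J (Om X))) (J X)).
Hypothesis Hw : loop_counit t c w.
Notation S := (sh D).

(** A monomorphism of C is tested on objects of C only; a map from V in D^{<=c} into C factors
    through the truncation of V above a, which is such an object. *)
Lemma interval_monoP X Y (f : mor X Y) : is_mono f <-> inj_from (t_le t c) (fmap J f).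
Proof.
split=> hf; last first.
  move=> W u v e; apply: (ie_inj HJ); apply: (hf _ (ie_le HJ W)).
  by rewrite -!fmapM e.
move=> V hV u v e.
have [A [V' [i [p [d [hd hA hV']]]]]] := trunc_triangle t (a - 1) V.
have [_ [pi ps]] := trunc_reflection hd hA hV'; rewrite subrK in hV' pi ps.
have hV2 : t_le t c V'.
  by apply: (t_le_cone hd _ hV); apply: t_le_mono hA; have := ie_ac HJ; lia.
have [Q [x [y [yx xy]]]] := ie_ess HJ hV2 hV'.
have [u' eu] := ps _ (ie_ge HJ X) u; have [v' ev] := ps _ (ie_ge HJ X) v.
have [u2 eu2] := ie_full HJ (u' ∘ x); have [v2 ev2] := ie_full HJ (v' ∘ x).
suff e2 : u2 = v2 by rewrite -eu -ev -[u']compm1 -[v']compm1 -xy !compA -eu2 -ev2 e2.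
apply: hf; apply: (ie_inj HJ); rewrite !fmapM eu2 ev2 !compA; congr (_ ∘ _).
by apply: (pi _ (ie_ge HJ Y)); rewrite -!compA eu ev.
Qed.

Lemma interval_isoP X Y (f : mor X Y) : is_iso f <-> bij_from (t_le t c) (fmap J f).
Proof.
rewrite -(isoJ HJ); split; first exact: iso_bij_from.
exact: bij_from_iso (ie_le HJ X) (ie_le HJ Y).
Qed.

(** For V in D^{<=c}, maps V → Om X are maps V[1] → X, and shifting V lowers its level by one; j <=
    c keeps V within the universal property of [Om]. *)
Lemma loop_from j X Y (f : mor X Y) : j <= c ->
  (inj_from (t_le t j) (fmap J (fmap Om f)) <-> inj_from (t_le t (j - 1)) (fmap J f)) /\
  (bij_from (t_le t j) (fmap J (fmap Om f)) <-> bij_from (t_le t (j - 1)) (fmap J f)).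
Proof.
move=> jc; have lec V : t_le t j V -> t_le t c V by exact: t_le_mono.
have hS V : t_le t j V -> t_le t (j - 1) (S V) by move=> h; apply/t_le_shE; rewrite subrK.
have hV V : t_le t (j - 1) V -> t_le t j (shV D V).
  by move=> /t_le_shVE; rewrite subrK.
have nat V X' Y' (f' : mor X' Y') (u : mor V (J (Om X'))) :
    fmap J f' ∘ (w X' ∘ fmap S u) = w Y' ∘ fmap S (fmap J (fmap Om f') ∘ u).
  by rewrite compA -(loop_nat Hw) -compA -fmapM.
have inj : inj_from (t_le t j) (fmap J (fmap Om f)) <-> inj_from (t_le t (j - 1)) (fmap J f).
  split=> h V hV0 u v e.
    have hV1 := hV _ hV0; apply: counit_epi.
    have [u' eu] := loop_factor Hw (u ∘ sh_counit V) (lec _ hV1).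
    have [v' ev] := loop_factor Hw (v ∘ sh_counit V) (lec _ hV1).
    rewrite -eu -ev; congr (_ ∘ fmap S _); apply: (h _ hV1).
    apply: (loop_inj Hw (lec _ hV1)); rewrite -!nat eu ev !compA e //.
  apply: (loop_inj Hw (lec _ hV0)); apply: (h _ (hS _ hV0)).
  by rewrite !nat e.
split=> //; split=> -[hi hs]; split; try exact/inj; move=> V hV0 u.
  have hV1 := hV _ hV0; have [ci [c1 c2]] := sh_counit_iso V.
  have [u' eu] := loop_factor Hw (u ∘ sh_counit V) (lec _ hV1).
  have [v' ev] := hs _ hV1 u'; exists (w X ∘ fmap S v' ∘ ci).
  by rewrite compA nat ev eu -compA c2 compm1.
have [v ev] := hs _ (hS _ hV0) (w Y ∘ fmap S u).
have [v' ev'] := loop_factor Hw v (lec _ hV0); exists v'.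
by apply: (loop_inj Hw (lec _ hV0)); rewrite -nat ev'.
Qed.

Lemma loop_iter_from i j X Y (f : mor X Y) : j <= c ->
  (inj_from (t_le t j) (fmap J (fmap (fiter i Om) f)) <->
     inj_from (t_le t (j - i%:Z)) (fmap J f)) /\
  (bij_from (t_le t j) (fmap J (fmap (fiter i Om) f)) <->
     bij_from (t_le t (j - i%:Z)) (fmap J f)).
Proof.
elim: i j => [|i IH] j jc; first by rewrite subr0.
have [h1 h2] := loop_from (fmap (fiter i Om) f) jc.
have [|h3 h4] := IH (j - 1); first by lia.
have -> : j - i.+1%:Z = j - 1 - i%:Z by lia.
by rewrite -h3 -h4.
Qed.

Lemma mono_loopP i X Y (f : mor X Y) :
  is_mono (fmap (fiter i Om) f) <-> inj_from (t_le t (c - i%:Z)) (fmap J f).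
Proof. by rewrite interval_monoP; exact: (loop_iter_from i f (lexx c)).1. Qed.

(** Invertibility of the i-th loop is bijectivity at level c-i, so the case i = 1 implies all
    others. *)
Lemma mono_iso_loopP X Y (f : mor X Y) :
  (is_mono f /\ forall i : nat, (1 <= i)%N -> is_iso (fmap (fiter i Om) f)) <->
  inj_from (t_le t c) (fmap J f) /\ bij_from (t_le t (c - 1)) (fmap J f).
Proof.
rewrite interval_monoP; split=> -[h1 h2]; split=> //.
  by have [_ <-] := loop_iter_from 1 f (lexx c); apply/interval_isoP; exact: h2.
move=> i hi; apply/interval_isoP; apply/(loop_iter_from i f (lexx c)).2.
by apply: bij_from_le_mono h2; lia.
Qed.

End Loops.

Section Suspensions.
Variables (k : comPzRingType) (D : triangulated k) (t : tstructure D) (a c : int).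
Variables (C : kcat k) (J : functor C D) (HJ : interval_embedding t a c J).
Variables (Si : functor C C) (v : forall X, mor (sh D (J X)) (J (Si X))).
Hypothesis Hv : suspension_unit t a v.

Lemma epi_suspensionP i X Y (f : mor X Y) :
  is_epi (fmap (fiter i Si) f) <-> inj_to (t_ge t (a + i%:Z)) (fmap J f).
Proof.
have := @mono_loopP _ _ _ _ _ _ _ (op_interval_embedding HJ) _ _ (op_loop_counit Hv) i Y X f.
by rewrite fiter_opfunctor t_le_op opprB opprK addrC.
Qed.

Lemma epi_iso_suspensionP X Y (f : mor X Y) :
  (is_epi f /\ forall i : nat, (1 <= i)%N -> is_iso (fmap (fiter i Si) f)) <->
  inj_to (t_ge t a) (fmap J f) /\ bij_to (t_ge t (a + 1)) (fmap J f).
Proof.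
have := @mono_iso_loopP _ _ _ _ _ _ _ (op_interval_embedding HJ) _ _ (op_loop_counit Hv) Y X f.
rewrite !t_le_op opprB !opprK addrC => <-.
split=> -[h1 h2]; split=> // i hi; have := h2 i hi; rewrite fiter_opfunctor => h.
  exact/op_iso.
exact: (proj1 (op_iso _) h).
Qed.

End Suspensions.

(** * Orthogonal factorizations *)

Section Factorization.
Variables (k : comPzRingType).

Lemma factorization_ext (C : kcat k) (PE PE' PM PM' : forall X Y : C, mor X Y -> Prop) :
  (forall X Y f, PE X Y f <-> PE' X Y f) -> (forall X Y f, PM X Y f <-> PM' X Y f) ->
  has_unique_factorization PE PM -> has_unique_factorization PE' PM'.
Proof.
move=> hE hM h X Y f; have [[Z [e [m [ef he hm]]]] hu] := h X Y f; split.
  by exists Z, e, m; split=> //; [exact/hE | exact/hM].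
move=> Z1 Z2 e1 m1 e2 m2 f1 /hE he1 /hM hm1 f2 /hE he2 /hM hm2.
exact: hu f1 he1 hm1 f2 he2 hm2.
Qed.

Lemma factorization_op (C : kcat k) (PE PM : forall X Y : C, mor X Y -> Prop) :
  @has_unique_factorization k (opcat C) (fun X Y f => PM Y X f) (fun X Y f => PE Y X f) ->
  has_unique_factorization PE PM.
Proof.
move=> h X Y f; have [[Z [m [e [ef hm he]]]] hu] := h Y X f; split; first by exists Z, e, m.
move=> Z1 Z2 e1 m1 e2 m2 f1 he1 hm1 f2 he2 hm2.
have [u [[u' [u1 u2]] h1 h2]] := hu Z2 Z1 m2 e2 m1 e1 f2 hm2 he2 f1 hm1 he1.
by exists u; split=> //; exists u'.
Qed.

Variables (D : triangulated k) (t : tstructure D) (a c : int).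
Variables (C : kcat k) (J : functor C D) (HJ : interval_embedding t a c J).

Lemma cone_le_to j (X Y Z : D) f g h : @dist _ D X Y Z f g h -> t_le t (j - 1) Z ->
  inj_to (t_ge t j) f /\ bij_to (t_ge t (j + 1)) f.
Proof.
move=> hd hZ; have inj : inj_to (t_ge t j) f.
  move=> W hW u v e; apply/eqP; rewrite -subr_eq0; apply/eqP.
  have [|x ->] := dist_coexact_l (u := u - v) hd; first by rewrite compBm e subrr.
  by rewrite (t_orth x hZ) ?comp0m // subrK.
split=> //; split; first by apply: inj_to_ge_mono inj; lia.
move=> W hW u; have [|x ex] := dist_coexact (u := fmap (sh D) u) (dist_rot hd).
  by apply: (t_orth _ hZ); rewrite subrK; exact/t_ge_shE.
have [x' ex'] := sh_full x; exists (- x'); apply: sh_inj.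
by rewrite ex -ex' compmN compNm shN fmapM.
Qed.

(* e is characterised by its cone lying in D^{<=a-1}, and m by its cone lying in
   D^{>=a}: truncating the cone of f produces the factorization. *)
Lemma interval_factorization : has_unique_factorization
  (fun X Y (e : @mor k C X Y) =>
     inj_to (t_ge t a) (fmap J e) /\ bij_to (t_ge t (a + 1)) (fmap J e))
  (fun X Y (m : @mor k C X Y) => inj_from (t_le t a) (fmap J m)).
Proof.
move=> X Y f; split.
  have [Z [i [p hd]]] := tr_cone (fmap J f).
  have [Z1 [Z2 [r [s [d [hZ h1 h2]]]]]] := trunc_triangle t (a - 1) Z; rewrite subrK in h2.
  (* M is the fibre of the map from Y to the upper truncation of Z; the octahedron makes the two
     truncations of Z the cones of [e] and [m]. *)
  have [M [m [d' hM]]] := fibre_ex (s ∘ i).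
  have [u [e [heu [_ me _ _]]]] := tr_oct_fibre hZ hd hM.
  have hMge : t_ge t a M.
    rewrite -(subrK 1 a); apply: (t_ge_fibre hM); rewrite ?subrK; first exact: ie_ge HJ Y.
    by apply: t_ge_mono h2; lia.
  have hMle : t_le t c M.
    apply: (t_le_ext heu (ie_le HJ X)); apply: t_le_mono h1; have := ie_ac HJ; lia.
  have [Q [x [y [yx xy]]]] := ie_ess HJ hMle hMge.
  have [e' ee'] := ie_full HJ (y ∘ e); have [m' em'] := ie_full HJ (m ∘ x).
  exists Q, e', m'; split.
  - apply: (ie_inj HJ); rewrite fmapM ee' em' -me -!compA (compA x) xy comp1m //.
  - have [e1 e2] := cone_le_to heu h1.
    have iy : is_iso y by exists x.
    rewrite ee'; split; last by apply: bij_to_comp => //; exact: iso_bij_to.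
    exact: (@inj_from_comp k (opcat D) _ _ _ _ _ _ e1 (proj1 (iso_bij_to _ iy))).
  have [m1 _] := cone_ge_inj hM h2.
  rewrite em'; apply: inj_from_comp => //; have ix : is_iso x by exists y.
  exact: (proj1 (iso_bij_from _ ix)).
(* Orthogonality: the fibre of e lies in D^{<=a}, where m' is injective, so e' vanishes on it and
   factors through e. *)
have lift Z Z' (e : mor X Z) (m : mor Z Y) (e' : mor X Z') (m' : mor Z' Y) :
    f = m ∘ e -> inj_to (t_ge t a) (fmap J e) /\ bij_to (t_ge t (a + 1)) (fmap J e) ->
    f = m' ∘ e' -> inj_from (t_le t a) (fmap J m') ->
    exists u : mor Z Z', u ∘ e = e' /\ m' ∘ u = m.
  move=> f1 [hi [_ hs]] f2 hm'; have [F [p [d hd]]] := fibre_ex (fmap J e).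
  have hF := inj_fibre_le hd hi hs.
  have [|u eu] := dist_coexact_l (u := fmap J e') hd.
    apply: (hm' _ hF); rewrite compm0 compA -fmapM -f2 f1 fmapM -compA.
    by rewrite (dist_comp0 hd) compm0.
  have [u' eu'] := ie_full HJ u; exists u'.
  have ue : u' ∘ e = e' by apply: (ie_inj HJ); rewrite fmapM eu' eu.
  split=> //; apply: (ie_inj HJ); apply: (hi _ (ie_ge HJ Y)).
  by rewrite -!fmapM -compA ue -f1 -f2.
have inj Z Z' (e : mor X Z) (u u' : mor Z Z') :
    inj_to (t_ge t a) (fmap J e) -> u ∘ e = u' ∘ e -> u = u'.
  move=> he eu; apply: (ie_inj HJ); apply: (he _ (ie_ge HJ _)).
  by rewrite -!fmapM eu.
move=> Z Z' e m e' m' f1 he hm f2 he' hm'.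
have [u [u1 u2]] := lift _ _ _ _ _ _ f1 he f2 hm'.
have [v [v1 v2]] := lift _ _ _ _ _ _ f2 he' f1 hm.
exists u; split=> //; exists v; split.
  by apply: (inj _ _ _ _ _ he.1); rewrite -compA u1 v1 comp1m.
by apply: (inj _ _ _ _ _ he'.1); rewrite -compA v1 u1 comp1m.
Qed.

End Factorization.

Lemma interval_factorization_op (k : comPzRingType) (D : triangulated k) (t : tstructure D)
    (a c : int) (C : kcat k) (J : functor C D) (HJ : interval_embedding t a c J) :
  has_unique_factorization
    (fun X Y (e : @mor k C X Y) => inj_to (t_ge t c) (fmap J e))
    (fun X Y (m : @mor k C X Y) =>
       inj_from (t_le t c) (fmap J m) /\ bij_from (t_le t (c - 1)) (fmap J m)).
Proof.
apply: factorization_op; have := interval_factorization (op_interval_embedding HJ).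
by rewrite !t_ge_op t_le_op opprD !opprK.
Qed.

(** * Cohomology *)

Section Unique.
Variables (k : comPzRingType) (C : kcat k).

Lemma coreflection_unique (P : C -> Prop) (X Y Y' : C) (f : mor Y X) (f' : mor Y' X) :
  coreflection P f -> coreflection P f' -> exists u : mor Y Y', is_iso u /\ f' ∘ u = f.
Proof.
move=> [hY fb] [hY' fb']; have [u eu] := fb'.2 _ hY f; exists u; split=> //.
apply: (bij_from_iso hY hY'); apply: (bij_from_cancel fb'.1); by rewrite eu.
Qed.

End Unique.

Lemma reflection_unique (k : comPzRingType) (C : kcat k) (P : C -> Prop)
    (X Y Y' : C) (f : mor X Y) (f' : mor X Y') :
  reflection P f -> reflection P f' -> exists u : mor Y' Y, is_iso u /\ u ∘ f' = f.
Proof.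
move=> h h'; have [u [hu eu]] := @coreflection_unique k (opcat C) P X Y Y' f f' h h'.
by exists u; split=> //; exact/op_iso.
Qed.

(* H is the zeroth cohomology of X, computed both as tau_{<=0} tau_{>=0} X and as
   tau_{>=0} tau_{<=0} X; this makes the notion self-dual. *)
Definition heart_square (k : comPzRingType) (D : triangulated k) (t : tstructure D)
    (X H X1 X2 : D) (i : mor X1 X) (p : mor X X2) (q : mor X1 H) (j : mor H X2) : Prop :=
  [/\ coreflection (t_le t 0) i, reflection (t_ge t 0) p, reflection (t_ge t 0) q,
      coreflection (t_le t 0) j & p ∘ i = j ∘ q].

(* A self-dual description of h as the map induced by e on zeroth cohomology. *)
Definition heart_map (k : comPzRingType) (D : triangulated k) (t : tstructure D)
    (X Y HX HY : D) (e : mor X Y) (h : mor HX HY) : Prop :=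
  exists (X1 X2 Y1 Y2 : D) (i : mor X1 X) (p : mor X X2) (q : mor X1 HX) (j : mor HX X2)
    (i' : mor Y1 Y) (p' : mor Y Y2) (q' : mor Y1 HY) (j' : mor HY Y2),
    [/\ heart_square t i p q j, heart_square t i' p' q' j' & j' ∘ h ∘ q = p' ∘ e ∘ i].

Section HeartSquare.
Variables (k : comPzRingType) (D : triangulated k) (t : tstructure D).
Implicit Types A B X Y Z V W H : D.
Notation S := (sh D).

Lemma op_heart_map X Y HX HY (e : mor X Y) (h : mor HX HY) :
  heart_map t e h -> @heart_map k (optri D) (opts t) Y X HY HX e h.
Proof.
move=> [X1 [X2 [Y1 [Y2 [i [p [q [j [i' [p' [q' [j' [hs hs' eh]]]]]]]]]]]]].
exists Y2, Y1, X2, X1, p', i', j', q', p, i, j, q; split; last first.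
- by rewrite /= compA eh compA.
- by case: hs => h1 h2 h3 h4 e1; split; rewrite ?t_le_op ?t_ge_op ?oppr0 //=.
by case: hs' => h1 h2 h3 h4 e1; split; rewrite ?t_le_op ?t_ge_op ?oppr0 //=.
Qed.

(** Octahedron for τ_{<=-1}X → τ_{<=0}X → X: the cone of the first map is both the reflection of
    τ_{<=0}X into D^{>=0} and the coreflection of τ_{>=0}X into D^{<=0}. *)
Lemma heart_square_ex X X2 H (p : mor X X2) (j : mor H X2) :
  reflection (t_ge t 0) p -> coreflection (t_le t 0) j ->
  exists (X1 : D) (i : mor X1 X) (q : mor X1 H), heart_square t i p q j.
Proof.
move=> hp hj.
have [X1 [R [i [r [d [hX1 h1 hR]]]]]] := trunc_triangle t 0 X.
have [F [X2' [f [p' [d' [hF hF' hX2']]]]]] := trunc_triangle t (-1) X.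
have hi := trunc_coreflection hX1 h1 hR.
have hp' := trunc_reflection hF hF' hX2'; rewrite addNr in hX2' hp'.
have hF0 : t_le t 0 F by apply: t_le_mono hF'.
have [f1 ef1] := hi.2.2 F hF0 f.
have [H' [q [d1 hq]]] := tr_cone f1.
rewrite -ef1 in hF; have [j' [s [hjs [e1 _ _ _]]]] := tr_oct hq hX1 hF.
have hH' : t_le t 0 H' by apply: (t_le_cone hq _ h1); apply: t_le_mono hF'.
have hj' := trunc_coreflection hjs hH' hR.
have [x [ix ex]] := reflection_unique hp hp'.
have [|y [iy ey]] := @coreflection_unique _ _ (t_le t 0) _ _ _ (x ∘ j') _ _ hj.
  by split=> //; apply: bij_from_comp hj'.2; exact: iso_bij_from.
exists X1, i, (y ∘ q); split=> //; last by rewrite compA ey -compA e1 compA ex.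
have hH : t_ge t 0 H.
  apply/t_ge_perp => V hV u; have hV0 : t_le t 0 V by apply: t_le_mono hV.
  apply: (hj.2.1 _ hV0); rewrite compm0; apply: (t_orth _ hV).
  by rewrite subrK; exact: hp.1.
split=> //; apply: bij_to_comp; first exact: iso_bij_to.
by have [_] := fibre_le_inj hq hF'; rewrite addNr.
Qed.

Lemma coreflection_map m X Y X1 Y1 (i : mor X1 X) (i' : mor Y1 Y) (e : mor X Y) :
  coreflection (t_le t m) i -> coreflection (t_le t m) i' ->
  exists e1, i' ∘ e1 = e ∘ i.
Proof. by move=> [hX1 _] [_ [_ hs]]; exact: hs. Qed.

Lemma reflection_map m X Y X2 Y2 (p : mor X X2) (p' : mor Y Y2) (e : mor X Y) :
  reflection (t_ge t m) p -> reflection (t_ge t m) p' ->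
  exists e2, e2 ∘ p = p' ∘ e.
Proof. by move=> [_ [_ hs]] [hY2 _]; exact: hs. Qed.

Lemma reflection_triangle m X X2 (p : mor X X2) : reflection (t_ge t (m + 1)) p ->
  exists (F : D) (f : mor F X) (d : mor X2 (S F)), dist f p d /\ t_le t m F.
Proof.
move=> hp; have [F [X2' [f [p' [d [hd hF hX2']]]]]] := trunc_triangle t m X.
have [x [[x' [x1 x2]] ex]] := reflection_unique hp (trunc_reflection hd hF hX2').
exists F, f, (d ∘ x'); split=> //; have ix : is_iso x by exists x'.
apply: (dist_iso2 (iso_id _) ix hd); first by rewrite comp1m.
  by rewrite compm1 ex.
by rewrite -compA x1 compm1.
Qed.

(** A map from V in D^{<=0} to X2 lifts to H and, as H lies in D^{>=0}, factors through τ_{>=0}V,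
    which belongs to the heart. *)
Lemma heart_inj_fromP H H' X2 Y2 (j : mor H X2) (j' : mor H' Y2) (e2 : mor X2 Y2) h :
  coreflection (t_le t 0) j -> coreflection (t_le t 0) j' -> t_ge t 0 X2 -> t_ge t 0 Y2 ->
  j' ∘ h = e2 ∘ j -> inj_from (t_heart t) h <-> inj_from (t_le t 0) e2.
Proof.
move=> [hH [ji js]] [hH' [ji' js']] hX2 hY2 eh.
have ge0 A X' (i : mor A X') : coreflection (t_le t 0) i -> t_ge t 0 X' -> t_ge t 0 A.
  move=> [_ [ii _]] hX'; apply/t_ge_perp => V hV u.
  have hV0 : t_le t 0 V by apply: t_le_mono hV.
  apply: (ii _ hV0); rewrite compm0; apply: (t_orth _ hV).
  by rewrite subrK.
split=> hi; last first.
  move=> K [hK _] u v e; apply: (ji _ hK); apply: (hi _ hK).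
  by rewrite !compA -eh -!compA e.
apply: inj_from0 => V hV u e.
have [F [V' [f [p [d [hd hF hV']]]]]] := trunc_triangle t (-1) V.
have [_ [pi ps]] := trunc_reflection hd hF hV'; rewrite addNr in hV' pi ps.
have hK : t_heart t V' by split=> //; apply: (t_le_cone hd _ hV); apply: t_le_mono hF.
have [u1 eu1] := js _ hV u; have [u2 eu2] := ps _ (ge0 _ _ _ (conj hH (conj ji js)) hX2) u1.
suff u20 : u2 = 0 by rewrite -eu1 -eu2 u20 comp0m compm0.
apply: (hi _ hK); rewrite compm0; apply: (pi _ (ge0 _ _ _ (conj hH' (conj ji' js')) hY2)).
apply: (ji' _ hV); rewrite comp0m compm0 !compA eh -!compA eu2 eu1 //.
Qed.

(* X2 and Y2 differ from X and Y by objects of D^{<=-1}, on which e is invertible. *)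
Lemma inj_from_reflection X Y X2 Y2 (p : mor X X2) (p' : mor Y Y2) (e : mor X Y) e2 :
  reflection (t_ge t 0) p -> reflection (t_ge t 0) p' -> e2 ∘ p = p' ∘ e ->
  bij_from (t_le t (-1)) e -> inj_from (t_le t 0) e <-> inj_from (t_le t 0) e2.
Proof.
rewrite -{1 2}(addNr 1) => hp hp' ee he.
have [F [f [d [hd hF]]]] := reflection_triangle hp.
have [F' [f' [d' [hd' hF']]]] := reflection_triangle hp'.
have [e0 [e01 e02]] := tr_mor1 hd hd' ee; rewrite addNr in hp hp'.
have hb (A B Z : D) (g : mor A B) g1 g2 : @dist _ D A B Z g g1 g2 -> t_ge t 0 Z ->
    bij_from (t_le t (-1)) g.
  by move=> hg hZ; have [_] := cone_ge_inj hg hZ; rewrite sub0r.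
have bf := hb _ _ _ _ _ _ hd hp.1; have bf' := hb _ _ _ _ _ _ hd' hp'.1.
have [e0' [e0'1 e0'2]] : is_iso e0.
  apply: (bij_from_iso hF hF'); apply: (bij_from_cancel bf'.1).
  by rewrite -e01; exact: bij_from_comp.
have shift V (hV : t_le t 0 V) Z (u : mor (S V) Z) : t_ge t 0 Z -> u = 0.
  by move=> hZ; apply: (@t_orth _ _ t (-1) _ _ u); [exact/t_le_shE | rewrite addNr].
split=> hi; apply: inj_from0 => V hV u eu.
  have [|x ex] := dist_exact_r (u := u) hd.
    rewrite -[_ ∘ u]comp1m -(fmap1 S) -e0'1 fmapM -compA (compA (fmap S e0)) e02.
    by rewrite -!compA eu !compm0.
  have [|y ey] := dist_exact (u := e ∘ x) hd'; first by rewrite compA -ee -compA -ex.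
  have xf : x = f ∘ (e0' ∘ y).
    by apply: (hi _ hV); rewrite ey !compA e01 -(compA f') e0'2 compm1.
  by rewrite ex xf compA (dist_comp0 hd) comp0m.
have [|y ey] := dist_exact (u := u) hd.
  by apply: (hi _ hV); rewrite compA ee -compA eu !compm0.
have [|z ez] := dist_exact_s (u := fmap S (e0 ∘ y)) hd'.
  by rewrite -fmapM compA -e01 -compA -ey eu sh0.
have y0 : y = 0.
  rewrite -[y]comp1m -e0'1 -compA; apply: sh_inj; rewrite fmapM ez.
  by rewrite (shift V hV _ z hp'.1) !compm0 sh0.
by rewrite ey y0 compm0.
Qed.

Variables (X Y HX HY : D) (e : mor X Y) (h : mor HX HY).
Hypothesis Hh : heart_map t e h.

Lemma heart_mono_inj_from : bij_from (t_le t (-1)) e ->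
  inj_from (t_heart t) h <-> inj_from (t_le t 0) e.
Proof.
move=> he.
have [X1 [X2 [Y1 [Y2 [i [p [q [j [i' [p' [q' [j' [hs hs' eh]]]]]]]]]]]]] := Hh.
have [hi hp hq hj e1] := hs; have [hi' hp' hq' hj' e1'] := hs'.
have [e2 ee2] := reflection_map e hp hp'.
rewrite (inj_from_reflection hp hp' ee2 he).
apply: (heart_inj_fromP hj hj' hp.1 hp'.1).
apply: (hq.2.1 _ hp'.1); by rewrite eh -ee2 -!compA e1.
Qed.

Lemma heart_iso_bij_from : bij_from (t_le t 0) e -> is_iso h.
Proof.
move=> he.
have [X1 [X2 [Y1 [Y2 [i [p [q [j [i' [p' [q' [j' [hs hs' eh]]]]]]]]]]]]] := Hh.
have [hi hp hq hj e1] := hs; have [hi' hp' hq' hj' e1'] := hs'.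
have [x ex] := coreflection_map e hi hi'.
have ix : is_iso x.
  apply: (bij_from_iso hi.1 hi'.1); apply: (bij_from_cancel hi'.2.1); rewrite ex.
  exact: bij_from_comp he hi.2.
have hqx : h ∘ q = q' ∘ x.
  apply: (hj'.2.1 _ hi.1); rewrite !compA eh -e1' -!compA ex !compA //.
apply: (bij_to_iso hq.1 hq'.1).
apply: (@bij_from_cancel k (opcat D) _ _ _ _ q h hq.2.1); rewrite /= hqx.
exact: (bij_to_comp hq'.2 (iso_bij_to _ ix)).
Qed.

End HeartSquare.

Section HeartMaps.
Variables (k : comPzRingType) (D : triangulated k) (t : tstructure D).
Variables (X Y HX HY : D) (e : mor X Y) (h : mor HX HY).
Hypothesis Hh : heart_map t e h.

Lemma t_heart_op : t_heart (opts t) = t_heart t :> (D -> Prop).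
Proof.
apply/funext => V; apply/propext; rewrite /t_heart t_le_op t_ge_op oppr0.
by split=> -[].
Qed.

Lemma heart_epi_inj_to : bij_to (t_ge t 1) e ->
  inj_to (t_heart t) h <-> inj_to (t_ge t 0) e.
Proof.
have := heart_mono_inj_from (op_heart_map Hh).
by rewrite !t_le_op oppr0 opprK t_heart_op.
Qed.

Lemma heart_iso_bij_to : bij_to (t_ge t 0) e -> is_iso h.
Proof.
have := heart_iso_bij_from (op_heart_map Hh); rewrite t_le_op oppr0 => he /he.
by move=> /op_iso.
Qed.

(** Let Z be the cone of the map x induced on τ_{<=0}. The first two hypotheses place Z in D^{>=0},
    the epimorphism on H^0 places it in D^{<=-1}; thus Z = 0 and x is invertible. *)
Lemma heart_epi_bij_from : inj_from (t_le t 0) e -> bij_from (t_le t (-1)) e ->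
  inj_to (t_heart t) h -> bij_from (t_le t 0) e.
Proof.
move=> ei eb hh.
have [X1 [X2 [Y1 [Y2 [i [p [q [j [i' [p' [q' [j' [hs hs' eh]]]]]]]]]]]]] := Hh.
have [hi hp hq hj e1] := hs; have [hi' hp' hq' hj' e1'] := hs'.
have [x ex] := coreflection_map e hi hi'.
have hqx : h ∘ q = q' ∘ x.
  by apply: (hj'.2.1 _ hi.1); rewrite !compA eh -e1' -!compA ex !compA.
have xi : inj_to (t_ge t 0) x.
  have := @heart_inj_fromP k (optri D) (opts t) HY HX Y1 X1 q' q x h.
  rewrite !t_le_op t_ge_op t_heart_op oppr0.
  by move=> /(_ hq' hq hi'.1 hi.1 hqx)[+ _]; exact.
have [Z [g [d hd]]] := tr_cone x.
have hZ0 : t_ge t 0 Z.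
  apply: (inj_cone_ge hd).
    by apply: (@inj_from_cancel _ _ _ _ _ _ i'); rewrite ex; exact: inj_from_comp ei hi.2.1.
  have le1 (V : D) : t_le t (0 - 1) V -> t_le t 0 V by apply: t_le_mono.
  have bi (A B : D) (l : mor A B) : bij_from (t_le t 0) l -> bij_from (t_le t (0 - 1)) l.
    by apply: bij_from_le_mono.
  suff [] : bij_from (t_le t (0 - 1)) x by [].
  apply: (bij_from_cancel (bi _ _ _ hi'.2).1); rewrite ex.
  by apply: bij_from_comp; [rewrite sub0r | exact: bi hi.2].
have hZ1 : t_le t (-1) Z.
  apply/t_le_perp; rewrite addNr => W hW u.
  have [|v ->] := dist_coexact (u := u) hd.
    apply: (xi _ hW); rewrite -compA (dist_comp0 hd) compm0 comp0m //.
  have hSX : t_le t (-1) (sh D X1) by apply/t_le_shE; rewrite addNr; exact: hi.1.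
  by rewrite (t_orth v hSX) ?addNr // comp0m.
have ix : is_iso x.
  by apply: (dist_zero_iso hd); apply: (t_zero hZ1); rewrite addNr.
apply: bij_from_cancelr hi.2 _; rewrite -ex.
by apply: bij_from_comp hi'.2 _; exact: iso_bij_from.
Qed.

End HeartMaps.

Lemma heart_mono_bij_to (k : comPzRingType) (D : triangulated k) (t : tstructure D)
    (X Y HX HY : D) (e : mor X Y) (h : mor HX HY) : heart_map t e h ->
  inj_to (t_ge t 0) e -> bij_to (t_ge t 1) e -> inj_from (t_heart t) h ->
  bij_to (t_ge t 0) e.
Proof.
move=> Hh; have := heart_epi_bij_from (op_heart_map Hh).
by rewrite !t_le_op oppr0 opprK t_heart_op.
Qed.

Section Cohomology.
Variables (k : comPzRingType) (D : triangulated k) (t : tstructure D) (T : truncation t).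

Definition coh (i : int) (X Y : D) (e : mor X Y) :=
  fmap (tau_le T 0) (fmap (tau_ge T 0) (fmap (shz D i) e)).

Lemma coh_heart_map i X Y (e : mor X Y) : heart_map t (fmap (shz D i) e) (coh i e).
Proof.
have sq (Z : D) := heart_square_ex (tau_ge_reflection T 0 Z)
  (tau_le_coreflection T 0 (tau_ge T 0 Z)).
have [X1 [i1 [q hX]]] := sq (shz D i X); have [Y1 [i1' [q' hY]]] := sq (shz D i Y).
do 4! eexists; exists i1; eexists; exists q; eexists; exists i1'; eexists; exists q'; eexists.
split; [exact: hX | exact: hY |].
case: hX => _ _ _ _ e1.
by rewrite /coh tau_le_nat -compA -e1 compA tau_ge_nat.
Qed.

Lemma coh_mono_inj_from i X Y (e : mor X Y) : bij_from (t_le t (i - 1)) e ->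
  inj_from (t_heart t) (coh i e) <-> inj_from (t_le t i) e.
Proof.
have [+ _] := from_le_shz t i 0 e; have [_] := from_le_shz t i (-1) e.
rewrite addrC add0r => <- <-; exact: heart_mono_inj_from (coh_heart_map i e).
Qed.

Lemma coh_iso_bij_from i X Y (e : mor X Y) : bij_from (t_le t i) e -> is_iso (coh i e).
Proof.
have [_] := from_le_shz t i 0 e; rewrite add0r => <-.
exact: heart_iso_bij_from (coh_heart_map i e).
Qed.

Lemma bij_from_coh_iso i X Y (e : mor X Y) : bij_from (t_le t (i - 1)) e ->
  is_iso (coh i e) -> bij_from (t_le t i) e.
Proof.
move=> he hi; have := (coh_mono_inj_from he).1 (proj1 (iso_bij_from _ hi)); move: he.
have [] := from_le_shz t i 0 e; have [_] := from_le_shz t i (-1) e.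
rewrite addrC add0r => <- <- <- hb hinj.
exact: (heart_epi_bij_from (coh_heart_map i e) hinj hb (proj1 (iso_bij_to _ hi))).
Qed.

Lemma coh_epi_inj_to i X Y (e : mor X Y) : bij_to (t_ge t (i + 1)) e ->
  inj_to (t_heart t) (coh i e) <-> inj_to (t_ge t i) e.
Proof.
have [+ _] := to_ge_shz t i 0 e; have [_] := to_ge_shz t i 1 e.
rewrite addrC add0r => <- <-; exact: heart_epi_inj_to (coh_heart_map i e).
Qed.

Lemma coh_iso_bij_to i X Y (e : mor X Y) : bij_to (t_ge t i) e -> is_iso (coh i e).
Proof.
have [_] := to_ge_shz t i 0 e; rewrite add0r => <-.
exact: heart_iso_bij_to (coh_heart_map i e).
Qed.

Lemma bij_to_coh_iso i X Y (e : mor X Y) : bij_to (t_ge t (i + 1)) e ->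
  is_iso (coh i e) -> bij_to (t_ge t i) e.
Proof.
move=> he hi; have := (coh_epi_inj_to he).1 (proj1 (iso_bij_to _ hi)); move: he.
have [] := to_ge_shz t i 0 e; have [_] := to_ge_shz t i 1 e.
rewrite addrC add0r => <- <- <- hb hinj.
exact: (heart_mono_bij_to (coh_heart_map i e) hinj hb (proj1 (iso_bij_from _ hi))).
Qed.

(** At level a-1 there are no nonzero maps into X or Y, so bijectivity is automatic; each
    isomorphism H^i(e) then raises the level by one, up to c-1. *)
Lemma coh_fromP a c X Y (e : mor X Y) : a <= c -> t_ge t a X -> t_ge t a Y ->
  (inj_from (t_heart t) (coh c e) /\ forall i, i <= c - 1 -> is_iso (coh i e)) <->
  inj_from (t_le t c) e /\ bij_from (t_le t (c - 1)) e.
Proof.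
move=> ac hX hY; split=> [[hm hi]|[hm hb]]; last first.
  split=> [|i ic]; first exact/coh_mono_inj_from.
  by apply: coh_iso_bij_from; exact: bij_from_le_mono ic hb.
suff hb : bij_from (t_le t (c - 1)) e by split=> //; exact/coh_mono_inj_from.
have base : bij_from (t_le t (a - 1)) e.
  rewrite -(subrK 1 a) in hX hY; split=> V hV u.
    by move=> v _; rewrite (t_orth u hV hX) (t_orth v hV hX).
  by exists 0; rewrite compm0 (t_orth u hV hY).
have up (m : nat) : a - 1 + m%:Z <= c - 1 -> bij_from (t_le t (a - 1 + m%:Z)) e.
  elim: m => [|m IH] hm'; first by rewrite addr0.
  apply: bij_from_coh_iso; last exact: hi.
  have -> : a - 1 + m.+1%:Z - 1 = a - 1 + m%:Z by lia.
  by apply: IH; lia.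
have -> : c - 1 = a - 1 + `|c - a|%N%:Z by lia.
by apply: up; lia.
Qed.

(** The induction runs downwards from level c+1, above which X and Y have no nonzero maps out. *)
Lemma coh_toP a c X Y (e : mor X Y) : a <= c -> t_le t c X -> t_le t c Y ->
  (inj_to (t_heart t) (coh a e) /\ forall i, a + 1 <= i -> is_iso (coh i e)) <->
  inj_to (t_ge t a) e /\ bij_to (t_ge t (a + 1)) e.
Proof.
move=> ac hX hY; split=> [[hm hi]|[hm hb]]; last first.
  split=> [|i ic]; first exact/coh_epi_inj_to.
  by apply: coh_iso_bij_to; exact: bij_to_ge_mono ic hb.
suff hb : bij_to (t_ge t (a + 1)) e by split=> //; exact/coh_epi_inj_to.
have base : bij_to (t_ge t (c + 1)) e.
  split=> V hV u; first by move=> v _; rewrite (t_orth u hY hV) (t_orth v hY hV).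
  by exists 0; rewrite comp0m (t_orth u hX hV).
have down (m : nat) : a + 1 <= c + 1 - m%:Z -> bij_to (t_ge t (c + 1 - m%:Z)) e.
  elim: m => [|m IH] hm'; first by rewrite subr0.
  apply: bij_to_coh_iso; last exact: hi.
  have -> : c + 1 - m.+1%:Z + 1 = c + 1 - m%:Z by lia.
  by apply: IH; lia.
have -> : a + 1 = c + 1 - `|c - a|%N%:Z by lia.
by apply: down; lia.
Qed.

Lemma heart_monoP (X Y : heart t) (f : mor X Y) :
  is_mono f <-> inj_from (t_heart t) (f : @mor k D X Y).
Proof.
split=> hf; last by move=> W u v; exact: (hf _ (fs_valP W)).
by move=> V hV u v; exact: (hf (FullsubOb hV)).
Qed.

Lemma heart_epiP (X Y : heart t) (f : mor X Y) :
  is_epi f <-> inj_to (t_heart t) (f : @mor k D X Y).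
Proof.
split=> hf; last by move=> W u v; exact: (hf _ (fs_valP W)).
by move=> V hV u v; exact: (hf (FullsubOb hV)).
Qed.

End Cohomology.

(** * The conditions of the theorem as Hom tests *)

Section Characterizations.
Variables (k : comPzRingType) (D : triangulated k) (t : tstructure D) (T : truncation t).
Variables (n : nat) (hn : (0 < n)%N).
Notation C := (ext_heart t n).
Notation J := (fincl (t_range t n)).
Notation b := (- n%:Z + 1).

Let HJ := ext_heart_embedding t hn.

Let bn : b + n.-1%:Z = 0.
Proof. lia. Qed.

Lemma Hext_iso i (X Y : C) (f : mor X Y) :
  is_iso (fmap (Hext T n i) f) <-> is_iso (coh T i (fmap J f)).
Proof. by split=> -[g hg]; exists g. Qed.

(** Maps from D^{<=-n} into X and Y vanish, which supplies the bijectivity one level below. *)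
Lemma Hext_monoP (X Y : C) (f : mor X Y) :
  is_mono (fmap (Hext T n b) f) <-> inj_from (t_le t b) (fmap J f).
Proof.
rewrite heart_monoP; apply: (@coh_mono_inj_from k D t T); split=> V hV u.
  have hX : t_ge t (b - 1 + 1) (J X) by rewrite subrK; exact: ie_ge HJ X.
  by move=> v _; rewrite (t_orth u hV hX) (t_orth v hV hX).
have hY : t_ge t (b - 1 + 1) (J Y) by rewrite subrK; exact: ie_ge HJ Y.
by exists 0; rewrite compm0 (t_orth u hV hY).
Qed.

Lemma Hext_epiP (X Y : C) (f : mor X Y) :
  is_epi (fmap (Hext T n 0) f) <-> inj_to (t_ge t 0) (fmap J f).
Proof.
rewrite heart_epiP; apply: (@coh_epi_inj_to k D t T); split=> V hV u.
  by move=> v _; rewrite (t_orth u (ie_le HJ Y) hV) (t_orth v (ie_le HJ Y) hV).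
by exists 0; rewrite comp0m (t_orth u (ie_le HJ X) hV).
Qed.

(** The n-1 loops lower the level of the test from 0 to -n+1. *)
Lemma Omega_monoP (X Y : C) (f : mor X Y) :
  is_mono (fmap (fiter n.-1 (Omega T n)) f) <-> inj_from (t_le t b) (fmap J f).
Proof.
have := mono_loopP HJ (Omega_loop_counit T n) n.-1 f.
by have -> : 0 - n.-1%:Z = b by lia.
Qed.

Lemma Sigma_epiP (X Y : C) (f : mor X Y) :
  is_epi (fmap (fiter n.-1 (Sigma T n)) f) <-> inj_to (t_ge t 0) (fmap J f).
Proof. by have := epi_suspensionP HJ (Sigma_suspension_unit T n) n.-1 f; rewrite bn. Qed.

Lemma Hext_epi_isoP (X Y : C) (e : mor X Y) :
  (is_epi (fmap (Hext T n b) e) /\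
     forall i : int, - n%:Z + 2 <= i -> is_iso (fmap (Hext T n i) e)) <->
  inj_to (t_ge t b) (fmap J e) /\ bij_to (t_ge t (b + 1)) (fmap J e).
Proof.
rewrite -(coh_toP T _ (ie_ac HJ) (ie_le HJ X) (ie_le HJ Y)) heart_epiP.
have -> : - n%:Z + 2 = b + 1 by lia.
by split=> -[h1 h2]; split=> // i /h2; rewrite Hext_iso.
Qed.

Lemma Hext_mono_isoP (X Y : C) (m : mor X Y) :
  (is_mono (fmap (Hext T n 0) m) /\
     forall i : int, i <= -1 -> is_iso (fmap (Hext T n i) m)) <->
  inj_from (t_le t 0) (fmap J m) /\ bij_from (t_le t (0 - 1)) (fmap J m).
Proof.
rewrite -(coh_fromP T _ (ie_ac HJ) (ie_ge HJ X) (ie_ge HJ Y)) heart_monoP sub0r.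
by split=> -[h1 h2]; split=> // i /h2; rewrite Hext_iso.
Qed.

End Characterizations.

Theorem theorem4 (k : comPzRingType) (D : triangulated k) (hD : algebraic D)
    (t : tstructure D) (T : truncation t) (n : nat) (hn : (0 < n)%N) :
  let C := ext_heart t n in
  let H := fun i : int => Hext T n i in
  let Om : functor C C := Omega T n in
  let Si : functor C C := Sigma T n in
  let b : int := - n%:Z + 1 in
  (* (i) *)
  (exists Phi : adjunction Si Om,
    pretriangulated Phi (@Delta k D t T n) (@Nabla k D t T n))
  /\
  (* (ii) *)
  (exists s : realization (ext_bifunctor t n),
    [/\ extriangulated s,
        forall (A B X : C) (f : mor A B) (g : mor B X)
            (d : bf_ob (ext_bifunctor t n) X A),
          s A B X d f g <->
          dist (fmap (fincl (t_range t n)) f) (fmap (fincl (t_range t n)) g) d,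
        forall (X Y : C) (f : mor X Y),
          (inflation s f <-> is_mono (fmap (H b) f)) /\
          (inflation s f <-> is_mono (fmap (fiter n.-1 Om) f)) &
        forall (X Y : C) (f : mor X Y),
          (deflation s f <-> is_epi (fmap (H 0) f)) /\
          (deflation s f <-> is_epi (fmap (fiter n.-1 Si) f))])
  /\
  (* (iii) *)
  [/\ forall (X Y : C) (m : mor X Y),
        is_mono (fmap (H b) m) <-> is_mono (fmap (fiter n.-1 Om) m),
      forall (X Y : C) (e : mor X Y),
        (is_epi (fmap (H b) e) /\
         forall i : int, - n%:Z + 2 <= i -> is_iso (fmap (H i) e)) <->
        (is_epi e /\
         forall i : nat, (1 <= i)%N -> is_iso (fmap (fiter i Si) e)) &
      has_unique_factorization
        (fun (X Y : C) (e : mor X Y) =>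
           is_epi (fmap (H b) e) /\
           forall i : int, - n%:Z + 2 <= i -> is_iso (fmap (H i) e))
        (fun (X Y : C) (m : mor X Y) => is_mono (fmap (H b) m))]
  /\
  (* (iii)' *)
  [/\ forall (X Y : C) (e : mor X Y),
        is_epi (fmap (H 0) e) <-> is_epi (fmap (fiter n.-1 Si) e),
      forall (X Y : C) (m : mor X Y),
        (is_mono (fmap (H 0) m) /\
         forall i : int, i <= -1 -> is_iso (fmap (H i) m)) <->
        (is_mono m /\
         forall i : nat, (1 <= i)%N -> is_iso (fmap (fiter i Om) m)) &
      has_unique_factorization
        (fun (X Y : C) (e : mor X Y) => is_epi (fmap (H 0) e))
        (fun (X Y : C) (m : mor X Y) =>
           is_mono (fmap (H 0) m) /\
           forall i : int, i <= -1 -> is_iso (fmap (H i) m))].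
Proof.
move=> C H Om Si b; have HJ := ext_heart_embedding t hn.
split; first exact: ext_heart_pretriangulated.
split.
  exists (@ext_realization k D t n); split=> [|||X Y f]; first exact: ext_heart_extriangulated.
  - by [].
  - by move=> X Y f; rewrite inflationP (Hext_monoP T hn) (Omega_monoP T hn).
  by rewrite deflationP // (Hext_epiP T hn) (Sigma_epiP T hn).
split; split.
- by move=> X Y m; rewrite (Hext_monoP T hn) (Omega_monoP T hn).
- move=> X Y e; rewrite (Hext_epi_isoP T hn).
  by rewrite (epi_iso_suspensionP HJ (Sigma_suspension_unit T n)).
- apply: factorization_ext (interval_factorization HJ) => X Y f; apply: iff_sym.
    exact: (Hext_epi_isoP T hn).
  exact: (Hext_monoP T hn).
- by move=> X Y e; rewrite (Hext_epiP T hn) (Sigma_epiP T hn).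
- move=> X Y m; rewrite (Hext_mono_isoP T hn).
  by rewrite (mono_iso_loopP HJ (Omega_loop_counit T n)).
apply: factorization_ext (interval_factorization_op HJ) => X Y f; apply: iff_sym.
  exact: (Hext_epiP T hn).
exact: (Hext_mono_isoP T hn).
Qed.
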